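(* There exist a constant $c\geq 0$ and, for every constant positive integer $q$, an algorithm that, given an $n$-element set $U$ and three functions $f,g,h:\binom{U}{q}\to\mathbb{Z}$, evaluates $$\Delta(f,g,h)=\sum_{\substack{A,B,C\in\binom{U}{q}\\ A\cap B=A\cap C=B\cap C=\emptyset}} f(A)\,g(B)\,h(C)$$ in time $O\bigl(n^{3q(\frac12-\tau)+c}\bigr)$, where $c$ and $\tau$ are independent of $q$ and $$\tau=\begin{cases}\dfrac{(3-\omega)(1-\alpha)}{36-6(1+\omega)(1+\alpha)} & \text{if }\alpha\leq 1/2,\\[2mm] \dfrac{1}{18} & \text{if }\alpha\geq 1/2.\end{cases}$$
   Context: $\binom{U}{q}$ denotes the set of all $q$-element subsets of $U$. The number $q$ is a constant independent of $n=|U|$ (the constant hidden in $O(\cdot)$ may depend on $q$), and the values of $f,g,h$ are assumed to have bit-length bounded by a fixed polynomial in $n$ that does not depend on $q$. $\omega$ is the limiting exponent of square matrix multiplication, $2\leq\omega<2.3728639$. $\alpha$ is the limiting exponent such that multiplying an $N\times N^\alpha$ matrix with an $N^\alpha\times N$ matrix takes $N^{2+o(1)}$ arithmetic operations, $0.3<\alpha\leq 3-\omega$; one has $\alpha=1$ if and only if $\omega=2$. Convention used in all running times: the product of an $N\times M$ matrix and an $M\times N$ matrix can be computed using (M1) $O(N^{2-\alpha\beta}M^\beta+N^2)$ arithmetic operations when $M\leq N$, where $\beta=(\omega-2)/(1-\alpha)$ (read $\beta=0$ if $\alpha=1$), and (M2) $O(N^{\omega-1}M)$ arithmetic operations when $M\geq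 N$. *)

(* Defs.v *)
From mathcomp Require Import all_boot all_order all_algebra.
From mathcomp Require Import classical_sets reals exp.

Set Implicit Arguments.
Unset Strict Implicit.
Unset Printing Implicit Defensive.

Import Order.TTheory GRing.Theory Num.Theory.
Local Open Scope ring_scope.

(* Algorithms are programs of a random access machine over the integers, in
   structured form and with logarithmic (bit) cost: a primitive operation is
   charged according to the bit lengths of the numbers and of the addresses it
   touches.  Unit cost would be unsound as a notion of time here, since it lets
   a multiplication of huge integers do many multiplications at once. *)

Definition bits (z : int) : nat := (trunc_log 2 `|z|%N).+1.

(* Memory: integer variables, and random access integer arrays. A program
   mentions only finitely many variable and array names; a negative index is
   read as its absolute value. *)
Record state := State { var : nat -> int; arr : nat -> nat -> int }.

Definition set_var (s : state) (x : nat) (v : int) : state :=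
  State (fun y => if y == x then v else var s y) (arr s).

Definition set_arr (s : state) (a i : nat) (v : int) : state :=
  State (var s)
    (fun b j => if (b == a) && (j == i) then v else arr s b j).

Inductive binop := Add | Sub | Mul | Div | Mod | Eq | Le.

Definition eval_op (o : binop) (x y : int) : int :=
  match o with
  | Add => x + y
  | Sub => x - y
  | Mul => x * y
  | Div => (x %/ y)%Z
  | Mod => (x %% y)%Z
  | Eq => Posz (x == y)
  | Le => Posz (x <= y)%R
  end.

Inductive expr :=
  | Const of int
  | Var of nat
  | Get of nat & expr
  | Op of binop & expr & expr.

Fixpoint eval (s : state) (e : expr) : int :=
  match e with
  | Const z => z
  | Var x => var s x
  | Get a i => arr s a `|eval s i|%N
  | Op o e1 e2 => eval_op o (eval s e1) (eval s e2)
  end.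

(* An operation is charged the product of the bit lengths of its operands, as
   for schoolbook multiplication and division. *)
Fixpoint ecost (s : state) (e : expr) : nat :=
  match e with
  | Const z => bits z
  | Var x => bits (var s x)
  | Get a i => (ecost s i + bits (eval s i) + bits (eval s (Get a i)))%N
  | Op o e1 e2 =>
      (ecost s e1 + ecost s e2 + bits (eval s e1) * bits (eval s e2))%N
  end.

Inductive cmd :=
  | Skip
  | Assign of nat & expr
  | Put of nat & expr & expr
  | Seq of cmd & cmd
  | If of expr & cmd & cmd
  | While of expr & cmd.

(* [exec c s s' t]: started in [s], the program [c] halts in [s'] after
   time [t]. *)
Inductive exec : cmd -> state -> state -> nat -> Prop :=
  | ExecSkip s : exec Skip s s 1
  | ExecAssign s x e :
      exec (Assign x e) s (set_var s x (eval s e)) (ecost s e).+1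
  | ExecPut s a i e :
      exec (Put a i e) s (set_arr s a `|eval s i|%N (eval s e))
        (ecost s i + ecost s e).+1
  | ExecSeq c1 c2 s s1 s2 t1 t2 :
      exec c1 s s1 t1 -> exec c2 s1 s2 t2 ->
      exec (Seq c1 c2) s s2 (t1 + t2)
  | ExecIfTrue e c1 c2 s s' t :
      eval s e != 0 -> exec c1 s s' t ->
      exec (If e c1 c2) s s' (ecost s e + t).+1
  | ExecIfFalse e c1 c2 s s' t :
      eval s e = 0 -> exec c2 s s' t ->
      exec (If e c1 c2) s s' (ecost s e + t).+1
  | ExecWhileEnd e c s :
      eval s e = 0 -> exec (While e c) s s (ecost s e).+1
  | ExecWhileStep e c s s1 s2 t1 t2 :
      eval s e != 0 -> exec c s s1 t1 -> exec (While e c) s1 s2 t2 ->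
      exec (While e c) s s2 (ecost s e + t1 + t2).+1.

(* Arithmetic operations are counted by straight-line programs over the
   integers.  The operands of a gate are positions in the list of the values
   available so far, which starts with the inputs. *)

Inductive gate :=
  | GConst of int
  | GAdd of nat & nat
  | GSub of nat & nat
  | GMul of nat & nat.

Definition gate_val (vs : seq int) (g : gate) : int :=
  match g with
  | GConst z => z
  | GAdd i j => vs`_i + vs`_j
  | GSub i j => vs`_i - vs`_j
  | GMul i j => vs`_i * vs`_j
  end.

Definition run (gs : seq gate) (inputs : seq int) : seq int :=
  foldl (fun vs g => rcons vs (gate_val vs g)) inputs gs.

Definition mx_entries (m n : nat) (A : 'M[int]_(m, n)) : seq int :=
  [seq A i j | i <- enum 'I_m, j <- enum 'I_n].

(* [gs] multiplies N x M by M x N matrices; entry (i, j) of the product is the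
   value at position [out (i * N + j)]. *)
Definition mm_slp (N M : nat) (gs : seq gate) (out : nat -> nat) : Prop :=
  forall (A : 'M[int]_(N, M)) (B : 'M[int]_(M, N)) (i j : 'I_N),
    (run gs (mx_entries A ++ mx_entries B))`_(out (i * N + j)%N)
    = (A *m B) i j.

Definition omega (R : realType) : R :=
  inf [set w : R | exists K : R, forall N : nat, (0 < N)%N ->
    exists (gs : seq gate) (out : nat -> nat),
      mm_slp N N gs out /\ (size gs)%:R <= K * N%:R `^ w]%classic.

Definition alpha (R : realType) : R :=
  sup [set a : R | 0 <= a /\
    forall eps : R, 0 < eps -> exists K : R, forall N : nat, (0 < N)%N ->
    exists (gs : seq gate) (out : nat -> nat),
      mm_slp N (Num.truncn (N%:R `^ a : R)) gs out
      /\ (size gs)%:R <= K * N%:R `^ (2 + eps)]%classic.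

Definition beta (R : realType) : R :=
  if alpha R == 1 then 0 else (omega R - 2) / (1 - alpha R).

Definition tau (R : realType) : R :=
  if alpha R <= 1 / 2 then
    (3 - omega R) * (1 - alpha R)
      / (36 - 6 * (1 + omega R) * (1 + alpha R))
  else 1 / 18.

Definition mm_start (N M : nat) : state :=
  State (fun x => match x with 0 => N%:Z | 1 => M%:Z | _ => 0 end)
        (fun _ _ => 0).

(* A straight-line program written in memory: its length is in variable 0, its
   opcodes and operands in arrays 0, 1 and 2, its output positions in array 3. *)
Definition slp_gates (s : state) : seq gate :=
  mkseq (fun k =>
    let x := arr s 1 k in
    let y := arr s 2 k in
    match arr s 0 k with
    | Posz 0 => GConst x
    | Posz 1 => GAdd `|x|%N `|y|%N
    | Posz 2 => GSub `|x|%N `|y|%N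
    | _ => GMul `|x|%N `|y|%N
    end) `|var s 0|%N.

Definition slp_out (s : state) (k : nat) : nat := `|arr s 3 k|%N.

(* For the dimensions in [dom], matrix products can be computed using
   O(bound N M) arithmetic operations by one algorithm: a single program [G]
   finds, from N and M, the operations to perform.  As the numbers that it
   handles to this end are addresses, its bit cost may exceed the operation
   count by a polylogarithmic factor. *)
Definition mm_computable (R : realType) (dom : nat -> nat -> bool)
    (bound : nat -> nat -> R) : Prop :=
  exists (G : cmd) (K : R) (k : nat), forall N M : nat,
    (0 < N)%N -> (0 < M)%N -> dom N M ->
    exists (s : state) (t : nat),
      [/\ exec G (mm_start N M) s t,
          mm_slp N M (slp_gates s) (slp_out s),
          (size (slp_gates s))%:R <= K * bound N M
        & t%:R <= K * bound N M * (bits (N + M)%N%:Z)%:R ^+ k].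

Definition qset (U : finType) (q : nat) := {A : {set U} | #|A| == q}.

Definition Delta (U : finType) (q : nat) (f g h : qset U q -> int) : int :=
  \sum_(A : qset U q) \sum_(B : qset U q) \sum_(C : qset U q
      | [&& [disjoint val A & val B], [disjoint val A & val C]
          & [disjoint val B & val C]])
    f A * g B * h C.

(* The elements of U are numbered 0, ..., n - 1, and a q-subset with elements
   a_0 < ... < a_(q-1) is stored at address a_0 + a_1 n + ... +
   a_(q-1) n^(q-1), which is less than n^q. *)
Definition code (U : finType) (q : nat) (A : qset U q) : nat :=
  foldr (fun (x : U) (acc : nat) => (enum_rank x + #|U| * acc)%N) 0%N
    (enum (val A)).

Definition table (U : finType) (q : nat) (f : qset U q -> int) (k : nat) : int :=
  if [pick A : qset U q | code A == k] is Some A then f A else 0.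

Definition Delta_start (U : finType) (q : nat) (f g h : qset U q -> int) :
    state :=
  State (fun x => if x is 0 then #|U|%:Z else 0)
        (fun a => match a with
                  | 0 => table f
                  | 1 => table g
                  | 2 => table h
                  | _ => fun _ => 0
                  end).

(* Main.v *)
Require Import Defs.
From mathcomp Require Import all_boot all_order all_algebra.
From mathcomp Require Import zify ring lra.
From mathcomp Require Import fingroup perm classical_sets reals exp.

(* Let e be the number of points lying in at least two of the q-sets A, B, C, so
   that the symmetric difference of the three sets has 3q - 2e elements.  With
   chi_A(u) = -1 for u in A and 1 otherwise, a fictitious point n outside all
   sets and weight 1 on u < n, weight 6q - 4i - n on u = n, the sum over
   u <= n of weight * chi_A(u) chi_B(u) chi_C(u) is 4 (e - i).  Multiplying this
   over i = 1, ..., m, the sum over u in [0, n]^m of a product of three numbers,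
   each depending on one of f, g, h only, equals the sum of
   f(A) g(B) h(C) 4^m (e - 1) ... (e - m), up to a constant factor; it takes
   n^m steps and only sees e = 0 and e > m.
   The triples with e > m are subtracted: their points are sorted by which of A, B,
   C they belong to.  The points common to the three sets form an outer loop, the
   private points of the set with the fewest of them are halved between two index
   groups (an odd one joins the outer loop), and the sum becomes the trace of a
   product of n^i x n^k, n^k x n^i and n^i x n^i matrices with k <= i.  Taking
   m = floor(3q(1/2 - tau)) balances the two parts.  All numbers are kept modulo a
   large Q, as arithmetic operations are charged for the length of their operands. *)

Set Implicit Arguments.
Unset Strict Implicit.
Unset Printing Implicit Defensive.

Import Order.TTheory GRing.Theory Num.Theory.
Local Open Scope ring_scope.

(** The weighted sum has about [n ^ m] terms, so each must take a number of operations independent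
    of [n], although it contains the sum of [f(A) chi_A(u_1) ... chi_A(u_m)] over all [A]. As a
    function of a point, the product of these signs differs from 1 at no more than [m] points.
    Writing it as 1 plus a correction and expanding over the [q] positions leaves [(m + 1) ^ q] sums
    of [f] over the tuples that agree with given points in some of the positions; these are
    tabulated beforehand. In the trace, distinctness of all points splits into three conditions, one
    per matrix, because any two of the four groups of points are seen together by one of the
    matrices. For [e > m] the points lying in exactly one or in all three sets number
    [3q - 2e <= 6 tau q], which bounds the index groups. For [alpha <= 1/2], [tau] solves the
    resulting equation of exponents; 1/18 is where the [N ^ 2] cost of the matrix entries alone
    fills the budget. The matrix multiplication program is arbitrary and may leave long numbers in
    memory, but their total length is bounded by its own running time. *)

(** * Bit lengths and the cost of expressions *)

Lemma bits_leP (z : int) (b : nat) : (0 < b)%N ->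
  (bits z <= b)%N = (`|z| < 2 ^ b)%N.
Proof.
move=> b_gt0; rewrite /bits; case: (posnP `|z|%N) => [->|z_gt0].
  by rewrite trunc_log0 b_gt0 expn_gt0.
apply/idP/idP => [le_b|lt_b].
  by apply: leq_trans (trunc_log_ltn `|z| (isT : (1 < 2)%N)) _; rewrite leq_exp2l.
rewrite -(@ltn_exp2l 2) //; apply: leq_ltn_trans lt_b.
exact: trunc_logP.
Qed.

Lemma bits_gt0 z : (0 < bits z)%N. Proof. by []. Qed.

Lemma ltn_bits z : (`|z| < 2 ^ bits z)%N.
Proof. by rewrite -bits_leP. Qed.

Lemma leq_bits x y : (`|x| <= `|y|)%N -> (bits x <= bits y)%N.
Proof. by move=> le_xy; rewrite bits_leP //; apply: leq_ltn_trans (ltn_bits y). Qed.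

Lemma bits_bool (b : bool) : bits (Posz b) = 1%N.
Proof. by case: b. Qed.

Lemma leq_bits_add x y z : (`|z| <= `|x| + `|y|)%N ->
  (bits z <= bits x + bits y)%N.
Proof.
move=> le_z; rewrite bits_leP ?addn_gt0 //; apply: leq_ltn_trans le_z _.
rewrite expnD.
have := ltn_bits x; have := ltn_bits y; rewrite !ltnNge.
have: (1 < 2 ^ bits x)%N by rewrite -{1}(expn0 2) ltn_exp2l.
have: (1 < 2 ^ bits y)%N by rewrite -{1}(expn0 2) ltn_exp2l.
move: (2 ^ _)%N (2 ^ _)%N; nia.
Qed.

Lemma leq_absz_modz x y : y != 0 -> (`|(x %% y)%Z| < `|y|)%N.
Proof. by move=> y_neq0; have := modz_ge0 x y_neq0; have := ltz_mod x y_neq0; lia. Qed.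

Lemma bits_eval_op o x y : (bits (eval_op o x y) <= bits x + bits y)%N.
Proof.
case: o => /=; try by (apply: leq_bits_add; lia).
- rewrite bits_leP // expnD abszM.
  have := ltn_bits x; have := ltn_bits y; nia.
- apply: leq_bits_add; apply: leq_trans (leq_addr _ _); by have := lez_div x y; lia.
- by rewrite bits_bool addn_gt0.
- by rewrite bits_bool addn_gt0.
Qed.

(* Names: variables below 16 and arrays below 8 belong to the main program and
   always hold numbers of at most L bits; other names belong to copies of the
   matrix multiplication program.  Variable 0 holds n, variable 1 the modulus Q.
   A narrow expression evaluates to O(L) bits, so that an affine one, which never
   multiplies two wide values, costs O(L^2) plus O(L) times the lengths of the
   wide values it reads. *)
Fixpoint narrow (e : expr) : bool :=
  match e with
  | Const _ => true
  | Var x => (x < 16)%N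
  | Get a _ => (a < 8)%N
  | Op Eq _ _ | Op Le _ _ => true
  | Op Mod _ (Var 1) => true
  | Op _ e1 e2 => narrow e1 && narrow e2
  end.

Fixpoint affine (pv pa : pred nat) (x : nat) (e : expr) : bool :=
  match e with
  | Const _ => true
  | Var y => (y < 16)%N || pv y
  | Get a i => affine pv pa x i && ((a < 8)%N || pa a && (if i is Var y then y == x else false))
  | Op _ e1 e2 => [&& affine pv pa x e1, affine pv pa x e2 & narrow e1 || narrow e2]
  end.

Fixpoint small (e : expr) : bool :=
  match e with
  | Const _ => true
  | Var y => (y < 16)%N
  | Get a i => (a < 8)%N && small i
  | Op _ e1 e2 => small e1 && small e2
  end.

(** [width] and [weight] are the constants of the two estimates in [affine_cost]: length of the
    value in units of [L] or [L + X], and cost in units of [L * (L + X)]. They depend on the program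
    text alone, hence not on [n]. *)
Fixpoint width (e : expr) : nat :=
  match e with
  | Const z => bits z
  | Var _ | Get _ _ => 1
  | Op _ e1 e2 => width e1 + width e2
  end.

Fixpoint weight (e : expr) : nat :=
  match e with
  | Const z => bits z
  | Var _ => 1
  | Get _ i => weight i + width i + 1
  | Op _ e1 e2 => weight e1 + weight e2 + width e1 * width e2
  end.

Lemma narrow_Op o e1 e2 : narrow (Op o e1 e2) ->
  [\/ narrow e1 && narrow e2, o = Eq \/ o = Le | o = Mod /\ e2 = Var 1].
Proof.
case: o => //=; try by [constructor 1|move=> _; constructor 2; auto].
case: e2; try by constructor 1.
by case=> [|[|x]]; [constructor 1|constructor 3|constructor 1].
Qed.

Lemma small_narrow e : small e -> narrow e.
Proof.
elim: e => //= [a i IH /andP[]//|o e1 IH1 e2 IH2 /andP[/IH1 h1 /IH2 h2]].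
by case: o; rewrite ?h1 ?h2 //; case: e2 {IH2} h2 => // -[|[|]].
Qed.

Lemma small_affine pv pa x e : small e -> affine pv pa x e.
Proof.
elim: e => //= [y -> //|a i IH /andP[-> /IH ->] //|o e1 IH1 e2 IH2 /andP[s1 s2]].
by rewrite IH1 // IH2 // small_narrow.
Qed.

(** Wide arrays are bounded by [X] only at the address held in variable [x]: their entries are short
    on average but not individually, so an iteration has to be charged for the very entry that it
    reads. *)
Lemma affine_cost s L X (pv pa : pred nat) x :
  var s 1 != 0 -> (0 < L)%N ->
  (forall y, (y < 16)%N -> (bits (var s y) <= L)%N) ->
  (forall a k, (a < 8)%N -> (bits (arr s a k) <= L)%N) ->
  (forall y, pv y -> (bits (var s y) <= X)%N) ->
  (forall a, pa a -> (bits (arr s a `|var s x|%N) <= X)%N) ->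
  forall e, affine pv pa x e ->
  (bits (eval s e) <= width e * (if narrow e then L else L + X))%N /\
  (ecost s e <= weight e * (L * (L + X)))%N.
Proof.
move=> Q0 L0 Hv Ha Hwv Hwa; elim => /=.
- by move=> z _; split; rewrite leq_pmulr // muln_gt0 L0 addn_gt0 L0.
- move=> y; case: ltnP => /= [lt_y _|_ py].
    by have := Hv _ lt_y; split; nia.
  by have := Hwv _ py; split; nia.
- move=> a i IH /andP[/IH[IH1 IH2]].
  have {}IH1 : (bits (eval s i) <= width i * (L + X))%N.
    by apply: leq_trans IH1 _; case: (narrow i); rewrite ?leq_mul2l ?leq_addr ?leqnn ?orbT.
  case: ltnP => /= [lt_a _|_ /andP[pa_a]].
    have := Ha a `|eval s i|%N lt_a; split; nia.
  case: i {IH} IH2 IH1 => //= y IH2 IH1 /eqP ?; subst y.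
  have := Hwa _ pa_a; split; nia.
- move=> o e1 IH1 e2 IH2 /and3P[/IH1[b1 c1] /IH2[b2 c2] ns]; split; last first.
    suff: (bits (eval s e1) * bits (eval s e2) <=
           width e1 * width e2 * (L * (L + X)))%N by nia.
    have {ns} : (bits (eval s e1) <= width e1 * L)%N /\ (bits (eval s e2) <= width e2 * (L + X))%N
      \/ (bits (eval s e1) <= width e1 * (L + X))%N /\ (bits (eval s e2) <= width e2 * L)%N.
      case/orP: ns => ns; [left|right]; rewrite ns in b1 b2 *; split=> //.
        by case: (narrow e2) b2; nia.
      by case: (narrow e1) b1; nia.
    by case=> -[h1 h2]; apply: leq_trans (leq_mul h1 h2) _; nia.
  case E: (narrow (Op o e1 e2)); rewrite /= in E; rewrite ?E; last first.
    apply: leq_trans (bits_eval_op _ _ _) _; rewrite mulnDl leq_add //.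
      by case: (narrow e1) b1; nia.
    by case: (narrow e2) b2; nia.
  have [/andP[n1 n2]|oE|[oE e2E]] := narrow_Op E.
  - rewrite n1 n2 in b1 b2; apply: leq_trans (bits_eval_op _ _ _) _; nia.
  (* A comparison has one bit, and [width e1] is not 0 because it bounds a bit length, which is at
     least 1. *)
  - suff -> : bits (eval_op o (eval s e1) (eval s e2)) = 1%N.
      have := bits_gt0 (eval s e1).
      case: (width e1) b1 => [|w] b1 _; last by rewrite mulSn; nia.
      by move: b1; rewrite mul0n leqNgt bits_gt0.
    by case: oE => -> /=; rewrite bits_bool.
  - subst o e2 => /=; have := Hv 1%N isT => h.
    apply: leq_trans (_ : _ <= L)%N _; last by rewrite /= mulnDl mul1n leq_addl.
    by apply: leq_trans h; apply/leq_bits/ltnW/leq_absz_modz.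
Qed.

(** * Executions, their frames, and counting loops *)

Definition runs c s s' (T : nat) := exists2 t, exec c s s' t & (t <= T)%N.

Fixpoint wvars c : seq nat :=
  match c with
  | Assign x _ => [:: x]
  | Seq c1 c2 | If _ c1 c2 => wvars c1 ++ wvars c2
  | While _ c => wvars c
  | _ => [::]
  end.

Fixpoint warrs c : seq nat :=
  match c with
  | Put a _ _ => [:: a]
  | Seq c1 c2 | If _ c1 c2 => warrs c1 ++ warrs c2
  | While _ c => warrs c
  | _ => [::]
  end.

Definition frame (V A : seq nat) s s' :=
  (forall y, y \notin V -> var s' y = var s y) /\
  (forall a, a \notin A -> forall k, arr s' a k = arr s a k).

Lemma frame_trans V A s1 s2 s3 : frame V A s1 s2 -> frame V A s2 s3 -> frame V A s1 s3.
Proof.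
move=> [v12 a12] [v23 a23]; split=> [y yV|a aA k]; first by rewrite v23 ?v12.
by rewrite a23 ?a12.
Qed.

Lemma frame_sub V A V' A' s s' : {subset V <= V'} -> {subset A <= A'} ->
  frame V A s s' -> frame V' A' s s'.
Proof.
move=> sV sA [hv ha]; split=> [y yV|a aA]; first by apply: hv; apply: contra yV => /sV.
by apply: ha; apply: contra aA => /sA.
Qed.

Lemma frame_set_var (V A : seq nat) s x v : x \in V -> frame V A s (set_var s x v).
Proof.
by move=> xV; split=> //= y; case: eqP => // ->; rewrite xV.
Qed.

Lemma exec_frame c s s' t : exec c s s' t -> frame (wvars c) (warrs c) s s'.
Proof.
elim=> {c s s' t} //=.
- by move=> s x e; apply: frame_set_var; rewrite inE.
- by move=> s a i e; split=> //= b; rewrite inE => /negPf-> k.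
- move=> c1 c2 s s1 s2 _ _ _ f1 _ f2.
  by apply: frame_trans (frame_sub _ _ f1) (frame_sub _ _ f2) => x; rewrite mem_cat => ->; rewrite ?orbT.
- by move=> *; apply: frame_sub; last eassumption; move=> x; rewrite mem_cat => ->.
- by move=> *; apply: frame_sub; last eassumption; move=> x; rewrite mem_cat => ->; rewrite orbT.
- by move=> e c s s1 s2 t1 t2 _ _ f1 _ f2; apply: frame_trans f1 f2.
Qed.

Lemma runs_frame c s s' T : runs c s s' T -> frame (wvars c) (warrs c) s s'.
Proof. by case=> t /exec_frame. Qed.

Definition modQ e := Op Mod e (Var 1).

Definition is_modQ e := if e is Op Mod _ (Var 1) then true else false.

(** Decidable from the text of a program, it makes [base] an invariant without reasoning about
    values. Names from 16 and 8 on are exempt since a foreign program may leave anything there. *)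
Fixpoint reduced c : bool :=
  match c with
  | Skip => true
  | Assign x e => (16 <= x)%N || (1 < x)%N && is_modQ e
  | Put a _ e => (8 <= a)%N || (2 < a)%N && is_modQ e
  | Seq c1 c2 | If _ c1 c2 => reduced c1 && reduced c2
  | While _ c => reduced c
  end.

Record base (n Q L : nat) (inp : nat -> nat -> int) s : Prop := Base {
  base0 : var s 0 = n;
  base1 : var s 1 = Q;
  base_var : forall x, (x < 16)%N -> (bits (var s x) <= L)%N;
  base_arr : forall a k, (a < 8)%N -> (bits (arr s a k) <= L)%N;
  base_inp : forall a k, (a < 3)%N -> arr s a k = inp a k }.

Lemma bits_modQ n Q L inp s e : (0 < Q)%N -> base n Q L inp s ->
  is_modQ e -> (bits (eval s e) <= L)%N.
Proof.
move=> Q0 bs; case: e => // -[] // e [] // [|[]] // _ /=.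
apply: leq_trans (base_var bs (isT : (1 < 16)%N)).
by apply/leq_bits/ltnW/leq_absz_modz; rewrite (base1 bs); lia.
Qed.

Lemma base_set_var n Q L inp s x v : base n Q L inp s ->
  (16 <= x)%N || (1 < x)%N && (bits v <= L)%N -> base n Q L inp (set_var s x v).
Proof.
move=> [b0 b1 bv ba bi] hx; split=> //=.
- by case: eqP hx => // <-.
- by case: eqP hx => // <-.
- move=> y lt_y; case: eqP => [yx|_]; last exact: bv.
  by move: hx; rewrite -yx leqNgt lt_y /= => /andP[].
Qed.

Lemma base_set_arr n Q L inp s a i v : base n Q L inp s ->
  (8 <= a)%N || (2 < a)%N && (bits v <= L)%N -> base n Q L inp (set_arr s a i v).
Proof.
move=> [b0 b1 bv ba bi] hx; split=> //=.
- move=> b k lt_b; case: eqP => [ba'|_] /=; last exact: ba.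
  case: eqP => _; last exact: ba.
  by move: hx; rewrite -ba' leqNgt lt_b /= => /andP[].
- move=> b k lt_b; case: eqP => [ba'|_] /=; last exact: bi.
  by move: hx lt_b; rewrite -ba' => hx lt_b; exfalso; move: hx; case: (bits v <= L)%N; lia.
Qed.

Lemma exec_base n Q L inp c s s' t : (0 < Q)%N -> reduced c ->
  exec c s s' t -> base n Q L inp s -> base n Q L inp s'.
Proof.
move=> Q0 + ex; elim: ex => {c s s' t} //=.
- move=> s x e /orP[h|/andP[x1 me]] bs; apply: base_set_var => //; first by rewrite h.
  by rewrite x1 (bits_modQ Q0 bs) ?orbT.
- move=> s a i e /orP[h|/andP[x1 me]] bs; apply: base_set_arr => //; first by rewrite h.
  by rewrite x1 (bits_modQ Q0 bs) ?orbT.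
- by move=> c1 c2 s s1 s2 _ _ _ IH1 _ IH2 /andP[g1 g2] /(IH1 g1)/(IH2 g2).
- by move=> ? ? ? ? ? ? _ _ IH /andP[g1 _] /(IH g1).
- by move=> ? ? ? ? ? ? _ _ IH /andP[_ g2] /(IH g2).
- by move=> e c s s1 s2 t1 t2 _ _ IH1 _ IH2 g /(IH1 g)/(IH2 g).
Qed.

Lemma small_cost n Q L inp s e : (0 < Q)%N -> base n Q L inp s -> small e ->
  (bits (eval s e) <= width e * L)%N /\ (ecost s e <= weight e * L ^ 2)%N.
Proof.
move=> Q0 bs se.
have L0 : (0 < L)%N by apply: leq_trans (base_var bs (isT : (0 < 16)%N)).
have := @affine_cost s L 0 pred0 pred0 0 _ L0 (base_var bs) (base_arr bs).
rewrite (base1 bs) addn0 => /(_ _ _ _ e) [||||]//; first by lia.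
  exact: small_affine.
by rewrite small_narrow // => h1 h2; split.
Qed.

(** The counter is reduced modulo [Q] to comply with [reduced], so the loop bound has to stay below
    [Q]. The test [x + 1 <= e] expresses the strict inequality [x < e]. *)
Definition upto x e c :=
  Seq (Assign x (modQ (Const 0)))
    (While (Op Le (Op Add (Var x) (Const 1)) e)
       (Seq c (Assign x (modQ (Op Add (Var x) (Const 1)))))).

Definition upto_cost e := (weight e + 2 * width e + 20)%N.

(** The cost [T i] may vary with the iteration, which lets short iterations pay for long ones. The
    invariant is asked for after the counter has moved on, and [e] has to keep its value on every
    state that differs from [s0] only where the loop writes. *)
Lemma runs_upto n Q L inp x e c B (T : nat -> nat) (J : nat -> state -> Prop) s0 :
  base n Q L inp s0 -> (1 < x < 16)%N -> reduced c -> x \notin wvars c ->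
  small e -> (B < Q)%N ->
  (forall s, base n Q L inp s -> frame (x :: wvars c) (warrs c) s0 s ->
     eval s e = B) ->
  J 0%N (set_var s0 x 0) ->
  (forall i s, (i < B)%N -> base n Q L inp s ->
     frame (x :: wvars c) (warrs c) s0 s -> var s x = i -> J i s ->
     exists s', runs c s s' (T i) /\ J i.+1 (set_var s' x i.+1)) ->
  exists s', [/\ runs (upto x e c) s0 s'
                   (upto_cost e * L ^ 2 * B.+1 + \sum_(i < B) T i),
                 base n Q L inp s' & J B s'].
Proof.
move=> bs0 /andP[x1 x16] red_c xc se BQ eB J0 JS.
have Q0 : (0 < Q)%N by apply: leq_trans BQ.
have L0 : (0 < L)%N by apply: leq_trans (base_var bs0 (isT : (0 < 16)%N)).
pose cond := Op Le (Op Add (Var x) (Const 1)) e.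
pose body := Seq c (Assign x (modQ (Op Add (Var x) (Const 1)))).
have scond : small cond by rewrite /= x16 se.
have sinc : small (modQ (Op Add (Var x) (Const 1))) by rewrite /= x16.
pose W := upto_cost e.
have ccond s : base n Q L inp s -> ((ecost s cond).+1 <= (weight e + 2 * width e + 8) * L ^ 2)%N.
  move=> bs; have [_] := small_cost Q0 bs scond.
  have -> : weight cond = (3 + weight e + 2 * width e)%N by [].
  by have : (0 < L ^ 2)%N by [rewrite expn_gt0 L0]; nia.
(* Induction on the number [k] of iterations left, since a derivation of [exec] unfolds a loop from
   its first iteration. *)
have key k : forall s, (k <= B)%N -> base n Q L inp s ->
    frame (x :: wvars c) (warrs c) s0 s -> var s x = (B - k)%N ->
    J (B - k)%N s ->
    exists2 s', runs (While cond body) s s'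
        (W * L ^ 2 * k + \sum_(B - k <= i < B) T i + (weight e + 2 * width e + 8) * L ^ 2)%N
      & J B s'.
  elim: k => [|k IH] s kB bs fs xs Js.
    rewrite subn0 in xs Js; exists s => //; exists (ecost s cond).+1.
      by apply: ExecWhileEnd; rewrite /= xs (eB s) //; case: lerP => //; lia.
    by rewrite -addnA; apply: leq_trans (leq_addl _ _); apply: leq_trans (ccond _ bs) (leq_addl _ _).
  have iB : (B - k.+1 < B)%N by lia.
  have [s' [[t et tT] J']] := JS _ _ iB bs fs xs Js.
  have iS : (B - k.+1).+1 = (B - k)%N by lia.
  have f' := exec_frame et.
  have xs' : var s' x = (B - k.+1)%N by case: f' => -> //.
  have bs' := exec_base Q0 red_c et bs.
  pose s2 := set_var s' x (eval s' (modQ (Op Add (Var x) (Const 1)))).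
  have ev : eval s' (modQ (Op Add (Var x) (Const 1))) = (B - k)%N.
    rewrite /= xs' (base1 bs') (_ : _ + 1 = Posz (B - k)); last by lia.
    by rewrite modz_small //; lia.
  have fs2 : frame (x :: wvars c) (warrs c) s0 s2.
    apply: frame_trans fs _; apply: frame_trans (frame_set_var _ _ _ _); last by rewrite inE eqxx.
    by apply: frame_sub f' => y; rewrite // inE => ->; rewrite orbT.
  have bs2 : base n Q L inp s2.
    by apply: base_set_var => //; rewrite x1 (bits_modQ Q0 bs') ?orbT.
  have [|||s3 [t3 e3 T3] J3] := IH s2 _ bs2 fs2; first by lia.
  - by rewrite /= eqxx; exact: ev.
  - by rewrite /s2 ev -iS.
  exists s3 => //; eexists.
    apply: ExecWhileStep; last exact: e3.
      by rewrite /= xs (eB s) //; case: lerP => //; lia.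
    by apply: ExecSeq; [exact: et|apply: ExecAssign].
  have [_] := small_cost Q0 bs' sinc; have := ccond _ bs.
  have -> : weight (modQ (Op Add (Var x) (Const 1))) = 6%N by [].
  move=> h1 h2.
  rewrite (big_cat_nat (n := B - k)); [|by lia|by lia].
  rewrite -iS big_nat1 iS.
  have : (W * L ^ 2 * k.+1 = W * L ^ 2 * k + (weight e + 2 * width e + 20) * L ^ 2)%N.
    by rewrite mulnS addnC.
  have L2 : (0 < L ^ 2)%N by rewrite expn_gt0 L0.
  move: h1 h2 L2 T3 tT; rewrite -/cond.
  move: (ecost s cond) (ecost s' _) (\sum_(_ <= i < _) _)%N (L ^ 2)%N => a1 a2 a3 a4.
  by rewrite /=; lia.
have bs1 : base n Q L inp (set_var s0 x 0) by apply: base_set_var => //; rewrite x1 (leq_trans _ L0) ?orbT.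
have [|||s' [t et tT] J'] := key B (set_var s0 x 0) (leqnn B) bs1.
- by apply: frame_set_var; rewrite inE eqxx.
- by rewrite subnn /= eqxx.
- by rewrite subnn.
have e0 : exec (Assign x (modQ (Const 0))) s0 (set_var s0 x 0) (ecost s0 (modQ (Const 0))).+1.
  have {2}-> : (0 : int) = eval s0 (modQ (Const 0)) by rewrite /= mod0z.
  exact: ExecAssign.
exists s'; split=> //; last first.
  by apply: exec_base bs1; [exact: Q0| |exact: et]; rewrite /= red_c x1 orbT.
exists ((ecost s0 (modQ (Const 0))).+1 + t)%N; first exact: ExecSeq e0 et.
have [_] := small_cost Q0 bs0 (isT : small (modQ (Const 0))).
have -> : weight (modQ (Const 0)) = 3%N by [].
move=> h.
move: tT; rewrite subnn big_mkord /W /upto_cost; have L2 : (0 < L ^ 2)%N by rewrite expn_gt0 L0.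
nia.
Qed.

(** * Renamed copies of a program, and the length of what it writes *)

Fixpoint rename_expr (r : nat -> nat) e :=
  match e with
  | Const z => Const z
  | Var x => Var (r x)
  | Get a i => Get (r a) (rename_expr r i)
  | Op o e1 e2 => Op o (rename_expr r e1) (rename_expr r e2)
  end.

Fixpoint rename (r : nat -> nat) c :=
  match c with
  | Skip => Skip
  | Assign x e => Assign (r x) (rename_expr r e)
  | Put a i e => Put (r a) (rename_expr r i) (rename_expr r e)
  | Seq c1 c2 => Seq (rename r c1) (rename r c2)
  | If e c1 c2 => If (rename_expr r e) (rename r c1) (rename r c2)
  | While e c => While (rename_expr r e) (rename r c)
  end.

Definition renamed (r : nat -> nat) s s1 :=
  (forall x, var s1 (r x) = var s x) /\ (forall a k, arr s1 (r a) k = arr s a k).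

Lemma eval_rename r s s1 e : renamed r s s1 ->
  eval s1 (rename_expr r e) = eval s e /\ ecost s1 (rename_expr r e) = ecost s e.
Proof.
move=> [rv ra]; elim: e => //=.
- by move=> x; rewrite rv.
- by move=> a i [-> ->]; rewrite ra.
- by move=> o e1 [-> ->] e2 [-> ->].
Qed.

(** Time carries over exactly: costs depend on values and array indices, never on names. Injectivity
    of [r] keeps distinct cells apart. *)
Lemma exec_rename r c s s' t : injective r -> exec c s s' t ->
  forall s1, renamed r s s1 ->
  exists2 s1', exec (rename r c) s1 s1' t & renamed r s' s1'.
Proof.
move=> rI; elim=> {c s s' t} /=.
- by move=> s s1 rs; exists s1 => //; apply: ExecSkip.
- move=> s x e s1 rs; have [ev ec] := eval_rename e rs; rewrite -ec -ev.
  eexists; first exact: ExecAssign.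
  by case: rs => rv ra; split=> //= y; rewrite (inj_eq rI) rv.
- move=> s a i e s1 rs; have [ev ec] := eval_rename e rs; have [iv ic] := eval_rename i rs.
  rewrite -ec -ev -iv -ic; eexists; first exact: ExecPut.
  by case: rs => rv ra; split=> //= b k; rewrite (inj_eq rI) ra.
- move=> c1 c2 s s1 s2 t1 t2 _ IH1 _ IH2 z1 /IH1[z2 e1 /IH2[z3 e2 r3]].
  by exists z3 => //; apply: ExecSeq e1 e2.
- move=> e c1 c2 s s' t ev _ IH s1 rs; have [ev' ec] := eval_rename e rs.
  have [s1' e1 r1] := IH _ rs; exists s1' => //; rewrite -ec; apply: ExecIfTrue => //.
  by rewrite ev'.
- move=> e c1 c2 s s' t ev _ IH s1 rs; have [ev' ec] := eval_rename e rs.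
  have [s1' e1 r1] := IH _ rs; exists s1' => //; rewrite -ec; apply: ExecIfFalse => //.
  by rewrite ev'.
- move=> e c s ev s1 rs; have [ev' ec] := eval_rename e rs.
  by exists s1 => //; rewrite -ec; apply: ExecWhileEnd; rewrite ev'.
- move=> e c s s1 s2 t1 t2 ev _ IH1 _ IH2 z1 rs; have [ev' ec] := eval_rename e rs.
  have [z2 e1 /IH2[z3 e2 r3]] := IH1 _ rs; exists z3 => //.
  by rewrite -ec; apply: ExecWhileStep e1 e2; rewrite ev'.
Qed.

Lemma wvars_rename r c : wvars (rename r c) = map r (wvars c).
Proof. by elim: c => //= [c1 -> c2 ->|_ c1 -> c2 ->]; rewrite map_cat. Qed.

Lemma warrs_rename r c : warrs (rename r c) = map r (warrs c).
Proof. by elim: c => //= [c1 -> c2 ->|_ c1 -> c2 ->]; rewrite map_cat. Qed.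

(** Each operand has at least one bit, so the sum of the two lengths, which bounds the length of the
    result, is at most twice the product that is charged. *)
Lemma bits_leq_cost s e : (bits (eval s e) <= 2 * ecost s e)%N.
Proof.
elim: e => /= [z|x|a i IH|o e1 IH1 e2 IH2]; try by lia.
apply: leq_trans (bits_eval_op _ _ _) _.
have := bits_gt0 (eval s e1); have := bits_gt0 (eval s e2); nia.
Qed.

(* Writing a number costs at least half its bit length, so whatever the program
   leaves in memory is short on average. *)
Lemma sum_bits_exec c s s' t (a B : nat) : exec c s s' t ->
  (\sum_(k < B) bits (arr s' a k) <= \sum_(k < B) bits (arr s a k) + 2 * t)%N.
Proof.
elim=> {c s s' t} //=; try by move=> *; lia.
move=> s b i e; set j := `|_|%N; set v := eval s e.
have le_v : (bits v <= 2 * ecost s e)%N by apply: bits_leq_cost.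
apply: leq_trans (_ : \sum_(k < B) (bits (arr s a k) + (val k == j) * bits v) <= _)%N.
  apply: leq_sum => k _; case: (k == j :> nat); rewrite ?andbF ?leq_addr //.
  by case: (a == b) => /=; rewrite ?mul1n ?leq_addl ?leq_addr.
rewrite big_split leq_add2l /= -big_distrl /=.
suff h : (\sum_(k < B) (val k == j) <= 1)%N by apply: leq_trans (leq_mul h (leqnn _)) _; lia.
rewrite -big_mkcond /= sum1_card; case: (ltnP j B) => jB.
  by rewrite (@eq_card1 _ (Ordinal jB)) // => k; rewrite !inE -val_eqE.
by rewrite eq_card0 // => k; rewrite !inE; apply/eqP; have := ltn_ord k; lia.
Qed.

(** * Expressions for digits, sets and table entries *)

Definition dig (b x j : nat) : nat := ((x %/ b ^ j) %% b)%N.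

Definition Esum es := foldr (Op Add) (Const 0) es.
Definition Eprod es := foldr (Op Mul) (Const 1) es.
Definition Epow e j := iter j (Op Mul e) (Const 1).
Definition Edig eb ex j := Op Mod (Op Div ex (Epow eb j)) eb.
Definition Eneq e1 e2 := Op Defs.Sub (Const 1) (Op Eq e1 e2).
Definition Elt e1 e2 := Op Le (Op Add e1 (Const 1)) e2.

Fixpoint Euniq es :=
  if es is e :: es' then Op Mul (Eprod [seq Eneq e e' | e' <- es']) (Euniq es')
  else Const 1.

(** The factor [1 + [e' < e] (n - 1)] is [n] or 1, so the product is [n] to the number of smaller
    elements: a power with a data-dependent exponent, obtained without a loop. *)
Definition Erank_pow e es :=
  Eprod [seq Op Add (Const 1) (Op Mul (Elt e' e) (Op Defs.Sub (Var 0) (Const 1)))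
        | e' <- es].
Definition Ercode es := Esum [seq Op Mul e (Erank_pow e es) | e <- es].
(** The factor [Euniq] silences tuples with repetitions, so no branching is required and the address
    may be meaningless in that case. *)
Definition Elook a vis sel := Op Mul (Euniq vis) (Get a (Ercode sel)).

(* Address of the set {x | x \in l}: its elements are ordered by counting,
   so that no sorting is needed. *)
Definition rcode (n : nat) (l : seq nat) : nat :=
  (\sum_(x <- l) x * n ^ count (fun y => y < x) l)%N.

Lemma eval_Esum s es : eval s (Esum es) = \sum_(e <- es) eval s e.
Proof. by elim: es => [|e es IH] /=; rewrite ?big_nil // big_cons -IH. Qed.

Lemma eval_Eprod s es : eval s (Eprod es) = \prod_(e <- es) eval s e.
Proof. by elim: es => [|e es IH] /=; rewrite ?big_nil // big_cons -IH. Qed.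

Lemma eval_Epow s e j : eval s (Epow e j) = eval s e ^+ j.
Proof. by elim: j => //= j IH; rewrite exprS -IH. Qed.

Lemma eval_Edig s eb ex j (b x : nat) : eval s eb = b -> eval s ex = x ->
  eval s (Edig eb ex j) = dig b x j.
Proof.
move=> hb hx; rewrite /= eval_Epow hb hx (_ : _ ^+ j = Posz (b ^ j)); last by rewrite -!natz natrX.
by rewrite divz_nat modz_nat.
Qed.

Lemma eval_Eneq s e1 e2 : eval s (Eneq e1 e2) = (eval s e1 != eval s e2).
Proof. by rewrite /=; case: eqP. Qed.

Lemma eval_Elt s e1 e2 : eval s (Elt e1 e2) = (eval s e1 < eval s e2).
Proof. by rewrite /=; congr (Posz (nat_of_bool _)); rewrite lezD1. Qed.

Lemma eval_Euniq s es : eval s (Euniq es) = uniq (map (eval s) es).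
Proof.
elim: es => //= e es ->; rewrite eval_Eprod big_map.
have -> : \prod_(e' <- es) eval s (Eneq e e') = (eval s e \notin map (eval s) es).
  elim: es => [|e' es IH]; first by rewrite big_nil.
  by rewrite big_cons eval_Eneq IH /= inE negb_or; case: (_ != _) => //=; rewrite mul1r.
by case: (_ \notin _); rewrite ?mul1r ?mul0r.
Qed.

Lemma eval_Ercode s (n : nat) es l : var s 0 = n -> (0 < n)%N ->
  map (eval s) es = map Posz l -> eval s (Ercode es) = rcode n l.
Proof.
move=> v0 n0 esl; rewrite eval_Esum big_map /rcode.
have rk (e : expr) (x : nat) : eval s e = x ->
    eval s (Erank_pow e es) = (n ^ count (fun y => (y < x)%N) l)%N.
  move=> ex; rewrite eval_Eprod big_map.
  transitivity (\prod_(z <- map (eval s) es) (1 + Posz (z < x :> int) * (n%:Z - 1))).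
    rewrite big_map; apply: eq_bigr => e' _.
    by rewrite [LHS]/(1 + eval s (Elt e' e) * (var s 0 - 1)) eval_Elt v0 ex.
  rewrite esl big_map; elim: (l) => [|y l' IH]; first by rewrite big_nil.
  rewrite big_cons IH /= ltz_nat expnD PoszM; case: (y < x)%N => /=.
    by rewrite mul1r addrC subrK expn1.
  by rewrite mul0r addr0 expn0.
(* The ranks refer to the whole list [es], so the induction runs over a separate list. *)
have: forall es' l', map (eval s) es' = map Posz l' ->
    \sum_(e <- es') eval s (Op Mul e (Erank_pow e es)) =
    (\sum_(x <- l') x * n ^ count (fun y => y < x) l)%N.
  elim=> [|e es' IH] [|x l'] //=; first by rewrite !big_nil.
  by case=> ex esl'; rewrite !big_cons (IH l') //= (rk _ x) // ex PoszD PoszM.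
exact.
Qed.

Lemma eval_Elook s (n : nat) a vis sel lv ls : var s 0 = n -> (0 < n)%N ->
  map (eval s) vis = map Posz lv -> map (eval s) sel = map Posz ls ->
  eval s (Elook a vis sel) = Posz (uniq lv) * arr s a (rcode n ls).
Proof.
move=> v0 n0 hv hs.
rewrite [LHS]/(eval s (Euniq vis) * arr s a `|eval s (Ercode sel)|%N).
rewrite eval_Euniq hv map_inj_uniq; last by move=> x y [].
by rewrite (eval_Ercode v0 n0 hs).
Qed.

Lemma small_Esum es : small (Esum es) = all small es.
Proof. by elim: es => //= e es ->. Qed.

Lemma small_Eprod es : small (Eprod es) = all small es.
Proof. by elim: es => //= e es ->. Qed.

Lemma small_Epow e j : small e -> small (Epow e j).
Proof. by move=> se; elim: j => //= j ->; rewrite se. Qed.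

Lemma small_Edig eb ex j : small eb -> small ex -> small (Edig eb ex j).
Proof. by move=> sb sx; rewrite /= sb sx small_Epow. Qed.

Lemma small_Euniq es : all small es -> small (Euniq es).
Proof.
elim: es => //= e es IH /andP[se ss]; rewrite IH // small_Eprod all_map andbT.
by apply: sub_all ss => e' /=; rewrite se.
Qed.

Lemma small_Ercode es : all small es -> small (Ercode es).
Proof.
move=> ss; rewrite small_Esum all_map; apply: sub_all (ss) => e se /=.
rewrite se small_Eprod all_map; apply: sub_all ss => e' /= ->.
by rewrite se.
Qed.

Lemma small_Elook a vis sel : (a < 8)%N -> all small vis -> all small sel ->
  small (Elook a vis sel).
Proof. by move=> a8 sv ss; rewrite /= a8 small_Euniq // small_Ercode. Qed.

Definition Eentry a vis sel ez :=
  Elook a [seq Edig (Var 0) ez j | j <- vis] [seq Edig (Var 0) ez j | j <- sel].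

Definition entry (tab : nat -> int) n vis sel z : int :=
  Posz (uniq (map (dig n z) vis)) * tab (rcode n (map (dig n z) sel)).

Lemma eval_Eentry s (n z : nat) a vis sel ez : var s 0 = n -> (0 < n)%N ->
  eval s ez = z -> eval s (Eentry a vis sel ez) = entry (arr s a) n vis sel z.
Proof.
move=> v0 n0 hz; apply: eval_Elook => //; rewrite -!map_comp; apply: eq_map => j;
  exact: eval_Edig.
Qed.

Lemma small_Eentry a vis sel ez : (a < 8)%N -> small ez -> small (Eentry a vis sel ez).
Proof.
move=> a8 sz; apply: small_Elook => //; rewrite all_map; apply/allP => j _;
  exact: small_Edig.
Qed.

(** * Congruence modulo Q; loops that store or accumulate *)

Definition eqm (Q : nat) (a b : int) := (a = b %[mod Q])%Z.

Lemma eqm_modQ Q a b : eqm Q a b -> eqm Q (a %% Q)%Z b.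
Proof. by rewrite /eqm modz_mod. Qed.

Lemma eqmD Q a b c d : eqm Q a b -> eqm Q c d -> eqm Q (a + c) (b + d).
Proof. by rewrite /eqm => h1 h2; rewrite -modzDm h1 h2 modzDm. Qed.

Lemma eqmM Q a b c d : eqm Q a b -> eqm Q c d -> eqm Q (a * c) (b * d).
Proof. by rewrite /eqm => h1 h2; rewrite -modzMm h1 h2 modzMm. Qed.

Lemma eqmN Q a b : eqm Q a b -> eqm Q (- a) (- b).
Proof. by move=> h; rewrite -(mulN1r a) -(mulN1r b); apply: eqmM. Qed.

Lemma eqmB Q a b c d : eqm Q a b -> eqm Q c d -> eqm Q (a - c) (b - d).
Proof. by move=> h1 /eqmN; apply: eqmD. Qed.

Lemma eqm_sum Q (I : Type) (r : seq I) (P : pred I) (F G : I -> int) :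
  (forall i, P i -> eqm Q (F i) (G i)) ->
  eqm Q (\sum_(i <- r | P i) F i) (\sum_(i <- r | P i) G i).
Proof. by move=> h; elim/big_ind2: _ => // *; exact: eqmD. Qed.

Definition fill x e a ea body := upto x e (Put a ea (modQ body)).

(** Entries are appended from position [S] on, and iteration [i] may rely on all positions below
    [S + i]; this is what evaluating gates one after the other requires. *)
Lemma runs_fill n Q L inp x e a ea body B T (v : nat -> int) (S : nat) s0 :
  base n Q L inp s0 -> (1 < x < 16)%N -> (2 < a < 8)%N -> small e -> (B < Q)%N ->
  (forall s, base n Q L inp s -> frame [:: x] [:: a] s0 s -> eval s e = B) ->
  (forall p, (p < S)%N -> eqm Q (arr s0 a p) (v p)) ->
  (forall i s, (i < B)%N -> base n Q L inp s -> frame [:: x] [:: a] s0 s ->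
     var s x = i -> (forall p, (p < S + i)%N -> eqm Q (arr s a p) (v p)) ->
     [/\ eval s ea = (S + i)%N, eqm Q (eval s body) (v (S + i)%N)
       & (ecost s ea + ecost s (modQ body) < T i)%N]) ->
  exists s', [/\ runs (fill x e a ea body) s0 s'
                   (upto_cost e * L ^ 2 * B.+1 + \sum_(i < B) T i),
                 base n Q L inp s'
               & forall p, (p < S + B)%N -> eqm Q (arr s' a p) (v p)].
Proof.
move=> bs0 hx /andP[a2 a8] se BQ eB v0 vS.
pose J i s := forall p, (p < S + i)%N -> eqm Q (arr s a p) (v p).
apply: (runs_upto (J := J)) => //=.
- by rewrite a2 orbT.
- by rewrite /J addn0.
- move=> i s iB bs fs xi Ji; have [ha hv hT] := vS _ _ iB bs fs xi Ji.
  exists (set_arr s a `|eval s ea|%N (eval s (modQ body))); split.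
    by eexists; [exact: ExecPut|].
  move=> p /=; rewrite eqxx ha /= addnS ltnS leq_eqVlt.
  case: eqP => [-> _|_ /=]; last exact: Ji.
  by rewrite /= (base1 bs); apply: eqm_modQ.
Qed.

Definition sumup x e acc body := upto x e (Assign acc (modQ (Op Add (Var acc) body))).

Lemma runs_sumup n Q L inp x e acc body B T (v : nat -> int) s0 :
  base n Q L inp s0 -> (1 < x < 16)%N -> (1 < acc < 16)%N -> x != acc ->
  small e -> (B < Q)%N ->
  (forall s, base n Q L inp s -> frame [:: x; acc] [::] s0 s -> eval s e = B) ->
  (forall i s, (i < B)%N -> base n Q L inp s -> frame [:: x; acc] [::] s0 s ->
     var s x = i ->
     eqm Q (eval s body) (v i) /\
     (ecost s (modQ (Op Add (Var acc) body)) < T i)%N) ->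
  exists s', [/\ runs (sumup x e acc body) s0 s'
                   (upto_cost e * L ^ 2 * B.+1 + \sum_(i < B) T i),
                 base n Q L inp s'
               & eqm Q (var s' acc) (var s0 acc + \sum_(i < B) v i)].
Proof.
move=> bs0 hx /andP[a2 a8] xacc se BQ eB vS.
pose J i s := eqm Q (var s acc) (var s0 acc + \sum_(k < i) v k).
apply: (runs_upto (J := J)) => //=.
- by rewrite a2 orbT.
- by rewrite inE.
- by rewrite /J /= eq_sym (negPf xacc) big_ord0 addr0.
- move=> i s iB bs fs xi Ji; have [hv hT] := vS _ _ iB bs fs xi.
  eexists; split; first by eexists; [exact: ExecAssign|exact: hT].
  rewrite /J /= eq_sym (negPf xacc) eqxx (base1 bs) big_ord_recr /= addrA.
  by apply: eqm_modQ; apply: eqmD.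
Qed.

(** * Evaluating straight-line programs stored in memory *)

Lemma run_rcons gs g inputs : run (rcons gs g) inputs =
  rcons (run gs inputs) (gate_val (run gs inputs) g).
Proof. by rewrite /run -cats1 foldl_cat. Qed.

Lemma size_run gs inputs : size (run gs inputs) = (size inputs + size gs)%N.
Proof.
elim/last_ind: gs => [|gs g IH]; first by rewrite addn0.
by rewrite run_rcons !size_rcons IH addnS.
Qed.

Lemma run_inputs gs inputs p : (p < size inputs)%N -> (run gs inputs)`_p = inputs`_p.
Proof.
move=> lt_p; elim/last_ind: gs => [|gs g IH] //.
by rewrite run_rcons nth_rcons size_run (leq_trans lt_p (leq_addr _ _)).
Qed.

(** The truncation to the first [p] values matters: an operand pointing at a value not computed yet
    reads 0 when its gate is evaluated, whatever the final list holds there. *)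
Lemma nth_run gs inputs k : (k < size gs)%N ->
  let V := run gs inputs in let p := (size inputs + k)%N in
  V`_p = gate_val [seq V`_i | i <- iota 0 p] (nth (GConst 0) gs k).
Proof.
elim/last_ind: gs => [|gs g IH] //= ; rewrite size_rcons ltnS leq_eqVlt => lt_k.
have szr := size_run gs inputs.
have E : [seq (run (rcons gs g) inputs)`_i | i <- iota 0 (size inputs + k)] =
         [seq (run gs inputs)`_i | i <- iota 0 (size inputs + k)].
  apply/eq_in_map => i; rewrite mem_iota add0n /= => lt_i.
  by rewrite run_rcons nth_rcons szr; case: ltnP => //; case/orP: lt_k => [/eqP|]; lia.
rewrite E run_rcons !nth_rcons szr ltn_add2l; case/orP: lt_k => [/eqP ->|lt_k].
  rewrite ltnn !eqxx; congr gate_val; apply: (@eq_from_nth _ 0) => [|i].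
    by rewrite size_map size_iota szr.
  by rewrite szr => lt_i; rewrite (nth_map 0%N) ?size_iota // nth_iota.
by rewrite lt_k IH.
Qed.

Lemma nth_iota_map (V : nat -> int) p i :
  [seq V j | j <- iota 0 p]`_i = if (i < p)%N then V i else 0.
Proof.
case: ltnP => h; last by rewrite nth_default // size_map size_iota.
by rewrite (nth_map 0%N) ?size_iota // nth_iota.
Qed.

(* Operands that are not available yet count as 0. *)
Definition Eabslt x p :=
  Op Mul (Op Le (Op Defs.Sub (Const 1) p) x) (Op Le x (Op Defs.Sub p (Const 1))).
Definition Eread a x p := Op Mul (Eabslt x p) (Get a x).

Lemma eval_Eread s a x p (m : nat) : eval s p = m ->
  eval s (Eread a x p) =
    if (`|eval s x| < m)%N then arr s a `|eval s x|%N else 0.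
Proof.
move=> hp.
have -> : eval s (Eread a x p) = Posz (1 - eval s p <= eval s x)%R *
   Posz (eval s x <= eval s p - 1)%R * arr s a `|eval s x|%N by [].
rewrite hp; case: ifP => h.
  have -> : 1 - Posz m <= eval s x by lia.
  have -> : eval s x <= Posz m - 1 by lia.
  by rewrite !mul1r.
have : ~~ ((1 - Posz m <= eval s x) && (eval s x <= Posz m - 1)) by apply/negP; lia.
by case: (_ <= eval s x); case: (eval s x <= _); rewrite // ?mul0r ?mulr0 ?mul0r.
Qed.

(** The opcode selects through 0/1 factors instead of branching, and everything outside 0, 1, 2 is a
    multiplication. A wide operand is only ever combined with narrow numbers, as [affine]
    demands. *)
Definition Egate a op x y p :=
  Op Add (Op Mul (Op Eq op (Const 0)) x)
    (Op Add (Op Mul (Op Eq op (Const 1)) (Op Add (Eread a x p) (Eread a y p)))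
    (Op Add (Op Mul (Op Eq op (Const 2)) (Op Defs.Sub (Eread a x p) (Eread a y p)))
       (Op Mul (Op Mul (Op Mul (Eneq op (Const 0)) (Eneq op (Const 1))) (Eneq op (Const 2)))
          (Op Mul (Eread a x p) (Eread a y p))))).

(** The [match] inside [slp_gates], named so that it can be compared with [Egate]. *)
Definition decode (op x y : int) : gate :=
  match op with
  | Posz 0 => GConst x
  | Posz 1 => GAdd `|x|%N `|y|%N
  | Posz 2 => GSub `|x|%N `|y|%N
  | _ => GMul `|x|%N `|y|%N
  end.

Lemma eqm_Egate Q s a op x y p (m : nat) (V : nat -> int) : eval s p = m ->
  (forall i, (i < m)%N -> eqm Q (arr s a i) (V i)) ->
  eqm Q (eval s (Egate a op x y p))
    (gate_val [seq V j | j <- iota 0 m] (decode (eval s op) (eval s x) (eval s y))).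
Proof.
move=> hp hV.
pose rx := if (`|eval s x| < m)%N then arr s a `|eval s x|%N else 0.
pose ry := if (`|eval s y| < m)%N then arr s a `|eval s y|%N else 0.
have hx : eqm Q rx [seq V j | j <- iota 0 m]`_(`|eval s x|%N).
  by rewrite nth_iota_map /rx; case: ifP => // /hV.
have hy : eqm Q ry [seq V j | j <- iota 0 m]`_(`|eval s y|%N).
  by rewrite nth_iota_map /ry; case: ifP => // /hV.
have -> : eval s (Egate a op x y p) =
   Posz (eval s op == 0)%R * eval s x +
   (Posz (eval s op == 1)%R * (eval s (Eread a x p) + eval s (Eread a y p)) +
   (Posz (eval s op == 2)%R * (eval s (Eread a x p) - eval s (Eread a y p)) +
   (1 - Posz (eval s op == 0)%R) * (1 - Posz (eval s op == 1)%R) *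
   (1 - Posz (eval s op == 2)%R) * (eval s (Eread a x p) * eval s (Eread a y p)))) by [].
rewrite !(eval_Eread _ _ hp) -/rx -/ry.
case: (eval s op) => [[|[|[|k]]]|k] /=; rewrite ?mul0r ?mul1r ?add0r ?addr0 //.
- exact: eqmD.
- exact: eqmB.
- exact: eqmM.
- exact: eqmM.
Qed.

Lemma mx_entries_nth N M (a : nat -> nat -> int) w : (w < N * M)%N ->
  (mx_entries (\matrix_(i < N, j < M) a i j))`_w = a (w %/ M)%N (w %% M)%N.
Proof.
move=> lt_w; have M0 : (0 < M)%N by case: M lt_w => //; rewrite muln0.
have -> : mx_entries (\matrix_(i < N, j < M) a i j) =
    [seq a i j | i <- iota 0 N, j <- iota 0 M].
  rewrite /mx_entries -!val_enum_ord; rewrite allpairs_mapl allpairs_mapr.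
  by apply: eq_allpairs => i j; rewrite mxE.
have -> : [seq a i j | i <- iota 0 N, j <- iota 0 M] =
    [seq a (w %/ M)%N (w %% M)%N | w <- iota 0 (N * M)].
  elim: N {lt_w} => // N IH.
  rewrite -{1}addn1 iotaD allpairs_cat IH /= cats0 mulSnr iotaD map_cat.
  congr (_ ++ _); rewrite !add0n -[(N * M)%N]addn0 iotaDl -map_comp.
  apply/eq_in_map => j; rewrite mem_iota add0n /= => jM.
  by rewrite divnMDl // divn_small // addn0 modnMDl modn_small.
by rewrite nth_iota_map lt_w.
Qed.

Lemma size_mx_entries N M (A : 'M[int]_(N, M)) : size (mx_entries A) = (N * M)%N.
Proof. by rewrite size_allpairs !size_enum_ord. Qed.

(** * Sums as matrix products *)

(* A sum over points u_0, ..., u_(l-1) of f, g, h values (inputs cf_f, cf_g, cf_h)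
   evaluated as matrix products: o points form the outer index, i points each of
   the two large matrix indices, k points the inner one.  Each of F, G, H sees the
   points listed in vis, which must be distinct, and takes as its set those
   listed in sel. *)
Record config := Config {
  cf_coef : int;
  cf_f : nat; cf_g : nat; cf_h : nat;
  cf_o : nat; cf_i : nat; cf_k : nat;
  visF : seq nat; selF : seq nat;
  visG : seq nat; selG : seq nat;
  visH : seq nat; selH : seq nat }.

(** The word whose blocks of base [n] digits are, lowest first, the outer points, the two large
    index groups and the inner points. *)
Definition zcode (n o i O x1 x2 y : nat) : nat :=
  (O + n ^ o * (x1 + n ^ i * (x2 + n ^ i * y)))%N.

Definition Ezcode o i eO e1 e2 e3 :=
  Op Add eO (Op Mul (Epow (Var 0) o)
    (Op Add e1 (Op Mul (Epow (Var 0) i)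
      (Op Add e2 (Op Mul (Epow (Var 0) i) e3))))).

Lemma eval_Ezcode s (n : nat) o i eO e1 e2 e3 (O x1 x2 y : nat) : var s 0 = n ->
  eval s eO = O -> eval s e1 = x1 -> eval s e2 = x2 -> eval s e3 = y ->
  eval s (Ezcode o i eO e1 e2 e3) = zcode n o i O x1 x2 y.
Proof.
move=> v0 h0 h1 h2 h3; rewrite /= !eval_Epow h0 h1 h2 h3 /= v0.
by rewrite /zcode !(PoszD, PoszM) -!natz !natrX.
Qed.

Lemma add_cost_lt a b c1 c2 p q : (c1 <= a * p)%N -> (c2 <= b * q)%N -> (p <= q)%N ->
  (0 < q)%N -> (c1 + c2 < (a + b).+1 * q)%N.
Proof.
move=> h1 h2 h3 h4; rewrite mulSn mulnDl.
by have : (a * p <= a * q)%N by [rewrite leq_mul2l h3 orbT]; lia.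
Qed.

Lemma sqr_le_mul L x : (L ^ 2 <= L * (L + x))%N.
Proof. by rewrite expnS expn1 leq_mul2l leq_addr orbT. Qed.

Section ConfigProgram.
Variables (cf : config) (r : nat -> nat).

Let w := Var 4.
Let NM := Op Mul (Var 6) (Var 7).
Let NM2 := Op Mul (Const 2) NM.

(** The left factor tabulates g over the first and the inner group, the right factor h over the
    inner and the second group, and f weights the entries of their product. A block that a function
    does not see is set to 0. *)
Definition entriesA := Eentry (cf_g cf) (visG cf) (selG cf)
  (Ezcode (cf_o cf) (cf_i cf) (Var 3) (Op Div w (Var 7)) (Const 0) (Op Mod w (Var 7))).
Let w' := Op Defs.Sub w NM.
Definition entriesB :=
  Eentry (cf_h cf) (visH cf) (selH cf)
  (Ezcode (cf_o cf) (cf_i cf) (Var 3) (Const 0) (Op Mod w' (Var 6)) (Op Div w' (Var 6))).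
Definition entriesF := Eentry (cf_f cf) (visF cf) (selF cf)
  (Ezcode (cf_o cf) (cf_i cf) (Var 3) (Op Div w (Var 6)) (Op Mod w (Var 6)) (Const 0)).
Definition entriesAB := Op Add (Op Mul (Elt w NM) entriesA)
  (Op Mul (Op Defs.Sub (Const 1) (Elt w NM)) entriesB).
Definition fill_entries := fill 4 NM2 6 w entriesAB.
Definition eval_gates := fill 4 (Var 5) 6 (Op Add NM2 w)
  (Egate 6 (Get (r 0) w) (Get (r 1) w) (Get (r 2) w) (Op Add NM2 w)).
Definition trace_term := Op Mul (Op Mul (Const (cf_coef cf)) entriesF)
    (Eread 6 (Get (r 3) w) (Op Add NM2 (Var 5))).
Definition add_trace := sumup 4 (Op Mul (Var 6) (Var 6)) 2 trace_term.
Definition config_body := Seq fill_entries (Seq eval_gates add_trace).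

Definition cellF (inp : nat -> nat -> int) n z := entry (inp (cf_f cf)) n (visF cf) (selF cf) z.
Definition cellG (inp : nat -> nat -> int) n z := entry (inp (cf_g cf)) n (visG cf) (selG cf) z.
Definition cellH (inp : nat -> nat -> int) n z := entry (inp (cf_h cf)) n (visH cf) (selH cf) z.

(** For fixed outer points this is a trace of three matrices, written as the pairing of the first
    one with the product of the other two, with both flattened row by row. *)
Definition config_slice inp n O : int :=
  let z := zcode n (cf_o cf) (cf_i cf) O in
  let N := (n ^ cf_i cf)%N in
  \sum_(x < N * N) cellF inp n (z (x %/ N) (x %% N) 0)%N *
    \sum_(y < n ^ cf_k cf) cellG inp n (z (x %/ N) 0 y)%N * cellH inp n (z 0 (x %% N) y)%N.

Hypothesis cf3 : (cf_f cf < 3)%N && (cf_g cf < 3)%N && (cf_h cf < 3)%N.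
Hypothesis r16 : forall x, (16 <= r x)%N.

Lemma small_Ezcode o i eO e1 e2 e3 :
  small eO -> small e1 -> small e2 -> small e3 -> small (Ezcode o i eO e1 e2 e3).
Proof. by move=> h0 h1 h2 h3; rewrite /= h0 h1 h2 h3 !small_Epow. Qed.

Lemma small_entriesF : small entriesF.
Proof. case/andP: cf3 => /andP[h _] _; apply: small_Eentry; [lia|exact: small_Ezcode]. Qed.

Lemma small_entriesAB : small entriesAB.
Proof.
have hA : small entriesA.
  by case/andP: cf3 => /andP[_ h] _; apply: small_Eentry; [lia|exact: small_Ezcode].
have hB : small entriesB.
  by case/andP: cf3 => _ h; apply: small_Eentry; [lia|exact: small_Ezcode].
by rewrite /entriesAB; move: hA hB; move: entriesA entriesB => EA EB /= -> ->.
Qed.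

Lemma affine_read (pa : pred nat) x p : pa x -> small p ->
  affine pred0 pa 4 (Eread 6 (Get x w) p) /\ narrow (Eread 6 (Get x w) p).
Proof. by move=> px sp; rewrite /= !small_affine // !small_narrow // px !orbT. Qed.

(** Gate [k] costs a multiple of [L * (L + x k)], where [x k] is the length of its three stored
    words. These lengths are bounded only in total, by [X] and, for the output positions, [Y]; this
    suffices because the costs of the iterations add up. Reducing every gate modulo [Q] is sound
    since gates only add, subtract and multiply. *)
Lemma runs_config_body : exists W : nat,
  forall (n Q L : nat) inp s sG tG (O M : nat),
  let N := (n ^ cf_i cf)%N in let sz := size (slp_gates sG) in
  let X (B : nat) := (\sum_(k < B) (bits (arr sG 0 k) + bits (arr sG 1 k) + bits (arr sG 2 k)))%N in
  let Y := (\sum_(k < N * N) bits (arr sG 3 k))%N in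
  (0 < n)%N -> M = (n ^ cf_k cf)%N -> (M <= N)%N ->
  base n Q L inp s -> (2 * (N * M) < Q)%N -> (N * N < Q)%N -> (sz < Q)%N ->
  var s 3 = O -> var s 5 = sz -> var s 6 = N -> var s 7 = M ->
  (forall a k, arr s (r a) k = arr sG a k) ->
  mm_slp N M (slp_gates sG) (slp_out sG) ->
  (X sz <= 3 * sz + 6 * tG)%N -> (Y <= N * N + 2 * tG)%N ->
  exists s', [/\ runs config_body s s' (W * (L ^ 2 * (sz + tG + N * N))),
    base n Q L inp s' & eqm Q (var s' 2) (var s 2 + cf_coef cf * config_slice inp n O)].
Proof.
pose w1 := (weight w + weight (modQ entriesAB)).+1.
pose eg := modQ (Egate 6 (Get (r 0) w) (Get (r 1) w) (Get (r 2) w) (Op Add NM2 w)).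
pose w2 := (weight (Op Add NM2 w) + weight eg).+1.
pose w3 := (weight (modQ (Op Add (Var 2) trace_term))).+1.
pose u1 := upto_cost NM2; pose u2 := upto_cost (Var 5); pose u3 := upto_cost (Op Mul (Var 6) (Var 6)).
(* The three loops contribute six terms, each a constant times [L ^ 2] times at most
   [10 * (sz + tG + N * N)]; the largest coefficient that occurs is the 6 in the bound on [X]. *)
exists (10 * (u1 + u2 + u3 + w1 + w2 + w3 + 1))%N.
move=> n Q L inp s sG tG O M N sz X Y n0 ME MN bs Q1 Q2 Q3 s3 s5 s6 s7 sr mm hX hY.
have Q0 : (0 < Q)%N by apply: leq_trans Q3.
have L0 : (0 < L)%N by apply: leq_trans (base_var bs (isT : (0 < 16)%N)).
have N0 : (0 < N)%N by rewrite expn_gt0 n0.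
have M0 : (0 < M)%N by rewrite ME expn_gt0 n0.
pose z := zcode n (cf_o cf) (cf_i cf) O.
pose A := \matrix_(i < N, j < M) cellG inp n (z i 0 j)%N.
pose B := \matrix_(i < M, j < N) cellH inp n (z 0 j i)%N.
have eA x : (x < N * M)%N -> (mx_entries A)`_x = cellG inp n (z (x %/ M) 0 (x %% M))%N.
  exact: (mx_entries_nth (fun i j => cellG inp n (z i 0 j)%N)).
have eB x : (x < M * N)%N -> (mx_entries B)`_x = cellH inp n (z 0 (x %% N) (x %/ N))%N.
  exact: (mx_entries_nth (fun i j => cellH inp n (z 0 j i)%N)).
pose inputs := mx_entries A ++ mx_entries B.
pose V := run (slp_gates sG) inputs.
have szI : size inputs = (2 * (N * M))%N by rewrite size_cat !size_mx_entries mulSn mul1n [(M * N)%N]mulnC.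
have eNM s' : var s' 6 = N -> var s' 7 = M -> eval s' NM = (N * M)%N.
  by move=> /= -> ->.
have eNM2 s' : var s' 6 = N -> var s' 7 = M -> eval s' NM2 = (2 * (N * M))%N.
  by move=> /= -> ->.
have sc e s' : base n Q L inp s' -> small e -> (ecost s' e <= weight e * L ^ 2)%N.
  by move=> bs' se; have [_] := small_cost Q0 bs' se.
have [s1 [run1 bs1 v1]] : exists s1, [/\ runs fill_entries s s1
      (u1 * L ^ 2 * (2 * (N * M)).+1 + \sum_(i < 2 * (N * M)) w1 * L ^ 2), base n Q L inp s1 &
      forall p, (p < 0 + 2 * (N * M))%N -> eqm Q (arr s1 6 p) V`_p].
  apply: (runs_fill (v := fun p => V`_p) (T := fun=> (w1 * L ^ 2)%N)) => //.
    by move=> s' _ [fv _]; apply: eNM2; rewrite fv.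
  move=> i s' iB bs' [fv fa] s'4 _; rewrite add0n; split => //.
  - rewrite /V run_inputs ?szI // /inputs nth_cat size_mx_entries.
    have v3 : eval s' (Var 3) = O by rewrite /= fv.
    have v6 : eval s' (Var 6) = N by rewrite /= fv.
    have v7 : eval s' (Var 7) = M by rewrite /= fv.
    rewrite -[eval _ _]/(eval s' (Elt w NM) * eval s' entriesA +
      (1 - eval s' (Elt w NM)) * eval s' entriesB) eval_Elt (eNM s') ?fv // (_ : eval s' w = i) // ltz_nat.
    case: ltnP => lt_i.
      rewrite eA // mul1r subrr mul0r addr0.
      rewrite /entriesA (eval_Eentry (n := n) (z := z (i %/ M) 0 (i %% M))%N) ?(base0 bs') //.
        rewrite /eqm; congr modz; rewrite /cellG /entry; congr (_ * _).
        by rewrite (base_inp bs') //; case/andP: cf3 => /andP[].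
      by apply: eval_Ezcode; rewrite ?(base0 bs') // ?[LHS]/= ?s'4 ?v7 ?fv ?s7 ?divz_nat ?modz_nat.
    rewrite mul0r add0r subr0 mul1r.
    have iB' : (i - N * M < M * N)%N by rewrite [(M * N)%N]mulnC; lia.
    rewrite eB //.
    have ew : eval s' (Op Defs.Sub w NM) = (i - N * M)%N.
      rewrite -[LHS]/(var s' 4 - eval s' NM) s'4 (eNM s') //; lia.
    rewrite /entriesB (eval_Eentry (n := n) (z := z 0 ((i - N * M) %% N) ((i - N * M) %/ N))%N) ?(base0 bs') //.
      rewrite /eqm; congr modz; rewrite /cellH /entry; congr (_ * _).
      by rewrite (base_inp bs') //; case/andP: cf3.
    apply: eval_Ezcode; rewrite ?(base0 bs') //.
      by rewrite -[LHS]/(eval s' (Op Defs.Sub w NM) %% eval s' (Var 6))%Z ew v6 modz_nat.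
    by rewrite -[LHS]/(eval s' (Op Defs.Sub w NM) %/ eval s' (Var 6))%Z ew v6 divz_nat.
  - have sAB : small (modQ entriesAB) by rewrite -[small _]/(small entriesAB && true) small_entriesAB.
    have := sc _ _ bs' sAB; have := sc w _ bs' isT.
    have : (0 < L ^ 2)%N by rewrite expn_gt0 L0.
    rewrite /w1; lia.
have [fv1 fa1] := runs_frame run1.
have s1v y : (y \notin [:: 4]) -> var s1 y = var s y by move=> yV; apply: fv1; rewrite !inE orbb in yV *.
have s1r a k : arr s1 (r a) k = arr sG a k.
  by rewrite fa1 ?sr // inE; have := r16 a; lia.
pose x k := (bits (arr sG 0 k) + bits (arr sG 1 k) + bits (arr sG 2 k))%N.
have [s2 [run2 bs2 v2]] : exists s2, [/\ runs eval_gates s1 s2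
      (u2 * L ^ 2 * sz.+1 + \sum_(i < sz) w2 * (L * (L + x i))), base n Q L inp s2 &
      forall p, (p < 2 * (N * M) + sz)%N -> eqm Q (arr s2 6 p) V`_p].
  apply: (runs_fill (v := fun p => V`_p) (T := fun i => (w2 * (L * (L + x i)))%N)) => //.
    by move=> s' _ [fv _]; rewrite /= fv // s1v.
  move=> i s' iB bs' [fv fa] s'4 IH.
  have e2 : eval s' (Op Add NM2 w) = (2 * (N * M) + i)%N.
    by rewrite -[LHS]/(eval s' NM2 + var s' 4) eNM2 ?s'4 // fv // s1v.
  have s'r a k : arr s' (r a) k = arr sG a k.
    by rewrite fa ?s1r // inE; have := r16 a; lia.
  have eg_ j : eval s' (Get (r j) w) = arr sG j i by rewrite /= s'4 s'r.
  split=> //.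
    have iB' : (i < `|var sG 0|)%N by move: iB; rewrite /sz size_mkseq.
    rewrite -[in V`_ _]szI nth_run // szI nth_mkseq //.
    have := eqm_Egate (Get (r 0) w) (Get (r 1) w) (Get (r 2) w) e2 IH.
    by rewrite !eg_.
  have afg : affine pred0 [pred a | a \in [:: r 0; r 1; r 2]] 4 eg.
    by rewrite /= !inE !eqxx !orbT.
  have := @affine_cost s' L (x i) pred0 [pred a | a \in [:: r 0; r 1; r 2]] 4.
  rewrite (base1 bs') s'4 => /(_ _ L0 (base_var bs') (base_arr bs') _ _ eg afg)[].
  - by lia.
  - by [].
  - by move=> a /=; rewrite !inE => /or3P[] /eqP ->; rewrite s'r /x /=; lia.
  move=> _ h2; apply: leq_trans (add_cost_lt (sc (Op Add NM2 w) _ bs' isT) h2 (sqr_le_mul _ _) _) _ => //.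
  by rewrite muln_gt0 addn_gt0 L0.
have [fv2 fa2] := runs_frame run2.
have s2v y : (y \notin [:: 4]) -> var s2 y = var s y.
  by move=> yV; rewrite fv2 ?s1v //; rewrite !inE orbb in yV *.
have s2r a k : arr s2 (r a) k = arr sG a k.
  by rewrite fa2 ?s1r // inE; have := r16 a; lia.
pose y k := bits (arr sG 3 k).
pose v k := cf_coef cf * (cellF inp n (z (k %/ N) (k %% N) 0)%N * V`_(slp_out sG k)).
have [s3' [run3 bs3 v3]] : exists s3', [/\ runs add_trace s2 s3'
      (u3 * L ^ 2 * (N * N).+1 + \sum_(i < N * N) w3 * (L * (L + y i))), base n Q L inp s3' &
      eqm Q (var s3' 2) (var s2 2 + \sum_(i < N * N) v i)].
  apply: (runs_sumup (v := v) (T := fun i => (w3 * (L * (L + y i)))%N)) => //.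
    by move=> s' _ [fv _]; rewrite /= fv // s2v // s6.
  move=> i s' iB bs' [fv fa] s'4.
  have s'r a k : arr s' (r a) k = arr sG a k by rewrite fa ?s2r.
  have e2 : eval s' (Op Add NM2 (Var 5)) = (2 * (N * M) + sz)%N.
    by rewrite -[LHS]/(eval s' NM2 + var s' 5) eNM2 ?fv ?s2v // s5.
  split.
    rewrite -[eval _ _]/(cf_coef cf * eval s' entriesF * eval s' (Eread 6 (Get (r 3) w) (Op Add NM2 (Var 5)))).
    rewrite (eval_Eread _ _ e2) /v -mulrA; apply: eqmM => //; apply: eqmM.
      rewrite /entriesF (eval_Eentry (n := n) (z := z (i %/ N) (i %% N) 0)%N) ?(base0 bs') //.
        rewrite /eqm; congr modz; rewrite /cellF /entry; congr (_ * _).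
        by rewrite (base_inp bs') //; case/andP: cf3 => /andP[].
      have v3 : eval s' (Var 3) = O by rewrite /= fv // s2v.
      have v6 : var s' 6 = N by rewrite /= fv // s2v.
      by apply: eval_Ezcode; rewrite ?(base0 bs') // ?[LHS]/= ?s'4 ?v6 ?divz_nat ?modz_nat.
    have -> : eval s' (Get (r 3) w) = arr sG 3 i by rewrite /= s'4 s'r.
    (* An output position past the last gate denotes the default 0 in the list of values, and
       [Eread] yields 0 there as well. *)
    rewrite /slp_out; case: ltnP => h; last by rewrite nth_default // size_run szI.
    by rewrite fa //; apply: v2.
  have aft : affine pred0 (pred1 (r 3)) 4 (modQ (Op Add (Var 2) trace_term)).
    have [aR nR] := @affine_read (pred1 (r 3)) (r 3) (Op Add NM2 (Var 5)) (eqxx _) isT.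
    have sF : small (Op Mul (Const (cf_coef cf)) entriesF) := small_entriesF.
    rewrite /trace_term; move: (Eread _ _ _) aR nR => R aR nR /=.
    by have := small_affine pred0 (pred1 (r 3)) 4 sF; have := small_narrow sF; rewrite /= aR nR => -> ->; rewrite ?orbT.
  have := @affine_cost s' L (y i) pred0 (pred1 (r 3)) 4.
  rewrite (base1 bs') s'4 => /(_ _ L0 (base_var bs') (base_arr bs') _ _ _ aft)[].
  - by lia.
  - by [].
  - by move=> a /eqP ->; rewrite s'r.
  move=> _ h2; apply: leq_trans (@add_cost_lt 0 _ 0 _ (L ^ 2) _ (leqnn _) h2 (sqr_le_mul _ _) _) _ => //.
  by rewrite muln_gt0 addn_gt0 L0.
exists s3'; split=> //; last first.
  move: v3; rewrite s2v //; congr (eqm _ _ (_ + _)).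
  rewrite /v -mulr_sumr; congr (_ * _); apply: eq_bigr => k _; congr (_ * _).
  have kN : (k %/ N < N)%N by rewrite ltn_divLR.
  have kN' : (k %% N < N)%N by rewrite ltn_mod.
  transitivity ((A *m B) (Ordinal kN) (Ordinal kN')).
    by rewrite -(mm A B) /= -divn_eq.
  by rewrite mxE -ME; apply: eq_bigr => j _; rewrite !mxE.
case: run1 => t1 e1 T1; case: run2 => t2 e2 T2; case: run3 => t3 e3 T3.
exists (t1 + (t2 + t3))%N; first by apply: ExecSeq e1 (ExecSeq e2 e3).
have sx : (\sum_(i < sz) w2 * (L * (L + x i)) <= w2 * (L ^ 2 * (sz + X sz)))%N.
  rewrite -!big_distrr /=; apply: leq_mul => //; rewrite big_split /= sum_nat_const card_ord.
  rewrite -/(X sz) expnS expn1 -(mulnA L L); apply: leq_mul => //.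
  by rewrite mulnDr leq_add ?leq_pmull // mulnC.
have sy : (\sum_(i < N * N) w3 * (L * (L + y i)) <= w3 * (L ^ 2 * (N * N + Y)))%N.
  rewrite -!big_distrr /=; apply: leq_mul => //; rewrite big_split /= sum_nat_const card_ord.
  rewrite -/(Y) expnS expn1 -(mulnA L L); apply: leq_mul => //.
  by rewrite mulnDr leq_add ?leq_pmull // mulnC.
rewrite sum_nat_const card_ord in T1.
have NMN : (N * M <= N * N)%N by rewrite leq_mul2l MN orbT.
have NN0 : (0 < N * N)%N by rewrite muln_gt0 N0.
set S := (sz + tG + N * N)%N.
have h a b : (b <= 10 * S)%N -> (a * (L ^ 2 * b) <= a * 10 * (L ^ 2 * S))%N.
  by move=> hb; rewrite -mulnA leq_mul // mulnCA leq_mul.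
have h1 := h u1 (2 * (N * M)).+1; have h2 := h w1 (2 * (N * M))%N.
have h3 := h u2 sz.+1; have h4 := h w2 (sz + X sz)%N.
have h5 := h u3 (N * N).+1; have h6 := h w3 (N * N + Y)%N.
have := h1 ltac:(rewrite /S; lia); have := h2 ltac:(rewrite /S; lia).
have := h3 ltac:(rewrite /S; lia); have := h4 ltac:(rewrite /S; lia).
have := h5 ltac:(rewrite /S; lia); have := h6 ltac:(rewrite /S; lia).
have {}T1 : (t1 <= u1 * (L ^ 2 * (2 * (N * M)).+1) + w1 * (L ^ 2 * (2 * (N * M))))%N.
  by apply: leq_trans T1 _; move: (L ^ 2)%N (N * M)%N => l2 nm; nia.
rewrite -mulnA in T2; rewrite -mulnA in T3.
clearbody S; move: h1 h2 h3 h4 h5 h6 => _ _ _ _ _ _.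
move: T1 T2 T3 sx sy; rewrite -/u1 -/u2 -/u3.
move: (\sum_(i < sz) _)%N (\sum_(i < N * N) _)%N => sm1 sm2.
move: (u1 * (_ * _.+1))%N (w1 * (_ * _))%N (u2 * (_ * _.+1))%N (w2 * (_ * _))%N
  (u3 * (_ * _.+1))%N (w3 * (_ * _))%N (L ^ 2 * S)%N.
move: u1 u2 u3 w1 w2 w3 => {}u1 {}u2 {}u3 {}w1 {}w2 {}w3 a1 a2 a3 a4 a5 a6 l2.

lia.
Qed.
End ConfigProgram.

(** * A complete run of one configuration *)

Lemma runs_seq c1 c2 s s1 s2 T1 T2 : runs c1 s s1 T1 -> runs c2 s1 s2 T2 ->
  runs (Seq c1 c2) s s2 (T1 + T2).
Proof.
by case=> t1 e1 h1 [t2 e2 h2]; exists (t1 + t2)%N; [exact: ExecSeq e1 e2|exact: leq_add].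
Qed.

Lemma leq_runs c s s' T T' : runs c s s' T -> (T <= T')%N -> runs c s s' T'.
Proof. by case=> t e h hT; exists t => //; apply: leq_trans hT. Qed.

Lemma runs_assign n Q L inp s x e : (0 < Q)%N -> base n Q L inp s -> small e ->
  runs (Assign x e) s (set_var s x (eval s e)) ((weight e).+1 * L ^ 2).
Proof.
move=> Q0 bs se; eexists; first exact: ExecAssign.
have L0 : (0 < L)%N by apply: leq_trans (base_var bs (isT : (0 < 16)%N)).
have [_] := small_cost Q0 bs se; have : (0 < L ^ 2)%N by rewrite expn_gt0 L0.
by rewrite mulSn; lia.
Qed.

Lemma reduced_rename r c : (forall x, 16 <= r x)%N -> reduced (rename r c).
Proof.
move=> r16; elim: c => //= [x e|a i e|c1 -> c2 ->|e c1 -> c2 ->] //.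
  by rewrite r16.
by rewrite (leq_trans _ (r16 a)).
Qed.

(** [slp_gates] takes the absolute value of the length that the foreign program leaves behind, which
    may be negative. *)
Definition Eabs v :=
  Op Mul v (Op Defs.Sub (Const 1) (Op Mul (Const 2) (Op Le v (Const (-1))))).

Lemma eval_Eabs s v : eval s (Eabs v) = `|eval s v|%N.
Proof. by rewrite /=; case: lerP => /=; lia. Qed.

Lemma small_pow n Q L inp s (j : nat) : base n Q L inp s -> (n ^ j < Q)%N ->
  eval s (modQ (Epow (Var 0) j)) = (n ^ j)%N.
Proof.
move=> bs jQ; rewrite /= eval_Epow /= (base0 bs) (base1 bs).
rewrite (_ : _ ^+ j = Posz (n ^ j)); last by rewrite -!natz natrX.
by rewrite modz_small //; lia.
Qed.

Lemma set_varE s x v y : var (set_var s x v) y = if y == x then v else var s y.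
Proof. by []. Qed.

Section FullConfig.
Variables (cf : config) (r : nat -> nat) (G : cmd).

(** The gates depend on the dimensions only, so [G] runs once and its gates serve all [n ^ o]
    choices of the outer points. *)
Definition config_prog :=
  Seq (Assign 6 (modQ (Epow (Var 0) (cf_i cf))))
 (Seq (Assign 7 (modQ (Epow (Var 0) (cf_k cf))))
 (Seq (Assign 8 (modQ (Epow (Var 0) (cf_o cf))))
 (Seq (Assign (r 0) (modQ (Epow (Var 0) (cf_i cf))))
 (Seq (Assign (r 1) (modQ (Epow (Var 0) (cf_k cf))))
 (Seq (rename r G)
 (Seq (Assign 5 (modQ (Eabs (Var (r 0)))))
      (upto 3 (Var 8) (config_body cf r)))))))).

Definition config_sum inp n := \sum_(O < n ^ cf_o cf) config_slice cf inp n O.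

Hypothesis cf3 : (cf_f cf < 3)%N && (cf_g cf < 3)%N && (cf_h cf < 3)%N.
Hypothesis r16 : forall x, (16 <= r x)%N.
Hypothesis r_inj : injective r.

(** The factor [n ^ o] also multiplies [tG]: every outer iteration reads the stored gates again, and
    [tG] bounds their total length. *)
Lemma runs_config_prog : exists W : nat,
  forall (n Q L : nat) inp s sG tG,
  let N := (n ^ cf_i cf)%N in let M := (n ^ cf_k cf)%N in
  let sz := size (slp_gates sG) in
  (0 < n)%N -> (M <= N)%N -> base n Q L inp s ->
  (forall x, var s (r x) = 0) -> (forall a k, arr s (r a) k = 0) ->
  (2 * (N * N) < Q)%N -> (n ^ cf_o cf < Q)%N -> (sz < Q)%N ->
  exec G (mm_start N M) sG tG ->
  mm_slp N M (slp_gates sG) (slp_out sG) ->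
  exists s', [/\ runs config_prog s s' (W * (L ^ 2 * (n ^ cf_o cf * (sz + tG + N * N)))),
    base n Q L inp s' & eqm Q (var s' 2) (var s 2 + cf_coef cf * config_sum inp n)].
Proof.
have [Wb runs_body] := runs_config_body cf3 r16.
pose ep j := modQ (Epow (Var 0) j).
pose W0 := ((weight (ep (cf_i cf))).+1 + (weight (ep (cf_k cf))).+1)%N.
pose eabs := modQ (Eabs (Var (r 0))).
exists (2 * W0 + (weight (ep (cf_o cf))).+1 + 1 + 2 * weight eabs + 1 + 2 * upto_cost (Var 8) + Wb)%N.
move=> n Q L inp s sG tG N M sz n0 MN bs vr ar Q1 Q2 Q3 exG mm.
have Q0 : (0 < Q)%N by apply: leq_trans Q3.
have L0 : (0 < L)%N by apply: leq_trans (base_var bs (isT : (0 < 16)%N)).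
have N0 : (0 < N)%N by rewrite expn_gt0 n0.
have NQ : (N < Q)%N by nia.
have MQ : (M < Q)%N by apply: leq_ltn_trans NQ.
have sep j : small (ep j) by rewrite /= small_Epow.
have step s' x j : base n Q L inp s' -> (n ^ j < Q)%N -> (1 < x)%N ->
    runs (Assign x (ep j)) s' (set_var s' x (n ^ j)%N) ((weight (ep j)).+1 * L ^ 2)
    /\ base n Q L inp (set_var s' x (n ^ j)%N).
  move=> bs' jQ x1; have := runs_assign x Q0 bs' (sep j); rewrite (small_pow bs') // => h.
  split=> //; case: h => t ex _; apply: exec_base Q0 _ ex bs'.
  by rewrite /= x1 orbT.
have [run1 bs1] := step s 6 (cf_i cf) bs NQ isT.
have [run2 bs2] := step _ 7 (cf_k cf) bs1 MQ isT.
have [run3 bs3] := step _ 8 (cf_o cf) bs2 Q2 isT.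
have [run4 bs4] := step _ (r 0) (cf_i cf) bs3 NQ (leq_trans (isT : (1 < 16)%N) (r16 0)).
have [run5 bs5] := step _ (r 1) (cf_k cf) bs4 MQ (leq_trans (isT : (1 < 16)%N) (r16 1)).
set s5 := set_var _ (r 1) _ in run5 bs5.
(* Zeroed memory under [r], together with the two dimensions just written, is the start state that
   [G] expects. *)
have rn5 : renamed r (mm_start N M) s5.
  split=> [x|a k]; last by rewrite /= ar.
  have rx y : (y < 16)%N -> (r x == y) = false by have := r16 x; lia.
  rewrite !set_varE !(inj_eq r_inj) !rx // vr.
  by case: x {rx} => [|[|x]].
have [s6 exG' [v6 a6]] := exec_rename r_inj exG rn5.
have fr6 := exec_frame exG'.
have notin_r y (c : seq nat) : (y < 16)%N -> y \notin map r c.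
  by move=> y16; apply/mapP => -[x _ yx]; have := r16 x; lia.
have bs6 : base n Q L inp s6 := exec_base Q0 (reduced_rename _ r16) exG' bs5.
have v6s y : (y < 16)%N -> var s6 y = var s5 y.
  by case: fr6 => fv _ y16; apply: fv; rewrite wvars_rename notin_r.
have szE : `|var sG 0|%N = sz by rewrite /sz size_mkseq.
have szL : (bits (var s6 (r 0)) <= L)%N.
  apply: leq_trans (base_var bs (isT : (1 < 16)%N)); rewrite (base1 bs) v6.
  by apply: leq_bits; rewrite szE ltnW.
have [run7 bs7] : runs (Assign 5 eabs) s6 (set_var s6 5 sz) ((2 * weight eabs).+1 * L ^ 2)
    /\ base n Q L inp (set_var s6 5 sz).
  have ev : eval s6 eabs = sz.
    rewrite -[LHS]/(eval s6 (Eabs (Var (r 0))) %% var s6 1)%Z eval_Eabs (base1 bs6).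
    by rewrite [eval _ _]/= v6 szE modz_small //; lia.
  have ex : exec (Assign 5 eabs) s6 (set_var s6 5 sz) (ecost s6 eabs).+1.
    by rewrite -{1}ev; exact: ExecAssign.
  split; last exact: exec_base Q0 _ ex bs6.
  exists (ecost s6 eabs).+1 => //.
  have := @affine_cost s6 L L (pred1 (r 0)) pred0 0 _ L0 (base_var bs6) (base_arr bs6).
  rewrite (base1 bs6) => /(_ _ _ _ eabs)[].
  - by lia.
  - by move=> y /eqP ->.
  - by [].
  - by rewrite /= eqxx !orbT.
  move=> _; have : (0 < L ^ 2)%N by rewrite expn_gt0 L0.
  rewrite (_ : L * (L + L) = 2 * L ^ 2)%N; last by rewrite expnS expn1; lia.
  by rewrite mulSn; move: (L ^ 2)%N => l2; lia.
set s7 := set_var s6 5 sz in run7 bs7.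
have v7 y : (y < 16)%N -> y != 5 -> var s7 y = var s5 y.
  by move=> y16 y5; rewrite set_varE (negPf y5) v6s.
have r_neq y x : (y < 16)%N -> (y == r x) = false by have := r16 x; lia.
pose J i s' := eqm Q (var s' 2) (var s 2 + cf_coef cf * \sum_(O < i) config_slice cf inp n O).
pose Tb := (Wb * (L ^ 2 * (sz + tG + N * N)))%N.
have [s8 [run8 bs8 J8]] : exists s8, [/\ runs (upto 3 (Var 8) (config_body cf r)) s7 s8
      (upto_cost (Var 8) * L ^ 2 * (n ^ cf_o cf).+1 + \sum_(i < n ^ cf_o cf) Tb),
      base n Q L inp s8 & J (n ^ cf_o cf)%N s8].
  apply: (runs_upto (J := J) (T := fun=> Tb)) => //.
  - by move=> s' _ [fv _]; rewrite /= fv // v7 // /s5 !set_varE !r_neq.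
  - rewrite /J -[var (set_var _ _ _) 2]/(var s7 2) big_ord0 mulr0 addr0 v7 // /s5 !set_varE !r_neq //.
  move=> i s' iB bs' [fv fa] s'3 Ji.
  have [|||||||||||s'' [run'' bs'' h]] := runs_body n Q L inp s' sG tG i M n0 erefl MN bs'.
  - by apply: leq_ltn_trans Q1; rewrite leq_mul2l /= leq_mul2l MN orbT.
  - by apply: leq_ltn_trans Q1; rewrite leq_pmull.
  - exact: Q3.
  - exact: s'3.
  - by rewrite fv.
  - by rewrite fv // v7 // /s5 !set_varE !r_neq.
  - by rewrite fv // v7 // /s5 !set_varE !r_neq.
  - move=> a k; rewrite fa ?a6 // !inE; have := r16 a; lia.
  - exact: mm.
  (* [G] starts from zero cells, and a zero counts one bit; hence the term [sz] beside the running
     time. *)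
  - rewrite !big_split /=; have h a := sum_bits_exec a (size (slp_gates sG)) exG.
    have {}h a : (\sum_(k < sz) bits (arr sG a k) <= sz + 2 * tG)%N.
      by apply: leq_trans (h a) _; rewrite /= sum_nat_const card_ord muln1.
    have := h 0%N; have := h 1%N; have := h 2%N; rewrite -/sz => h2 h1 h0.
    by apply: leq_trans (leq_add (leq_add h0 h1) h2) _; lia.
  - apply: leq_trans (sum_bits_exec _ _ exG) _.
    by rewrite /= sum_nat_const card_ord muln1.
  exists s''; split => //; rewrite /J -[var (set_var _ _ _) 2]/(var s'' 2) big_ord_recr mulrDr addrA.
  by rewrite /eqm h -[RHS]modzDml -Ji modzDml.
exists s8; split=> //.
have run6 : runs (rename r G) s5 s6 tG by exists tG.
have run := runs_seq run1 (runs_seq run2 (runs_seq run3 (runs_seq run4 (runs_seq run5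
  (runs_seq run6 (runs_seq run7 run8)))))).
apply: leq_runs run _; rewrite sum_nat_const card_ord /Tb /W0.
have O0 : (0 < n ^ cf_o cf)%N by rewrite expn_gt0 n0.
have L2 : (0 < L ^ 2)%N by rewrite expn_gt0 L0.
have NN0 : (0 < N * N)%N by rewrite muln_gt0 N0.
rewrite -/(ep _) -/(ep _) -/(ep _) -/N.
set S := (sz + tG + N * N)%N.
have S0 : (0 < S)%N by rewrite /S; lia.
set R := (L ^ 2 * (n ^ cf_o cf * S))%N.
have lR a : (a * L ^ 2 <= a * R)%N by rewrite leq_mul // leq_pmulr // muln_gt0 O0.
have tR : (tG <= R)%N.
  rewrite /R mulnA; apply: leq_trans (leq_pmull _ _); first by rewrite /S; lia.
  by rewrite muln_gt0 L2.
have oR : (upto_cost (Var 8) * L ^ 2 * (n ^ cf_o cf).+1 <= upto_cost (Var 8) * (2 * R))%N.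
  rewrite -mulnA leq_mul // /R mulnCA leq_mul // -addn1 mul2n -addnn.
  by apply: leq_add; rewrite ?leq_pmulr // muln_gt0 O0.
have bR : (n ^ cf_o cf * (Wb * (L ^ 2 * S)) = Wb * R)%N.
  by rewrite mulnCA /R; congr muln; rewrite mulnCA.
rewrite bR; move: oR (lR (weight (ep (cf_i cf))).+1) (lR (weight (ep (cf_k cf))).+1)
  (lR (weight (ep (cf_o cf))).+1) (lR (2 * weight eabs).+1); clearbody R.
move: (upto_cost (Var 8) * _ * _)%N (_.+1 * L ^ 2)%N (_.+1 * L ^ 2)%N (_.+1 * L ^ 2)%N (_.+1 * L ^ 2)%N.
move: (weight _) (weight _) (weight _) (weight _) (upto_cost _).
by move=> *; lia.
Qed.
End FullConfig.

Definition scatter x e a ea body := upto x e (Put a ea (modQ (Op Add (Get a ea) body))).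

(** Addresses may repeat, so a cell ends with the sum over a fibre of [ad]; this collects all tuples
    that match one word with wildcards. *)
Lemma runs_scatter n Q L inp x e a ea body B T (ad : nat -> nat) (v : nat -> int) s0 :
  base n Q L inp s0 -> (1 < x < 16)%N -> (2 < a < 8)%N -> small e -> (B < Q)%N ->
  (forall s, base n Q L inp s -> frame [:: x] [:: a] s0 s -> eval s e = B) ->
  (forall i s, (i < B)%N -> base n Q L inp s -> frame [:: x] [:: a] s0 s ->
     var s x = i ->
     [/\ eval s ea = ad i, eqm Q (eval s body) (v i)
       & (ecost s ea + ecost s (modQ (Op Add (Get a ea) body)) < T i)%N]) ->
  exists s', [/\ runs (scatter x e a ea body) s0 s'
                   (upto_cost e * L ^ 2 * B.+1 + \sum_(i < B) T i),
                 base n Q L inp s'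
               & forall k, eqm Q (arr s' a k) (arr s0 a k + \sum_(i < B | ad i == k) v i)].
Proof.
move=> bs0 hx /andP[a2 a8] se BQ eB vS.
pose J i s := forall k, eqm Q (arr s a k) (arr s0 a k + \sum_(j < i | ad j == k) v j).
apply: (runs_upto (J := J)) => //=.
- by rewrite a2 orbT.
- by move=> k; rewrite big_ord0 addr0.
- move=> i s iB bs fs xi Ji; have [ha hv hT] := vS _ _ iB bs fs xi.
  exists (set_arr s a `|eval s ea|%N (eval s (modQ (Op Add (Get a ea) body)))); split.
    by eexists; [exact: ExecPut|].
  move=> k /=; rewrite eqxx ha /= big_mkcond big_ord_recr -big_mkcond /= [k == _]eq_sym addrA.
  case: eqP => [->|_]; last by rewrite addr0; exact: Ji.
  by rewrite (base1 bs); apply: eqm_modQ; apply: eqmD.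
Qed.

(** The counterpart of [small_cost] while variable 1 is still growing towards the modulus and [base]
    does not hold yet. *)
Lemma bounded_cost s L e : var s 1 != 0 -> (0 < L)%N ->
  (forall y, (y < 16)%N -> (bits (var s y) <= L)%N) ->
  (forall a k, (a < 8)%N -> (bits (arr s a k) <= L)%N) -> small e ->
  (ecost s e <= weight e * L ^ 2)%N.
Proof.
move=> v1 L0 bv ba se.
have := @affine_cost s L 0 pred0 pred0 0 v1 L0 bv ba.
rewrite addn0 => /(_ _ _ e)[] //; exact: small_affine.
Qed.

(** * Computing the modulus *)

Section Prelude.
Variables (c0 d0 c1 d1 : nat).

(** The polynomial factor of the modulus exceeds every loop bound, and the power of two exceeds the
    absolute value of the result, which has polynomially many bits; its exponent grows with [n],
    hence the doubling loop. The initial 1 makes variable 1 nonzero, as the cost estimate asks. *)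
Definition prelude :=
  Seq (Assign 1 (Const 1))
 (Seq (Assign 1 (Op Mul (Const c0) (Epow (Op Add (Var 0) (Const 1)) d0)))
 (Seq (Assign 3 (Op Mul (Const c1) (Epow (Var 0) d1)))
      (While (Var 3) (Seq (Assign 1 (Op Add (Var 1) (Var 1)))
                          (Assign 3 (Op Defs.Sub (Var 3) (Const 1))))))).

Definition doublings n := (c1 * n ^ d1)%N.
Definition modulus n := (c0 * n.+1 ^ d0 * 2 ^ doublings n)%N.

Lemma runs_prelude : exists W : nat, forall (n : nat) (inp : nat -> nat -> int) s,
  let Q := modulus n in let L := bits Q in
  (0 < n)%N -> (0 < c0)%N -> (0 < d0)%N -> var s 0 = n ->
  (forall x, (0 < x < 16)%N -> var s x = 0) ->
  (forall a k, (a < 8)%N -> (bits (arr s a k) <= L)%N) ->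
  (forall a k, (a < 3)%N -> arr s a k = inp a k) ->
  exists s', [/\ runs prelude s s' (W * (L ^ 2 * (doublings n).+1)),
     base n Q L inp s' & frame [:: 1; 3] [::] s s'].
Proof.
pose e1 := Op Mul (Const c0) (Epow (Op Add (Var 0) (Const 1)) d0).
pose e3 := Op Mul (Const c1) (Epow (Var 0) d1).
pose wh := While (Var 3) (Seq (Assign 1 (Op Add (Var 1) (Var 1)))
                          (Assign 3 (Op Defs.Sub (Var 3) (Const 1)))).
exists (weight e1 + weight e3 + 20)%N => n inp s Q L n0 c00 d00 v0 vx ba ai.
have L0 : (0 < L)%N by [].
have n1 : (0 < n.+1 ^ d0)%N by rewrite expn_gt0.
have E0 k : (0 < 2 ^ k)%N by rewrite expn_gt0.
have nQ : (n < Q)%N.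
  rewrite /Q /modulus; apply: leq_trans (leq_pmulr _ (E0 _)).
  apply: leq_trans (leq_pmull _ c00); rewrite -[X in (X <= _)%N]expn1.
  by apply: leq_pexp2l.
have Q0 : (0 < Q)%N by apply: leq_trans nQ.
have bL z : (z <= Q)%N -> (bits z%:Z <= L)%N by move=> zQ; apply: leq_bits.
(* With [k] doublings left, variable 1 times [2 ^ k] already is the final modulus, so no
   intermediate value is longer than [L]. *)
have key k : forall s, (k <= doublings n)%N -> var s 3 = k ->
   (exists2 z : nat, var s 1 = z & (0 < z)%N /\ (z * 2 ^ k)%N = Q) ->
   var s 0 = n -> (forall x, (x < 16)%N -> (bits (var s x) <= L)%N) ->
   (forall a k, (a < 8)%N -> (bits (arr s a k) <= L)%N) ->
   exists2 s', runs wh s s' (12 * L ^ 2 * k.+1) & [/\ var s' 1 = Q, frame [:: 1; 3] [::] s s' &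
     forall x, (x < 16)%N -> (bits (var s' x) <= L)%N].
  have L2 : (0 < L ^ 2)%N by rewrite expn_gt0.
  clear s v0 vx ba ai; elim: k => [|k IH] s kE s3 [z z1 [z0 zQ]] s0 bv ba.
    exists s; last by split=> //; rewrite z1 -zQ expn0 muln1.
    exists (ecost s (Var 3)).+1; first exact: ExecWhileEnd.
    by rewrite /= s3 muln1 (_ : bits 0%N = 1%N) //; nia.
  pose s1 := set_var s 1 (var s 1 + var s 1).
  pose s2 := set_var s1 3 (var s1 3 - 1).
  have z2 : (2 * z <= Q)%N by rewrite -zQ expnS mulnCA leq_mul2l leq_pmulr.
  have v1 : var s 1 + var s 1 = (2 * z)%N by rewrite z1; lia.
  have b1 x : (x < 16)%N -> (bits (var s1 x) <= L)%N.
    by rewrite set_varE; case: eqP => _ x16; [rewrite v1 bL|exact: bv].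
  have v2 : var s1 3 - 1 = k by rewrite /= s3; lia.
  have b2 x : (x < 16)%N -> (bits (var s2 x) <= L)%N.
    rewrite set_varE; case: eqP => _ x16; last exact: b1.
    rewrite v2 bL //; apply: leq_trans (ltnW (ltn_expl k (isT : (1 < 2)%N))) _.
    by rewrite -zQ expnS mulnCA mulnA; apply: leq_pmull; rewrite muln_gt0.
  have [|||s' [t ex tT] [v' f' b']] := IH s2 (ltnW kE) v2 _ _ b2.
  - by exists (2 * z)%N; rewrite // -zQ expnS; split; lia.
  - by [].
  - by [].
  exists s'; last first.
    split=> //; apply: frame_trans f'.
    by apply: frame_trans (frame_set_var _ _ _ _) (frame_set_var _ _ _ _).
  have v10 : var s 1 != 0 by rewrite z1; lia.
  have v11 : var s1 1 != 0 by rewrite set_varE eqxx v1; lia.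
  have c1' := bounded_cost v10 L0 bv ba (isT : small (Op Add (Var 1) (Var 1))).
  have c2' := bounded_cost v11 L0 b1 ba (isT : small (Op Defs.Sub (Var 3) (Const 1))).
  have c3' := bounded_cost v10 L0 bv ba (isT : small (Var 3)).
  have e1' : exec (Assign 1 (Op Add (Var 1) (Var 1))) s s1 _ := ExecAssign _ _ _.
  have e2' : exec (Assign 3 (Op Defs.Sub (Var 3) (Const 1))) s1 s2 _ := ExecAssign _ _ _.
  eexists; first by apply: ExecWhileStep (ExecSeq e1' e2') ex; rewrite /= s3.
  move: c1' c2' c3'; rewrite [weight _]/= [weight (Op Defs.Sub _ _)]/= (_ : bits 1 = 1)%N //.
  move: (ecost _ _) (ecost _ _) (ecost _ _) tT L2 => x1 x2 x3.
  move: (L ^ 2)%N => l2; rewrite [weight _]/=; lia.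
have step1 : runs (Assign 1 (Const 1)) s (set_var s 1 1) 2.
  by exists 2 => //; apply: (ExecAssign s 1 (Const 1)).
set s1 := set_var s 1 1 in step1.
have b1 x : (x < 16)%N -> (bits (var s1 x) <= L)%N.
  rewrite set_varE; case: eqP => // x1 x16.
  case: x x1 x16 => [|x] x1 x16; first by rewrite v0 bL // ltnW.
  by rewrite vx ?x16.
have s10 : var s1 0 = n by rewrite set_varE v0.
have se1 : small e1 by rewrite /= small_Epow.
have se3 : small e3 by rewrite /= small_Epow.
have ev1 : eval s1 e1 = (c0 * n.+1 ^ d0)%N.
  rewrite -[LHS]/(Posz c0 * eval s1 (Epow (Op Add (Var 0) (Const 1)) d0)) eval_Epow.
  rewrite [eval _ _]/= v0 (_ : Posz n + 1 = n.+1); last by lia.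
  by rewrite PoszM; congr (_ * _); rewrite -!natz natrX.
have step2 := ExecAssign s1 1 e1; set s2 := set_var s1 1 _ in step2.
have c1' := bounded_cost (isT : var s1 1 != 0) L0 b1 ba se1.
have s20 : var s2 0 = n by rewrite set_varE s10.
have b2 x : (x < 16)%N -> (bits (var s2 x) <= L)%N.
  rewrite set_varE; case: eqP => // x1 x16; last exact: b1.
  by rewrite ev1 bL // /Q /modulus leq_pmulr.
have v21 : var s2 1 != 0 by rewrite set_varE eqxx ev1; lia.
have ev3 : eval s2 e3 = doublings n.
  rewrite -[LHS]/(Posz c1 * eval s2 (Epow (Var 0) d1)) eval_Epow.
  by rewrite [eval _ _]/= v0 PoszM; congr (_ * _); rewrite -!natz natrX.
have step3 := ExecAssign s2 3 e3; set s3 := set_var s2 3 _ in step3.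
have c3' := bounded_cost v21 L0 b2 ba se3.
have b3 x : (x < 16)%N -> (bits (var s3 x) <= L)%N.
  rewrite set_varE; case: eqP => // x1 x16; last exact: b2.
  rewrite ev3 bL //; apply: leq_trans (ltnW (ltn_expl _ (isT : (1 < 2)%N))) _.
  by rewrite /Q /modulus leq_pmull // muln_gt0 c00.
have [||||s4 [t4 ex4 T4] [v4 f4 b4]] := key (doublings n) s3 (leqnn _) _ _ _ b3.
- by rewrite set_varE eqxx ev3.
- exists (c0 * n.+1 ^ d0)%N; first by rewrite -ev1.
  by rewrite muln_gt0 c00.
- by rewrite set_varE.
- exact: ba.
have f04 : frame [:: 1; 3] [::] s s4.
  have fs st x v : x \in [:: 1%N; 3] -> frame [:: 1; 3] [::] st (set_var st x v).
    exact: frame_set_var.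
  exact: frame_trans (fs s 1%N _ isT) (frame_trans (fs s1 1%N _ isT)
    (frame_trans (fs s2 3 _ isT) f4)).
have [fv fa] := f04.
exists s4; split=> //; last first.
  split=> //; first by rewrite fv.
    by move=> a k a8; rewrite fa // ba.
  by move=> a k a3; rewrite fa // ai.
case: step1 => t1 ex1 T1.
exists (t1 + ((ecost s1 e1).+1 + ((ecost s2 e3).+1 + t4)))%N.
  by apply: ExecSeq ex1 (ExecSeq step2 (ExecSeq step3 ex4)).
have : (0 < L ^ 2)%N by rewrite expn_gt0.
move: c1' c3' T4; move: (ecost _ _) (ecost _ _) (L ^ 2)%N (doublings n) => x1 x2 l2 E.
move: (weight e1) (weight e3) => w1 w3; nia.
Qed.
End Prelude.

(* [l] lists the points of a set in any order; repetitions give 0. *)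
Definition fval (tab : nat -> int) n (l : seq nat) : int := Posz (uniq l) * tab (rcode n l).

(** * Wildcard tables and the weighted sum *)

Section HatTable.
Variable q : nat.

(* x encodes q digits below n followed by q bits; a bit set to 1 replaces its
   digit by n, a wildcard.  So hatval at a word of digits in [0, n] sums tab over
   all tuples matching it. *)
Definition wdig n x k := (dig n x k + dig 2 (x %/ n ^ q) k * (n - dig n x k))%N.
Definition haddr n x := (\sum_(k <- iota 0 q) wdig n x k * n.+1 ^ k)%N.

Definition hatval (tab : nat -> int) n w :=
  \sum_(x < n ^ q * 2 ^ q | haddr n x == w) fval tab n (map (dig n x) (iota 0 q)).

Definition Evdig k := Edig (Var 0) (Var 3) k.
Definition Ewdig k := Op Add (Evdig k)
  (Op Mul (Edig (Const 2) (Op Div (Var 3) (Epow (Var 0) q)) k) (Op Defs.Sub (Var 0) (Evdig k))).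
Definition En1 := Op Add (Var 0) (Const 1).
Definition Ehaddr := Esum [seq Op Mul (Ewdig k) (Epow En1 k) | k <- iota 0 q].
Definition Ehbound := Op Mul (Epow (Var 0) q) (Const (2 ^ q)%N).
Definition hat_prog a := scatter 3 Ehbound (3 + a) Ehaddr
  (Elook a (map Evdig (iota 0 q)) (map Evdig (iota 0 q))).

Lemma Posz_exp (a b : nat) : Posz a ^+ b = (a ^ b)%N.
Proof. by rewrite -!natz natrX. Qed.

Lemma Posz_sum (I : Type) (r : seq I) (F : I -> nat) :
  Posz (\sum_(i <- r) F i)%N = \sum_(i <- r) Posz (F i).
Proof. by apply: (big_morph Posz PoszD). Qed.

Lemma small_Ehaddr : small Ehaddr.
Proof.
rewrite small_Esum all_map; apply/allP => k _ /=.
by rewrite !small_Epow.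
Qed.

Lemma runs_hat a : (a < 3)%N -> exists W : nat, forall (n Q L : nat) inp s,
  (0 < n)%N -> base n Q L inp s -> (forall k, arr s (3 + a) k = 0) ->
  (n ^ q * 2 ^ q < Q)%N ->
  exists s', [/\ runs (hat_prog a) s s' (W * (L ^ 2 * n ^ q)), base n Q L inp s' &
    forall k, eqm Q (arr s' (3 + a) k) (hatval (inp a) n k)].
Proof.
move=> a3.
pose ebody := Elook a (map Evdig (iota 0 q)) (map Evdig (iota 0 q)).
pose efull := modQ (Op Add (Get (3 + a) Ehaddr) ebody).
have a38 : (3 + a < 8)%N by lia.
have sv : all small (map Evdig (iota 0 q)).
  by rewrite all_map; apply/allP => k _; exact: small_Edig.
have sbody : small ebody by apply: small_Elook => //; lia.
have sfull : small efull.
  by rewrite -[small _]/(((3 + a < 8)%N && small Ehaddr && small ebody) && true) a38 small_Ehaddr sbody.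
have sbound : small Ehbound by rewrite /= small_Epow.
pose W1 := (weight Ehaddr + weight efull).+1.
exists (2 ^ q * (2 * upto_cost Ehbound + W1))%N => n Q L inp s n0 bs hz hQ.
have Q0 : (0 < Q)%N by apply: leq_trans hQ.
have L0 : (0 < L)%N by apply: leq_trans (base_var bs (isT : (0 < 16)%N)).
have [|||s' [run bs' h]] := @runs_scatter n Q L inp 3 Ehbound (3 + a) Ehaddr ebody
  (n ^ q * 2 ^ q) (fun=> (W1 * L ^ 2)%N) (haddr n)
  (fun x => fval (inp a) n (map (dig n x) (iota 0 q))) s bs isT _ sbound hQ.
- by lia.
- move=> s' bs' _; rewrite -[LHS]/(eval s' (Epow (Var 0) q) * Posz (2 ^ q)) eval_Epow.
  by rewrite [eval _ _]/= (base0 bs') Posz_exp.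
- move=> i s' iB bs' _ s'3.
  have evd k : eval s' (Evdig k) = dig n i k by apply: eval_Edig; rewrite ?[LHS]/= ?(base0 bs').
  have dn k : (dig n i k < n)%N by rewrite ltn_mod.
  have ed2 k : eval s' (Edig (Const 2) (Op Div (Var 3) (Epow (Var 0) q)) k) =
      dig 2 (i %/ n ^ q) k.
    apply: eval_Edig => //.
    rewrite -[LHS]/(var s' 3 %/ eval s' (Epow (Var 0) q))%Z eval_Epow s'3.
    by rewrite [eval _ _]/= (base0 bs') Posz_exp divz_nat.
  split.
  + rewrite eval_Esum big_map /haddr Posz_sum; apply: eq_bigr => k _.
    rewrite -[LHS]/((eval s' (Evdig k) + eval s' (Edig (Const 2) (Op Div (Var 3) (Epow (Var 0) q)) k) *
      (var s' 0 - eval s' (Evdig k))) * eval s' (Epow En1 k)) evd (base0 bs').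
    rewrite ed2.
    rewrite eval_Epow [eval _ _]/= (base0 bs') (_ : Posz n + 1 = n.+1); last by lia.
    rewrite Posz_exp /wdig !(PoszM, PoszD) subzn //; exact: ltnW.
  + rewrite (@eval_Elook _ n _ _ _ (map (dig n i) (iota 0 q)) (map (dig n i) (iota 0 q))) ?(base0 bs') //;
      try by rewrite -!map_comp; apply: eq_map.
    by rewrite /fval (base_inp bs').
  + have [_ h1] := small_cost Q0 bs' small_Ehaddr; have [_ h2] := small_cost Q0 bs' sfull.
    have L2 : (0 < L ^ 2)%N by rewrite expn_gt0 L0.
    exact: leq_trans (add_cost_lt h1 h2 (leqnn _) L2) _.
exists s'; split=> // [|k]; last first.
  by have := h k; rewrite hz add0r.
apply: leq_runs run _; rewrite sum_nat_const card_ord.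
have : (0 < n ^ q * 2 ^ q)%N by rewrite muln_gt0 !expn_gt0 n0.
have -> : (2 ^ q * (2 * upto_cost Ehbound + W1) * (L ^ 2 * n ^ q) =
  (2 * upto_cost Ehbound + W1) * (L ^ 2 * (n ^ q * 2 ^ q)))%N.
  by move: (L ^ 2)%N (n ^ q)%N (2 ^ q)%N => x y z; lia.
by move: (L ^ 2)%N (n ^ q * 2 ^ q)%N => x y; move: (upto_cost _) => u; nia.
Qed.

End HatTable.

Section WeightedSum.
Variables (q m : nat) (coef : int).

(* For v < n, the product over i of 1 - 2 [U i = v] is 1 + sum_z gam z [U z = v],
   so that the sum hatF of a table with these weights on each point v is a
   combination of wildcard sums at words over U 0, ..., U (m - 1), n. *)
Definition gam n (U : nat -> nat) z : int :=
  if (z < m)%N then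
    Posz (U z < n) * ((\prod_(i <- iota 0 z) Posz (U i != U z)) *
      (\prod_(i <- iota 0 m) (1 - 2 * Posz (U i == U z)) - 1))
  else 1.
Definition uext n (U : nat -> nat) z : nat := if (z < m)%N then U z else n.
Definition hatF (tab : nat -> int) n (U : nat -> nat) : int :=
  \sum_(t : {ffun 'I_q -> 'I_m.+1}) (\prod_(k : 'I_q) gam n U (t k)) *
    hatval q tab n (\sum_(k : 'I_q) uext n U (t k) * n.+1 ^ k)%N.
Definition omg n i (x : nat) : int :=
  if (x < n)%N then 1 else (Posz (6 * q) - Posz (4 * i.+1)) - Posz n.
Definition wterm (inp : nat -> nat -> int) n (U : nat -> nat) : int :=
  \prod_(i <- iota 0 m) omg n i (U i) * hatF (inp 0%N) n U * hatF (inp 1%N) n U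
    * hatF (inp 2) n U.

Definition EU i := Edig En1 (Var 3) i.
Definition Egam z :=
  if (z < m)%N then
    Op Mul (Elt (EU z) (Var 0)) (Op Mul (Eprod [seq Eneq (EU i) (EU z) | i <- iota 0 z])
      (Op Defs.Sub (Eprod [seq Op Defs.Sub (Const 1) (Op Mul (Const 2) (Op Eq (EU i) (EU z)))
        | i <- iota 0 m]) (Const 1)))
  else Const 1.
Definition Euext z := if (z < m)%N then EU z else Var 0.
Definition Ehataddr (t : {ffun 'I_q -> 'I_m.+1}) :=
  Esum [seq Op Mul (Euext (t k)) (Epow En1 k) | k : 'I_q <- enum 'I_q].
(** All [(m + 1) ^ q] terms are written out in the program text. Their number does not depend on
    [n], so the expression costs [O(L ^ 2)]. *)
Definition EhatF a :=
  Esum [seq Op Mul (Eprod [seq Egam (t k) | k : 'I_q <- enum 'I_q]) (Get (3 + a) (Ehataddr t))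
       | t : {ffun 'I_q -> 'I_m.+1} <- enum {ffun 'I_q -> 'I_m.+1}].
Definition Eomg i := let l := Elt (EU i) (Var 0) in
  Op Add l (Op Mul (Op Defs.Sub (Const 1) l)
    (Op Defs.Sub (Const (Posz (6 * q) - Posz (4 * i.+1))) (Var 0))).
Definition Eomgs := Eprod [seq Eomg i | i <- iota 0 m].
Definition Ewterm := Op Mul (Op Mul (Op Mul Eomgs (EhatF 0)) (EhatF 1)) (EhatF 2).
Definition wsum_prog := sumup 3 (Epow En1 m) 2 (Op Mul (Const coef) Ewterm).

Lemma small_EU i : small (EU i). Proof. exact: small_Edig. Qed.

Lemma small_Egam z : small (Egam z).
Proof.
rewrite /Egam; case: ifP => // _.
have h : small (Eprod [seq Eneq (EU i) (EU z) | i <- iota 0 z]).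
  by rewrite small_Eprod all_map; apply/allP => i _ /=; rewrite !small_Epow.
have h' : small (Eprod [seq Op Defs.Sub (Const 1) (Op Mul (Const 2) (Op Eq (EU i) (EU z)))
        | i <- iota 0 m]).
  by rewrite small_Eprod all_map; apply/allP => i _ /=; rewrite !small_Epow.
by move: h h'; move: (Eprod _) (Eprod _) => x y /= -> ->; rewrite small_Epow.
Qed.

Lemma small_EhatF a : (a < 3)%N -> small (EhatF a).
Proof.
move=> a3; rewrite small_Esum all_map; apply/allP => t _.
have a38 : (3 + a < 8)%N by lia.
have h : small (Eprod [seq Egam (t k) | k : 'I_q <- enum 'I_q]).
  by rewrite small_Eprod all_map; apply/allP => k _; exact: small_Egam.
have h' : small (Ehataddr t).
  rewrite small_Esum all_map; apply/allP => k _ /=; rewrite small_Epow // andbT /Euext.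
  by case: ifP => // _; exact: small_EU.
by rewrite -[X in is_true X]/(small (Eprod [seq Egam (t k) | k : 'I_q <- enum 'I_q]) &&
  ((3 + a < 8)%N && small (Ehataddr t))) h h' a38.
Qed.

Lemma small_Ewterm : small Ewterm.
Proof.
have h : small Eomgs.
  rewrite small_Eprod all_map; apply/allP => i _ /=.
  by rewrite !small_Epow.
have := small_EhatF (isT : (0 < 3)%N); have := small_EhatF (isT : (1 < 3)%N).
have := small_EhatF (isT : (2 < 3)%N); move: h; rewrite /Ewterm.
by move: Eomgs (EhatF 0) (EhatF 1) (EhatF 2) => x1 x2 x3 x4 /= -> -> -> ->.
Qed.

Lemma eqm_Ewterm n Q L inp s u : (0 < n)%N -> base n Q L inp s -> var s 3 = Posz u ->
  (forall a k, (a < 3)%N -> eqm Q (arr s (3 + a) k) (hatval q (inp a) n k)) ->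
  eqm Q (eval s Ewterm) (wterm inp n (dig n.+1 u)).
Proof.
move=> n0 bs s3 hh.
have v0 := base0 bs.
have e1 : eval s En1 = n.+1 by rewrite /= v0; lia.
have eU i : eval s (EU i) = dig n.+1 u i by exact: eval_Edig.
have eg z : eval s (Egam z) = gam n (dig n.+1 u) z.
  rewrite /Egam /gam; case: ifP => // _.
  rewrite -[LHS]/(eval s (Elt (EU z) (Var 0)) *
    (eval s (Eprod [seq Eneq (EU i) (EU z) | i <- iota 0 z]) *
    (eval s (Eprod [seq Op Defs.Sub (Const 1) (Op Mul (Const 2) (Op Eq (EU i) (EU z)))
        | i <- iota 0 m]) - 1))).
  rewrite eval_Elt eU [eval s (Var 0)]/= v0 ltz_nat !eval_Eprod !big_map.
  congr (_ * (_ * (_ - 1))); apply: eq_bigr => i _; first by rewrite eval_Eneq !eU eqz_nat.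
  by rewrite -[LHS]/(1 - 2 * Posz (eval s (EU i) == eval s (EU z))) !eU.
have ex z : eval s (Euext z) = uext n (dig n.+1 u) z.
  by rewrite /Euext /uext; case: ifP.
have eF a : (a < 3)%N -> eqm Q (eval s (EhatF a)) (hatF (inp a) n (dig n.+1 u)).
  move=> a3; rewrite eval_Esum big_map big_enum; apply: eqm_sum => t _.
  rewrite -[eval _ _]/(eval s (Eprod [seq Egam (t k) | k : 'I_q <- enum 'I_q]) *
     arr s (3 + a) `|eval s (Ehataddr t)|%N).
  apply: eqmM.
    by rewrite eval_Eprod big_map big_enum /eqm; congr modz; apply: eq_bigr => k _; exact: eg.
  rewrite (_ : eval s (Ehataddr t) = \sum_(k < q) uext n (dig n.+1 u) (t k) * n.+1 ^ k)%N.
    exact: hh.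
  rewrite eval_Esum big_map big_enum Posz_sum; apply: eq_bigr => k _.
  by rewrite -[LHS]/(eval s (Euext (t k)) * eval s (Epow En1 k)) ex eval_Epow e1 Posz_exp PoszM.
have eo : eval s Eomgs = \prod_(i <- iota 0 m) omg n i (dig n.+1 u i).
  rewrite eval_Eprod big_map; apply: eq_bigr => i _.
  rewrite -[LHS]/(eval s (Elt (EU i) (Var 0)) + (1 - eval s (Elt (EU i) (Var 0))) *
    ((Posz (6 * q) - Posz (4 * i.+1)) - var s 0)).
  rewrite eval_Elt eU [eval _ _]/= v0 ltz_nat /omg; case: ltnP => _ /=; first by rewrite subrr mul0r.
  by rewrite subr0 mul1r add0r.
rewrite -[eval _ _]/(eval s Eomgs * eval s (EhatF 0) * eval s (EhatF 1) * eval s (EhatF 2)) eo.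
apply: eqmM; last exact: eF.
apply: eqmM; last exact: eF.
by apply: eqmM; last exact: eF.
Qed.

Lemma runs_wsum : exists W : nat, forall (n Q L : nat) inp s,
  (0 < n)%N -> base n Q L inp s -> (n.+1 ^ m < Q)%N ->
  (forall a k, (a < 3)%N -> eqm Q (arr s (3 + a) k) (hatval q (inp a) n k)) ->
  exists s', [/\ runs wsum_prog s s' (W * (L ^ 2 * n.+1 ^ m)), base n Q L inp s' &
    eqm Q (var s' 2) (var s 2 + coef * \sum_(u < n.+1 ^ m) wterm inp n (dig n.+1 u))].
Proof.
pose efull := modQ (Op Add (Var 2) (Op Mul (Const coef) Ewterm)).
have sfull : small efull by have := small_Ewterm; rewrite /efull; move: Ewterm => x /= ->.
exists (2 * upto_cost (Epow En1 m) + (weight efull).+1)%N => n Q L inp s n0 bs hQ hh.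
have Q0 : (0 < Q)%N by apply: leq_trans hQ.
have L0 : (0 < L)%N by apply: leq_trans (base_var bs (isT : (0 < 16)%N)).
have L2 : (0 < L ^ 2)%N by rewrite expn_gt0 L0.
have [||s' [run bs' h]] := @runs_sumup n Q L inp 3 (Epow En1 m) 2 (Op Mul (Const coef) Ewterm)
  (n.+1 ^ m) (fun=> ((weight efull).+1 * L ^ 2)%N)
  (fun u => coef * wterm inp n (dig n.+1 u)) s bs isT isT isT (small_Epow _ (isT : small En1)) hQ.
- move=> s' bs' _; rewrite eval_Epow [eval _ _]/= (base0 bs') (_ : Posz n + 1 = n.+1); last by lia.
  exact: Posz_exp.
- move=> u s' uB bs' [fv fa] s'3; split.
    rewrite -[eval _ _]/(coef * eval s' Ewterm); apply: eqmM => //.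
    by apply: (eqm_Ewterm n0 bs') => // a k a3; rewrite fa //; exact: hh.
  have [_ h1] := small_cost Q0 bs' sfull.
  by rewrite mulSn -/efull; lia.
exists s'; split=> //; last by rewrite mulr_sumr.
apply: leq_runs run _; rewrite sum_nat_const card_ord.
have : (0 < n.+1 ^ m)%N by rewrite expn_gt0.
move: (L ^ 2)%N (n.+1 ^ m)%N => x y; move: (upto_cost _) (weight _) => u w; nia.
Qed.

End WeightedSum.

(** * Words as tuples of digits, and sums over injections *)

Lemma dig0 b x : dig b x 0 = (x %% b)%N.
Proof. by rewrite /dig expn0 divn1. Qed.

Lemma digS b x j : dig b x j.+1 = dig b (x %/ b) j.
Proof. by rewrite /dig expnS divnMA. Qed.

Lemma ltn_dig b x j : (0 < b)%N -> (dig b x j < b)%N.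
Proof. exact: ltn_pmod. Qed.

Lemma dig_inj b r x y : (0 < b)%N -> (x < b ^ r)%N -> (y < b ^ r)%N ->
  (forall j, (j < r)%N -> dig b x j = dig b y j) -> x = y.
Proof.
case: b => // b _; elim: r x y => [|r IH] x y xr yr xy; first by move: xr yr; rewrite expn0; lia.
rewrite (divn_eq x b.+1) (divn_eq y b.+1).
have := xy 0%N isT; rewrite !dig0 => ->; congr (_ * _ + _)%N; apply: IH.
- by rewrite ltn_divLR // mulnC -expnS.
- by rewrite ltn_divLR // mulnC -expnS.
- by move=> j jr; rewrite -!digS; exact: xy.
Qed.

Lemma dig_low b r x y j : (0 < b)%N -> (j < r)%N -> dig b (y * b ^ r + x) j = dig b x j.
Proof.
move=> b0 jr; rewrite /dig -{1}(subnK jr) addnS -addSn expnD mulnA divnMDl ?expn_gt0 ?b0 //.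
by rewrite expnSr mulnA modnMDl.
Qed.

Lemma divn_high b r x y : (x < b ^ r)%N -> ((y * b ^ r + x) %/ b ^ r)%N = y.
Proof. by move=> xr; rewrite divnMDl ?divn_small ?addn0 // (leq_ltn_trans _ xr). Qed.

Lemma sum_divn a b (F : nat -> int) :
  \sum_(x < a * b) F x = \sum_(y < b) \sum_(x < a) F (y * a + x)%N.
Proof.
elim: b => [|b IH]; first by rewrite muln0 !big_ord0.
by rewrite mulnSr big_split_ord /= IH big_ord_recr /= [(a * b)%N]mulnC.
Qed.

Definition digits b r x : {ffun 'I_r -> 'I_b.+1} := [ffun j => inord (dig b.+1 x (val j))].

Lemma digitsE b r x j : digits b r x j = dig b.+1 x j :> nat.
Proof. by rewrite ffunE inordK // ltn_dig. Qed.

Lemma sum_digits b r (F : {ffun 'I_r -> 'I_b.+1} -> int) :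
  \sum_(x < b.+1 ^ r) F (digits b r x) = \sum_v F v.
Proof.
have bij : bijective (fun x : 'I_(b.+1 ^ r) => digits b r x).
  apply: inj_card_bij; last by rewrite card_ffun !card_ord.
  move=> x y /ffunP xy; apply: val_inj; apply: (@dig_inj b.+1 r _ _ isT (ltn_ord x) (ltn_ord y)) => j jr.
  by have := xy (Ordinal jr); move/(congr1 val); rewrite /= !digitsE.
by rewrite [RHS](reindex _ (onW_bij _ bij)).
Qed.

Lemma map_dig b r x :
  map (dig b.+1 x) (iota 0 r) = map val (codom (digits b r x)).
Proof.
rewrite codomE -map_comp -val_enum_ord -map_comp.
by apply: eq_map => j /=; rewrite digitsE.
Qed.

(** An [r]-set is the image of exactly [r!] injections, counted as the injections into it: an
    injection into a set of [r] elements is onto. *)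
Lemma sum_inj (T : finType) r (F : {set T} -> int) :
  \sum_(v : {ffun 'I_r -> T} | injectiveb v) F [set v j | j : 'I_r] =
  r`!%:Z * \sum_(S : {set T} | #|S| == r) F S.
Proof.
rewrite (partition_big (fun v : {ffun 'I_r -> T} => [set v j | j : 'I_r]) (fun S => #|S| == r)).
  rewrite mulr_sumr; apply: eq_bigr => S /eqP Sr.
  rewrite (eq_bigr (fun=> F S)); last by move=> v /andP[_ /eqP ->].
  rewrite sumr_const -mulr_natl natz; congr (Posz _ * _).
  have := card_inj_ffuns_on 'I_r (mem S).
  rewrite card_ord Sr ffactnn => <-; apply: eq_card => v; rewrite !inE unfold_in.
  case vI: (injectiveb v); rewrite ?andbF //= andbT; apply/eqP/forallP => [<- j|vS].
    by apply: imset_f.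
  have cv : #|[set v j | j : 'I_r]| = r by rewrite card_imset ?card_ord //; exact/injectiveP.
  apply/eqP; rewrite eqEcard Sr cv leqnn andbT.
  by apply/fintype.subsetP => x /imsetP[j _ ->]; exact: vS.
by move=> v /injectiveP vI; rewrite card_imset // card_ord.
Qed.

Lemma fval_codom n q (tab : nat -> int) (F : {set 'I_n} -> int)
  (v : {ffun 'I_q -> 'I_n}) :
  (forall l : seq 'I_n, uniq l -> size l = q -> tab (rcode n (map val l)) = F [set i in l]) ->
  fval tab n (map val (codom v)) = if injectiveb v then F [set v j | j : 'I_q] else 0.
Proof.
move=> Htab; rewrite /fval map_inj_uniq; last exact: val_inj.
have -> : uniq (codom v) = injectiveb v by [].
case vI: (injectiveb v); last by rewrite mul0r.
rewrite mul1r Htab ?size_codom ?card_ord //; congr F.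
apply/setP => i; rewrite !inE; apply/codomP/imsetP => [[j ->]|[j _ ->]]; by exists j.
Qed.

Lemma prod_forall (I : finType) (P : pred I) :
  Posz [forall i, P i] = \prod_i Posz (P i).
Proof.
case: (boolP [forall i, P i]) => [/forallP h|].
  by rewrite big1 // => i _; rewrite h.
by rewrite negb_forall => /existsP[i /negPf nPi]; rewrite (bigD1 i) //= nPi mul0r.
Qed.

(** * Closed form of the combination of wildcard sums *)

Section HatClosedForm.
Variables (q m n' : nat) (tab : nat -> int) (U : nat -> nat).
Let n := n'.+1.
Hypothesis Un : forall i, (i < m)%N -> (U i <= n)%N.

Definition psi x : int := \prod_(i <- iota 0 m) (1 - 2 * Posz (U i == x)).

(** Only the first position carrying [x] survives, so a point occurring several times in the word is
    corrected once. *)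
Lemma sum_first x : \sum_(z < m) Posz (U z == x) * \prod_(i <- iota 0 z) Posz (U i != U z) =
  Posz (x \in map U (iota 0 m)).
Proof.
elim: (m) => [|k IH]; first by rewrite big_ord0.
have -> : iota 0 k.+1 = iota 0 k ++ [:: k] by rewrite -addn1 iotaD.
rewrite big_ord_recr IH map_cat mem_cat inE /= [x == _]eq_sym.
have -> : \prod_(i <- iota 0 k) Posz (U i != U k) = Posz (U k \notin map U (iota 0 k)).
  elim: (iota 0 k) => [|i s IHs]; first by rewrite big_nil.
  by rewrite big_cons IHs /= inE negb_or [U k == _]eq_sym; case: (_ != _); rewrite ?mul1r ?mul0r.
case: eqP => [->|_]; last by rewrite orbF mul0r addr0.
by rewrite orbT mul1r; case: (_ \in _).
Qed.

(** For a genuine point the wildcard position [z = m] contributes nothing, and by [sum_first] one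
    copy of the correction remains. *)
Lemma sum_gam x : (x < n)%N ->
  \sum_(z < m.+1) gam m n U z * Posz (x == uext m n U z) = psi x - 1.
Proof.
move=> xn; rewrite big_ord_recr /= {2}/uext ltnn (ltn_eqF xn) mulr0 addr0.
transitivity (\sum_(z < m) (Posz (U z == x) * \prod_(i <- iota 0 z) Posz (U i != U z)) * (psi x - 1)).
  apply: eq_bigr => z _; rewrite /gam /uext /= ltn_ord [x == _]eq_sym.
  by case: eqP => [->|_]; rewrite ?mulr0 ?mul0r // xn !mul1r mulr1.
rewrite -mulr_suml sum_first; case: (boolP (x \in _)) => [_|xU]; first by rewrite mul1r.
rewrite mul0r /psi big1_seq ?subrr // => i /andP[_ im].
by case: eqP => [Ux|]; rewrite ?mulr0 ?subr0 //; case/negP: xU; rewrite -Ux map_f.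
Qed.

Lemma sum_gam_wild : \sum_(z < m.+1) gam m n U z * Posz (n == uext m n U z) = 1.
Proof.
rewrite big_ord_recr /= /uext ltnn eqxx mulr1 {2}/gam ltnn big1 ?add0r // => z _.
rewrite /gam ltn_ord; case: eqP => [<-|_]; last by rewrite mulr0.
by rewrite ltnn !mul0r.
Qed.

Lemma haddr_eq q' (a c : 'I_q' -> nat) b : (forall k, a k <= b)%N -> (forall k, c k <= b)%N ->
  (\sum_(k < q') a k * b.+1 ^ k == \sum_(k < q') c k * b.+1 ^ k)%N = [forall k, a k == c k].
Proof.
move=> ab cb; apply/eqP/forallP => [|h]; last by apply: eq_bigr => k _; rewrite (eqP (h k)).
elim: q' a c ab cb => [|p IH] a c ab cb; first by move=> _ [].
have split_sum (d : 'I_p.+1 -> nat) : (\sum_(k < p.+1) d k * b.+1 ^ k =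
    (\sum_(k < p) d (lift ord0 k) * b.+1 ^ k) * b.+1 + d ord0)%N.
  rewrite big_ord_recl expn0 muln1 addnC big_distrl; congr (_ + _)%N.
  by apply: eq_bigr => k _; rewrite lift0 expnSr mulnA.
rewrite !split_sum => E.
have E0 : a ord0 = c ord0.
  by move/(congr1 (modn^~ b.+1)): E; rewrite !modnMDl !modn_small // ltnS.
have E1 : (\sum_(k < p) a (lift ord0 k) * b.+1 ^ k = \sum_(k < p) c (lift ord0 k) * b.+1 ^ k)%N.
  by move/eqP: E; rewrite E0 eqn_add2r eqn_pmul2r // => /eqP.
have h := IH _ _ (fun k => ab _) (fun k => cb _) E1.
by move=> k; case: (unliftP ord0 k) => [j|] ->; [exact: h|rewrite E0].
Qed.

Definition wmix (x b : nat) := (x + b * (n - x))%N.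

Lemma hatvalE w : hatval q tab n w =
  \sum_(v : {ffun 'I_q -> 'I_n}) \sum_(b : {ffun 'I_q -> 'I_2})
    fval tab n (map val (codom v)) * Posz (\sum_(k < q) wmix (v k) (b k) * n.+1 ^ k == w)%N.
Proof.
rewrite /hatval big_mkcond.
rewrite (sum_divn _ _ (fun x => if haddr q n x == w then fval tab n (map (dig n x) (iota 0 q)) else 0)).
pose G (v : {ffun 'I_q -> 'I_n}) (b : {ffun 'I_q -> 'I_2}) : int :=
  fval tab n (map val (codom v)) *
  Posz (\sum_(k < q) wmix (v k) (b k) * n.+1 ^ k == w)%N.
have step y x : (x < n ^ q)%N ->
    (if haddr q n (y * n ^ q + x) == w then fval tab n (map (dig n (y * n ^ q + x)) (iota 0 q)) else 0) =
    G (digits n' q x) (digits 1 q y).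
  move=> xn; rewrite /G -map_dig -/n.
  have -> : map (dig n (y * n ^ q + x)) (iota 0 q) = map (dig n x) (iota 0 q).
    by apply/eq_in_map => k; rewrite mem_iota => /andP[_ kq]; rewrite dig_low.
  have -> : haddr q n (y * n ^ q + x) = (\sum_(k < q) wmix (digits n' q x k) (digits 1 q y k) * n.+1 ^ k)%N.
    rewrite /haddr -[X in iota 0 X]subn0 -/(index_iota 0 q) big_mkord; apply: eq_bigr => k _.
    by rewrite !digitsE /wdig /wmix dig_low // divn_high.
  by case: eqP; rewrite ?mulr1 ?mulr0.
under eq_bigr => y _ do under eq_bigr => x _ do rewrite step //.
rewrite exchange_big /= (sum_digits (fun v => \sum_(y < 2 ^ q) G v (digits 1 q y))).
by apply: eq_bigr => v _; rewrite (sum_digits (G v)).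
Qed.

(** At each of the [q] positions an entry is either kept, with total weight [psi - 1] by [sum_gam],
    or replaced by the wildcard, with weight 1 by [sum_gam_wild]. The two add up to [psi], and
    distributivity multiplies over the positions. *)
Lemma hatFE : hatF q m tab n U =
  \sum_(v : {ffun 'I_q -> 'I_n}) fval tab n (map val (codom v)) * \prod_(k < q) psi (v k).
Proof.
rewrite /hatF; under eq_bigr => t _ do rewrite hatvalE mulr_sumr.
rewrite exchange_big /=; apply: eq_bigr => v _.
under eq_bigr => t _ do rewrite -mulr_sumr mulrCA.
rewrite -mulr_sumr; congr (_ * _).
pose H (k : 'I_q) (b : 'I_2) (z : 'I_m.+1) : int :=
  gam m n U z * Posz (wmix (v k) b == uext m n U z).
transitivity (\prod_(k < q) \sum_(b < 2) \sum_(z < m.+1) H k b z).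
  rewrite bigA_distr_bigA /=; rewrite [RHS](eq_bigr (fun b : {ffun 'I_q -> 'I_2} =>
    \sum_(t : {ffun 'I_q -> 'I_m.+1}) \prod_(k < q) H k (b k) (t k))); last first.
    by move=> b _; rewrite bigA_distr_bigA.
  rewrite exchange_big /=; apply: eq_bigr => t _; rewrite mulr_sumr; apply: eq_bigr => b _.
  rewrite big_split /=; congr (_ * _); rewrite haddr_eq ?prod_forall // => k.
    have vn := ltn_ord (v k); rewrite /wmix; case: (b k) => [[|[|//]] _] /=; lia.
  by rewrite /uext; case: ltnP => // /Un.
apply: eq_bigr => k _; rewrite big_ord_recl big_ord1 /H.
have -> : wmix (v k) (ord0 : 'I_2) = v k by rewrite /wmix mul0n addn0.
have -> : wmix (v k) (lift ord0 ord0 : 'I_2) = n.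
  by rewrite /wmix /= mul1n subnKC // ltnW.
by rewrite sum_gam // sum_gam_wild subrK.
Qed.
End HatClosedForm.

(** * The weighted identity *)

Section WeightedIdentity.
Variables (q m n' : nat).
Let n := n'.+1.

Definition tab_for (tab : nat -> int) (F : {set 'I_n} -> int) :=
  forall l : seq 'I_n, uniq l -> size l = q -> tab (rcode n (map val l)) = F [set i in l].

(** The sign of a point relative to [S]. As a product over [S] it is 1 at the fictitious point [n],
    and exchanging two products turns [psi] into it. *)
Definition chi (S : {set 'I_n}) (y : nat) : int := \prod_(x in S) (1 - 2 * Posz (y == val x)).

Lemma chi_ord S (z : 'I_n) : chi S z = if z \in S then -1 else 1.
Proof.
case: ifP => zS.
  rewrite /chi (bigD1 z) //= eqxx big1 ?mulr1 // => x /andP[_ xz].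
  by rewrite val_eqE eq_sym (negPf xz) mulr0 subr0.
rewrite /chi big1 // => x xS; case: eqP => [zx|]; rewrite ?mulr0 ?subr0 //.
by rewrite (val_inj zx) xS in zS.
Qed.

Lemma chi_n S : chi S n = 1.
Proof.
by rewrite /chi big1 // => x _; rewrite gtn_eqF ?mulr0 ?subr0 // ltn_ord.
Qed.

Lemma hatF_chi tab F U : tab_for tab F -> (forall i, (i < m)%N -> (U i <= n)%N) ->
  hatF q m tab n U =
  q`!%:Z * \sum_(S : {set 'I_n} | #|S| == q) F S * \prod_(i <- iota 0 m) chi S (U i).
Proof.
move=> Ht Un; rewrite hatFE //.
transitivity (\sum_(v : {ffun 'I_q -> 'I_n} | injectiveb v)
    (fun S : {set 'I_n} => F S * \prod_(x in S) psi m U x) [set v j | j : 'I_q]).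
  rewrite [RHS]big_mkcond; apply: eq_bigr => v _; rewrite (fval_codom v Ht).
  case: ifP => [/injectiveP vI|_]; last by rewrite mul0r.
  by rewrite big_imset //=; apply: in2W.
rewrite (sum_inj q (fun S : {set 'I_n} => F S * \prod_(x in S) psi m U x)).
congr (_ * _); apply: eq_bigr => S _; congr (_ * _).
by rewrite /psi exchange_big.
Qed.

Definition overlap (A B C : {set 'I_n}) : nat := #|A :&: B :|: A :&: C :|: B :&: C|.

Lemma sum_omg i (A B C : {set 'I_n}) : #|A| = q -> #|B| = q -> #|C| = q ->
  \sum_(y < n.+1) omg q n i y * (chi A y * chi B y * chi C y) =
  4 * (Posz (overlap A B C) - Posz i.+1).
Proof.
move=> Aq Bq Cq; rewrite big_ord_recr /= !chi_n /omg ltnn !mulr1.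
have card_sum (S : {set 'I_n}) : \sum_(z < n) Posz (z \in S) = #|S|.
  rewrite -Posz_sum -sum1_card [in RHS]big_mkcond; congr Posz.
(* For bits a, b, c, the sign [(-1) ^ (a + b + c)] equals [1 - 2 (a + b + c)] plus 4 if at least two
   of them are 1. Summing gives [n - 6q + 4 e], and the weight of the fictitious point cancels
   [n - 6q]. *)
transitivity (\sum_(z < n) (1 - 2 * (Posz (z \in A) + Posz (z \in B) + Posz (z \in C)) +
    4 * Posz (z \in A :&: B :|: A :&: C :|: B :&: C)) +
    (Posz (6 * q) - Posz (4 * i.+1) - Posz n)).
  congr (_ + _); apply: eq_bigr => z _; rewrite /= ltn_ord mul1r !chi_ord !inE.
  by case: (z \in A); case: (z \in B); case: (z \in C).
rewrite big_split sumrB -!mulr_sumr !big_split /= !card_sum sumr_const card_ord.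
rewrite Aq Bq Cq -/(overlap A B C) -mulr_natl natz; lia.
Qed.

(** Once the three sets are fixed, the coordinates of the word are independent and the sum over
    words factors over [i]. The constant [q! ^ 3] counts the orderings of the three sets. *)
Lemma sum_wterm inp (F G H : {set 'I_n} -> int) :
  tab_for (inp 0%N) F -> tab_for (inp 1%N) G -> tab_for (inp 2) H ->
  (forall S : {set 'I_n}, #|S| != q -> F S = 0) ->
  (forall S : {set 'I_n}, #|S| != q -> G S = 0) ->
  (forall S : {set 'I_n}, #|S| != q -> H S = 0) ->
  \sum_(u < n.+1 ^ m) wterm q m inp n (dig n.+1 u) =
  Posz (q`! ^ 3) * \sum_A \sum_B \sum_C F A * G B * H C *
    \prod_(i < m) (4 * (Posz (overlap A B C) - Posz i.+1)).
Proof.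
move=> tF tG tH zF zG zH.
pose E (A B C : {set 'I_n}) (V : {ffun 'I_m -> 'I_n.+1}) : int :=
  \prod_(i < m) (omg q n i (V i) * (chi A (V i) * chi B (V i) * chi C (V i))).
pose P (V : {ffun 'I_m -> 'I_n.+1}) := Posz (q`! ^ 3) *
  \sum_A \sum_B \sum_C F A * G B * H C * E A B C V.
have step u : wterm q m inp n (dig n.+1 u) = P (digits n m u).
  have Un i : (dig n.+1 u i <= n)%N by rewrite -ltnS ltn_dig.
  rewrite /wterm (hatF_chi tF) // (hatF_chi tG) // (hatF_chi tH) //.
  have ordE (K : nat -> nat -> int) : \prod_(i <- iota 0 m) K i (dig n.+1 u i) =
      \prod_(i < m) K i (digits n m u i).
    rewrite -[X in iota 0 X]subn0 -/(index_iota 0 m) big_mkord.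
    by apply: eq_bigr => i _; rewrite digitsE.
  rewrite (ordE (fun i x => omg q n i x)).
  have allS (K : {set 'I_n} -> int) : (forall S : {set 'I_n}, #|S| != q -> K S = 0) ->
      \sum_(S : {set 'I_n} | #|S| == q) K S * \prod_(i <- iota 0 m) chi S (dig n.+1 u i) =
      \sum_S K S * \prod_(i < m) chi S (digits n m u i).
    move=> zK; rewrite big_mkcond; apply: eq_bigr => S _.
    rewrite (ordE (fun=> chi S)); case: ifP => // /negbT /zK ->.
    by rewrite mul0r.
  rewrite !allS // /P.
  have E3 (k w a b c : int) : w * (k * a) * (k * b) * (k * c) = k ^+ 3 * (w * (a * (b * c))).
    by ring.
  rewrite E3 Posz_exp; congr (_ * _); rewrite !mulr_suml mulr_sumr; apply: eq_bigr => A _.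
  rewrite !mulr_sumr; apply: eq_bigr => B _.
  rewrite !mulr_sumr; apply: eq_bigr => C _.
  by rewrite /E !big_split /=; ring.
rewrite (eq_bigr (fun u => P (digits n m (nat_of_ord u)))); last by move=> u _; exact: step.
rewrite sum_digits /P -mulr_sumr; congr (_ * _).
rewrite exchange_big; apply: eq_bigr => A _.
rewrite exchange_big; apply: eq_bigr => B _.
rewrite exchange_big; apply: eq_bigr => C _.
rewrite -mulr_sumr.
have [Aq|/zF->] := eqVneq #|A| q; last by rewrite !mul0r.
have [Bq|/zG->] := eqVneq #|B| q; last by rewrite mulr0 !mul0r.
have [Cq|/zH->] := eqVneq #|C| q; last by rewrite mulr0 !mul0r.
congr (_ * _); transitivity (\prod_(i < m) \sum_(y < n.+1)
    omg q n i y * (chi A y * chi B y * chi C y)); first by rewrite bigA_distr_bigA.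
by apply: eq_bigr => i _; exact: sum_omg.
Qed.

Definition fall (e : nat) : int := \prod_(i < m) (4 * (Posz e - Posz i.+1)).

(** This value is nonzero, so the sum over disjoint triples can be recovered by an exact
    division. *)
Lemma fall0 : fall 0 = (-4) ^+ m * m`!%:Z.
Proof.
rewrite /fall (eq_bigr (fun i : 'I_m => (-4) * Posz i.+1)); last first.
  by move=> i _; rewrite sub0r mulrN mulNr.
rewrite big_split /= prodr_const card_ord; congr (_ * _).
by rewrite fact_prod big_add1 big_mkord (big_morph Posz PoszM (erefl _)).
Qed.

Lemma fall_eq0 e : (0 < e <= m)%N -> fall e = 0.
Proof.
case: e => // e /= em; rewrite /fall (bigD1 (Ordinal em)) //=.
by rewrite subrr mulr0 mul0r.
Qed.

Lemma overlap_eq0 (A B C : {set 'I_n}) : (overlap A B C == 0%N) =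
  [&& [disjoint A & B], [disjoint A & C] & [disjoint B & C]].
Proof. by rewrite /overlap cards_eq0 !finset.setU_eq0 !finset.setI_eq0 andbA. Qed.

Lemma sum_fall (F G H : {set 'I_n} -> int) :
  \sum_A \sum_B \sum_C F A * G B * H C * fall (overlap A B C) =
  fall 0 * (\sum_(A : {set 'I_n}) \sum_(B : {set 'I_n}) \sum_(C : {set 'I_n} | [&& [disjoint A & B], [disjoint A & C] & [disjoint B & C]])
     F A * G B * H C) +
  \sum_A \sum_B \sum_C F A * G B * H C *
     (if (m < overlap A B C)%N then fall (overlap A B C) else 0).
Proof.
rewrite mulr_sumr -big_split; apply: eq_bigr => A _.
rewrite mulr_sumr -big_split; apply: eq_bigr => B _.
rewrite mulr_sumr [in RHS]big_mkcond -big_split; apply: eq_bigr => C _ /=.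
rewrite -overlap_eq0; case: eqP => [->|/eqP e0].
  by rewrite ltn0 mulr0 addr0 mulrC.
rewrite add0r; case: ltnP => // em; rewrite fall_eq0 ?mulr0 // em lt0n e0 //.
Qed.

End WeightedIdentity.

(** * Triples sorted by membership of their points *)

Section TypeSums.
Variable T : finType.

Definition typ := (bool * bool * bool)%type.
Definition inA (t : typ) := t.1.1.
Definition inB (t : typ) := t.1.2.
Definition inC (t : typ) := t.2.
Definition triple := ({set T} * {set T} * {set T})%type.

Definition tunion (p : triple) : {set T} := p.1.1 :|: p.1.2 :|: p.2.
Definition place l (t : 'I_l -> typ) (s : 'I_l -> T) : triple :=
  ([set s j | j : 'I_l & inA (t j)], [set s j | j : 'I_l & inB (t j)],
   [set s j | j : 'I_l & inC (t j)]).

(** For a fixed injection [s], assignments that give every point a nonempty type correspond to the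
    triples whose union is the image of [s]; the inverse [tau] reads off memberships. Then [sum_inj]
    turns injections into sets. *)
Lemma sum_types l (P : triple -> int) :
  \sum_(t : {ffun 'I_l -> typ} | [forall j, t j != (false, false, false)])
    \sum_(s : {ffun 'I_l -> T} | injectiveb s) P (place t s) =
  l`!%:Z * \sum_(p : triple | #|tunion p| == l) P p.
Proof.
transitivity (\sum_(s : {ffun 'I_l -> T} | injectiveb s)
    (fun S : {set T} => \sum_(p : triple | tunion p == S) P p) [set s j | j : 'I_l]).
  rewrite exchange_big; apply: eq_bigr => s /injectiveP sI.
  pose tau (p : triple) : {ffun 'I_l -> typ} :=
    [ffun j => (s j \in p.1.1, s j \in p.1.2, s j \in p.2)].
  rewrite [RHS](reindex_onto (fun t : {ffun 'I_l -> typ} => place t s) tau) /=; last first.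
    move=> -[[A B] C] /eqP pS; rewrite /place.
    have img (X : {set T}) (b : 'I_l -> bool) : X \subset tunion (A, B, C) ->
        (forall j, b j = (s j \in X)) -> [set s j | j : 'I_l & b j] = X.
      rewrite pS => XS bE; apply/setP => x; apply/imsetP/idP => [[j]|xX].
        by rewrite inE bE => sX ->.
      have /imsetP[j _ xj] := fintype.subsetP XS x xX.
      by exists j; rewrite // inE bE -xj.
    congr (_, _, _); apply: img => [|j]; rewrite ?/inA ?/inB ?/inC ?ffunE //=;
      apply/fintype.subsetP => x; rewrite !inE /= => ->; rewrite ?orbT //.
  apply: eq_big => [t|t _]; last by [].
  have -> : tau (place t s) = t.
    apply/ffunP => j; rewrite ffunE /= !mem_imset // !inE /inA /inB /inC.
    by case: (t j) => [[]].
  have -> : tunion (place t s) = s @: [set j | t j != (false, false, false)].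
    rewrite /tunion /= -!imsetU (_ : _ :|: _ = [set j | t j != (false, false, false)]) //.
    apply/setP => j; by rewrite !inE /inA /inB /inC; case: (t j) => [[[] []] []].
  have -> : [set s j | j : 'I_l] = s @: [set: 'I_l].
    by apply/setP => x; apply/imsetP/imsetP => -[j _ ->]; exists j.
  rewrite eqxx andbT; apply/forallP/eqP => [h|/(imset_inj sI)/setP h j].
    by rewrite (_ : [set j | _] = [set: 'I_l]) //; apply/setP => j; rewrite !inE h.
  by have := h j; rewrite !inE.
rewrite (sum_inj l (fun S : {set T} => \sum_(p : triple | tunion p == S) P p)); congr (_ * _).
rewrite [RHS](partition_big tunion (fun S => #|S| == l)) //=; apply: eq_bigr => S /eqP Sl.
by apply: eq_bigl => p; case: eqP => [->|]; rewrite ?andbF // Sl eqxx.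
Qed.

(** Unions of size [l] are counted [l!] times; the common multiple [b!] keeps all coefficients
    integral. *)
Lemma sum_by_types b (P : triple -> int) :
  (forall p, (b < #|tunion p|)%N -> P p = 0) ->
  b`!%:Z * \sum_p P p = \sum_(l < b.+1) (b`! %/ l`!)%N%:Z *
    \sum_(t : {ffun 'I_l -> typ} | [forall j, t j != (false, false, false)])
      \sum_(s : {ffun 'I_l -> T} | injectiveb s) P (place t s).
Proof.
move=> zP; rewrite [RHS](eq_bigr (fun l : 'I_b.+1 =>
    b`!%:Z * \sum_(p | #|tunion p| == l) P p)); last first.
  move=> l _; rewrite sum_types mulrA -PoszM divnK //.
  have lb : (l <= b)%N by rewrite -ltnS.
  by rewrite -(bin_fact lb) mulnCA dvdn_mulr.
rewrite -mulr_sumr; congr (_ * _).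
rewrite (bigID (fun p => #|tunion p| < b.+1)%N) /= [X in _ + X]big1 ?addr0; last first.
  by move=> p; rewrite -leqNgt => /zP.
rewrite (partition_big (fun p => inord #|tunion p| : 'I_b.+1) xpredT) //=.
apply: eq_bigr => l _; apply: eq_bigl => p.
apply/andP/eqP => [[pb /eqP <-]|pl]; first by rewrite inordK.
by rewrite pl ltn_ord inord_val.
Qed.
End TypeSums.

Section SumByLayout.
Variables (n' q m : nat) (F G H : {set 'I_n'.+1} -> int).
Let n := n'.+1.

Definition placed l (t : 'I_l -> typ) : int :=
  \sum_(s : {ffun 'I_l -> 'I_n} | injectiveb s)
    let p := place t s in F p.1.1 * G p.1.2 * H p.2.

Definition multi (t : typ) : bool := inA t && inB t || inA t && inC t || inB t && inC t.

Definition proper_types l (t : 'I_l -> typ) : bool :=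
  [&& [forall j, t j != (false, false, false)],
      #|[set j | inA (t j)]| == q, #|[set j | inB (t j)]| == q, #|[set j | inC (t j)]| == q
    & (m < #|[set j | multi (t j)]|)%N].

Hypothesis zF : forall S : {set 'I_n}, #|S| != q -> F S = 0.
Hypothesis zG : forall S : {set 'I_n}, #|S| != q -> G S = 0.
Hypothesis zH : forall S : {set 'I_n}, #|S| != q -> H S = 0.

(** Along an injection, the sizes of the three sets and of their overlap can be read off the types,
    so [fall] is constant on the inner sum. A union of three [q]-sets has at most [3q] points, which
    bounds [l]. *)
Lemma sum_overlap_by_types :
  (3 * q)`!%:Z * (\sum_A \sum_B \sum_C F A * G B * H C *
     (if (m < overlap A B C)%N then fall m (overlap A B C) else 0)) =
  \sum_(l < (3 * q).+1) ((3 * q)`! %/ l`!)%N%:Z *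
    \sum_(t : {ffun 'I_l -> typ} | proper_types t)
      fall m #|[set j | multi (t j)]| * placed t.
Proof.
pose P (p : triple 'I_n) : int := F p.1.1 * G p.1.2 * H p.2 *
     (if (m < overlap p.1.1 p.1.2 p.2)%N then fall m (overlap p.1.1 p.1.2 p.2) else 0).
have -> : \sum_A \sum_B \sum_C F A * G B * H C *
     (if (m < overlap A B C)%N then fall m (overlap A B C) else 0) = \sum_p P p.
  rewrite pair_bigA /= pair_bigA /=; exact: eq_bigr.
rewrite sum_by_types; last first.
  move=> -[[A B] C] /= big_u; rewrite /P /=.
  have [Aq|/zF->] := eqVneq #|A| q; last by rewrite !mul0r.
  have [Bq|/zG->] := eqVneq #|B| q; last by rewrite mulr0 !mul0r.
  have [Cq|/zH->] := eqVneq #|C| q; last by rewrite mulr0 !mul0r.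
  exfalso; move: big_u; rewrite ltnNge => /negP; apply.
  rewrite /tunion /= cardsU (leq_trans (leq_subr _ _)) // cardsU Aq Bq Cq.
  by have := leq_subr #|A :&: B| (q + q); lia.
apply: eq_bigr => l _; congr (_ * _).
rewrite [LHS]big_mkcond [RHS]big_mkcond; apply: eq_bigr => t _.
rewrite /proper_types; case: forallP => //= _.
case: ifP => [/and4P[/eqP Aq /eqP Bq /eqP Cq em]|nope].
  rewrite /placed mulr_sumr; apply: eq_bigr => s /injectiveP sI.
  have -> : P (place t s) = let p := place t s in F p.1.1 * G p.1.2 * H p.2 * fall m #|[set j | multi (t j)]|.
    rewrite /P /overlap /= -!imsetI; try by move=> x y _ _; exact: sI.
    rewrite -!imsetU card_imset //.
    rewrite (_ : _ :|: _ = [set j | multi (t j)]) ?em //.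
    by apply/setP => j; rewrite !inE.
  by rewrite mulrC.
apply: big1 => s /injectiveP sI; rewrite /P /=.
have [Aq|/zF->] := eqVneq #|[set s j | j : 'I_l & inA (t j)]| q; last by rewrite !mul0r.
have [Bq|/zG->] := eqVneq #|[set s j | j : 'I_l & inB (t j)]| q; last by rewrite mulr0 !mul0r.
have [Cq|/zH->] := eqVneq #|[set s j | j : 'I_l & inC (t j)]| q; last by rewrite mulr0 !mul0r.
rewrite !card_imset // in Aq Bq Cq.
rewrite /overlap -!imsetI; try by move=> x y _ _; exact: sI.
rewrite -!imsetU card_imset //.
rewrite (_ : _ :|: _ = [set j | multi (t j)]); last by apply/setP => j; rewrite !inE.
by move: nope; rewrite Aq Bq Cq !eqxx /= => ->; rewrite mulr0.
Qed.

End SumByLayout.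

Lemma dig_cat b r x y j : (0 < b)%N -> (x < b ^ r)%N ->
  dig b (x + b ^ r * y) j = if (j < r)%N then dig b x j else dig b y (j - r).
Proof.
move=> b0 xr; rewrite addnC mulnC; case: ltnP => jr; first exact: dig_low.
by rewrite /dig -[in LHS](subnKC jr) expnD divnMA divn_high.
Qed.

Lemma sum_divnC a b (F : nat -> int) :
  \sum_(x < a * b) F x = \sum_(x < a) \sum_(y < b) F (x + a * y)%N.
Proof.
rewrite sum_divn exchange_big; apply: eq_bigr => x _; apply: eq_bigr => y _.
by rewrite addnC mulnC.
Qed.

(** Any two of the four blocks occur together in one of the three lists. This lets F, G and H each
    test only the points that they see. *)
Lemma uniq_cat4 (T : eqType) (a b c d : seq T) :
  uniq (a ++ b ++ c ++ d) =
  [&& uniq (a ++ b ++ c), uniq (a ++ b ++ d) & uniq (a ++ c ++ d)].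
Proof.
rewrite !cat_uniq !has_cat !negb_or.
by do !case: (uniq _) => //=; do !case: (~~ has _ _) => //=.
Qed.

Lemma entry_ext tab n vis sel z z' :
  (forall j, j \in vis ++ sel -> dig n z j = dig n z' j) ->
  entry tab n vis sel z = entry tab n vis sel z'.
Proof.
move=> zz; rewrite /entry; congr (Posz (uniq _) * tab (rcode n _));
  by apply/eq_in_map => j jv; apply: zz; rewrite mem_cat jv ?orbT.
Qed.

(** * The sum for one type assignment as a configuration *)

Section Placement.
Variables (n' q : nat).
Let n := n'.+1.
Implicit Types F G H : {set 'I_n} -> int.

Definition rot_typ (t : typ) : typ := (t.1.2, t.2, t.1.1).

Lemma placed_rot F G H l (t : 'I_l -> typ) :
  placed F G H t = placed G H F (rot_typ \o t).
Proof.
apply: eq_bigr => s _ /=; rewrite /inA /inB /inC /rot_typ /=.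
by rewrite mulrC mulrA mulrC mulrA.
Qed.

(** Only the multiset of types matters: a permutation of the points is absorbed by reindexing the
    injections. *)
Lemma placed_perm F G H l (t : {ffun 'I_l -> typ}) (T : seq typ) (d : typ) :
  perm_eq T (codom t) ->
  placed F G H t = placed F G H (fun j : 'I_l => nth d T j).
Proof.
move=> pT; have szT : size T = l by rewrite (perm_size pT) size_codom card_ord.
have pT' : perm_eq T [tuple t j | j < l].
  by rewrite (perm_trans pT) // codomE /= .
case/tuple_permP: pT' => p Tp.
have Tt (j : 'I_l) : nth d T j = t (p j).
  rewrite Tp -(tnth_nth d [tuple tnth [tuple t j | j < l] (p i) | i < l] j).
  by rewrite !tnth_mktuple.
rewrite /placed (reindex (fun s : {ffun 'I_l -> 'I_n} => [ffun j => s ((p^-1)%g j)])) /=; last first.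
  exists (fun s : {ffun 'I_l -> 'I_n} => [ffun j => s (p j)]) => s _; apply/ffunP => j; rewrite !ffunE.
    by rewrite permK.
  by rewrite permKV.
apply: eq_big => [s|s _].
  apply/injectiveP/injectiveP => sI x y xy.
    have : (p x) = (p y) by apply: sI; rewrite !ffunE !permK.
    exact: perm_inj.
  by move: xy; rewrite !ffunE => /sI /perm_inj.
have im (b : typ -> bool) : [set [ffun j => s ((p^-1)%g j)] j | j : 'I_l & b (t j)] =
    [set s j | j : 'I_l & b (nth d T j)].
  apply/setP => x; apply/imsetP/imsetP => -[j]; rewrite inE => bj ->.
    by exists ((p^-1)%g j); rewrite ?ffunE // inE Tt permKV.
  by exists (p j); rewrite ?ffunE ?permK // inE -Tt.
by rewrite !im.
Qed.

Variables (TO T1 T2 T3 : seq typ).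
Let o := size TO.
Let i := size T1.
Let k := size T3.
Let T := TO ++ T1 ++ T2 ++ T3.
Let d : typ := (false, false, false).
Let l := (o + (i + (i + k)))%N.

Definition layout_config coef (af ag ah : nat) : config :=
  let a := iota 0 o in let b := iota o i in let c := iota (o + i) i in
  let e := iota (o + i + i) k in
  let sel (x : typ -> bool) := [seq j <- iota 0 l | x (nth d T j)] in
  Config coef af ag ah o i k
    (a ++ b ++ c) (sel inA) (a ++ b ++ e) (sel inB) (a ++ c ++ e) (sel inC).

Hypothesis size2 : size T2 = i.
Hypothesis T1C : all (fun t => ~~ inC t) T1.
Hypothesis T2B : all (fun t => ~~ inB t) T2.
Hypothesis T3A : all (fun t => ~~ inA t) T3.

Lemma nth_layout j : nth d T j =
  if (j < o)%N then nth d TO j else if (j < o + i)%N then nth d T1 (j - o)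
  else if (j < o + i + i)%N then nth d T2 (j - o - i) else nth d T3 (j - o - i - i).
Proof.
rewrite /T !nth_cat -/o -/i size2; case: (ltnP j o) => // h1.
case: (ltnP (j - o) i); case: (ltnP j (o + i)) => // h2 h3; try by exfalso; lia.
by case: (ltnP (j - o - i) i); case: (ltnP j (o + i + i)) => // h4 h5; exfalso; lia.
Qed.

Let P j := nth d T j.

Lemma layout_inA j : (j < l)%N -> inA (P j) -> j \in iota 0 o ++ iota o i ++ iota (o + i) i.
Proof.
move=> jl; rewrite !mem_cat !mem_iota /P nth_layout !add0n leq0n /=.
case: ltnP => //= h1; case: ltnP => //= h2; case: ltnP => //= h3.
have h : (j - o - i - i < size T3)%N by rewrite -/k; move: jl; rewrite /l; lia.
by have /negP := elimT (all_nthP d) T3A _ h.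
Qed.

Lemma layout_inB j : (j < l)%N -> inB (P j) -> j \in iota 0 o ++ iota o i ++ iota (o + i + i) k.
Proof.
move=> jl; rewrite !mem_cat !mem_iota /P nth_layout !add0n leq0n /=.
case: ltnP => //= h1; case: ltnP => //= h2; case: ltnP => //= h3.
  have h : (j - o - i < size T2)%N by rewrite size2; lia.
  by have /negP := elimT (all_nthP d) T2B _ h.
by move=> _; move: jl; rewrite /l; lia.
Qed.

Lemma layout_inC j : (j < l)%N -> inC (P j) -> j \in iota 0 o ++ iota (o + i) i ++ iota (o + i + i) k.
Proof.
move=> jl; rewrite !mem_cat !mem_iota /P nth_layout !add0n leq0n /=.
case: ltnP => //= h1; case: ltnP => //= h2.
  have h : (j - o < size T1)%N by rewrite -/i; lia.
  by have /negP := elimT (all_nthP d) T1C _ h.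
by move=> _; move: jl; rewrite /l; lia.
Qed.

Lemma iota_layout : iota 0 l = iota 0 o ++ iota o i ++ iota (o + i) i ++ iota (o + i + i) k.
Proof. by rewrite /l !iotaD !add0n. Qed.

Lemma tab_place (tab : nat -> int) F (x : typ -> bool) z : tab_for q tab F ->
  count x T = q -> injectiveb (digits n' l z) ->
  tab (rcode n (map (dig n z) [seq j <- iota 0 l | x (P j)])) =
  F [set digits n' l z j | j : 'I_l & x (P j)].
Proof.
move=> Ht xq /injectiveP sI.
have szT : size T = l by rewrite /T !size_cat size2.
pose L := [seq digits n' l z j | j <- [seq j : 'I_l <- enum 'I_l | x (P (val j))]].
have LE : map val L = map (dig n z) [seq j <- iota 0 l | x (P j)].
  rewrite /L -val_enum_ord filter_map -!map_comp; apply: eq_map => j /=.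
  by rewrite digitsE.
have szL : size L = q.
  rewrite size_map size_filter -xq.
  have -> : T = [seq P j | j <- map val (enum 'I_l)].
    by rewrite val_enum_ord -szT /P map_nth_iota0 // take_size.
  by rewrite -map_comp count_map.
have uL : uniq L by rewrite map_inj_uniq // filter_uniq // enum_uniq.
rewrite -LE Ht //; congr F; apply/setP => y; rewrite inE.
apply/mapP/imsetP => -[j].
  by rewrite mem_filter => /andP[xj _] ->; exists j; rewrite // inE.
by rewrite inE => xj ->; exists j; rewrite // mem_filter xj mem_enum.
Qed.

(** A word of [l] digits assigns values to all points. Setting the block hidden from a function to 0
    does not change its entry, and by [uniq_cat4] the three tests for repetitions together say that
    the assignment is injective. *)
Lemma config_sum_placed coef (af ag ah : nat) inp F G H :
  tab_for q (inp af) F -> tab_for q (inp ag) G -> tab_for q (inp ah) H ->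
  count inA T = q -> count inB T = q -> count inC T = q ->
  config_sum (layout_config coef af ag ah) inp n =
  placed F G H (fun j : 'I_l => P j).
Proof.
move=> tF tG tH qA qB qC; set cf := layout_config coef af ag ah.
have n0 : (0 < n)%N by [].
have digz O x1 x2 y j : (O < n ^ o)%N -> (x1 < n ^ i)%N -> (x2 < n ^ i)%N ->
    dig n (zcode n o i O x1 x2 y) j =
    if (j < o)%N then dig n O j else if (j - o < i)%N then dig n x1 (j - o)
    else if (j - o - i < i)%N then dig n x2 (j - o - i) else dig n y (j - o - i - i).
  by move=> hO h1 h2; rewrite /zcode dig_cat //; case: ifP => // _; rewrite !dig_cat.
pose Phi z := cellF cf inp n z * (cellG cf inp n z * cellH cf inp n z).
transitivity (\sum_(z < n ^ l) Phi z).
  rewrite /l expnD (sum_divnC _ _ Phi); apply: eq_bigr => O _.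
  rewrite expnD (sum_divnC _ _ (fun z => Phi (O + n ^ o * z)%N)) /config_slice /=.
  rewrite -/o -/i -/k.
  pose K x1 x2 : int := cellF cf inp n (zcode n o i O x1 x2 0) *
    \sum_(y < n ^ k) cellG cf inp n (zcode n o i O x1 0 y) * cellH cf inp n (zcode n o i O 0 x2 y).
  transitivity (\sum_(x1 < n ^ i) \sum_(x2 < n ^ i) K x1 x2).
    rewrite (sum_divn _ _ (fun x => K (x %/ n ^ i) (x %% n ^ i))%N).
    apply: eq_bigr => x1 _; apply: eq_bigr => x2 _.
    by rewrite divnMDl ?expn_gt0 // divn_small // addn0 modnMDl modn_small.
  apply: eq_bigr => x1 _.
  rewrite expnD (sum_divnC _ _ (fun z => Phi (O + n ^ o * (x1 + n ^ i * z))%N)).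
  apply: eq_bigr => x2 _; rewrite /K mulr_sumr; apply: eq_bigr => y _.
  have N0 : (0 < n ^ i)%N by rewrite expn_gt0.
  rewrite /Phi -/(zcode n o i O x1 x2 y); congr (_ * (_ * _)).
  - apply: entry_ext => j; rewrite !mem_cat /= !mem_filter !mem_iota => hj.
    rewrite !digz //; case: ifP => // h1; case: ifP => // h2; case: ifP => // h3.
    exfalso; case/orP: hj => [|/andP[xj jl]]; first by lia.
    by have := layout_inA _ xj; rewrite !mem_cat !mem_iota; lia.
  - apply: entry_ext => j; rewrite !mem_cat /= !mem_filter !mem_iota => hj.
    rewrite !digz //; case: ifP => // h1; case: ifP => // h2; case: ifP => // h3.
    exfalso; case/orP: hj => [|/andP[xj jl]]; first by lia.
    by have := layout_inB _ xj; rewrite !mem_cat !mem_iota; lia.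
  - apply: entry_ext => j; rewrite !mem_cat /= !mem_filter !mem_iota => hj.
    rewrite !digz //; case: ifP => // h1; case: ifP => // h2.
    exfalso; case/orP: hj => [|/andP[xj jl]]; first by lia.
    by have := layout_inC _ xj; rewrite !mem_cat !mem_iota; lia.
pose Psi (s : {ffun 'I_l -> 'I_n}) : int := if injectiveb s then
  F [set s j | j : 'I_l & inA (P j)] * G [set s j | j : 'I_l & inB (P j)] *
  H [set s j | j : 'I_l & inC (P j)] else 0.
rewrite (eq_bigr (fun z : 'I_(n ^ l) => Psi (digits n' l z))); last first.
  move=> z _; rewrite /Phi /cellF /cellG /cellH /entry /=.
  set uF := uniq _; set uG := uniq _; set uH := uniq _.
  have uu : injectiveb (digits n' l z) = [&& uF, uG & uH].
    rewrite /uF /uG /uH !map_cat -uniq_cat4 -!map_cat -iota_layout map_dig.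
    by rewrite map_inj_uniq //; exact: val_inj.
  rewrite /Psi; case sI: (injectiveb _); move: uu; rewrite sI.
    case/esym/and3P => -> -> ->; rewrite !mul1r.
    by rewrite (tab_place tF qA sI) (tab_place tG qB sI) (tab_place tH qC sI) mulrA.
  by case: uF uG uH => -[] [] //= _; rewrite ?mul0r ?mulr0.
by rewrite sum_digits /Psi -big_mkcond.
Qed.

End Placement.

(** * A balanced layout for every type assignment *)

Lemma card_count l (t : {ffun 'I_l -> typ}) (x : pred typ) :
  #|[set j | x (t j)]| = count x (codom t).
Proof.
by rewrite cardsE cardE /enum_mem size_filter codomE count_map enumT; apply: eq_count.
Qed.

Lemma count_typ (x : pred typ) (s : seq typ) : count x s =
  (x (true, true, true) * count_mem (true, true, true) s +
   x (true, true, false) * count_mem (true, true, false) s +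
   x (true, false, true) * count_mem (true, false, true) s +
   x (true, false, false) * count_mem (true, false, false) s +
   x (false, true, true) * count_mem (false, true, true) s +
   x (false, true, false) * count_mem (false, true, false) s +
   x (false, false, true) * count_mem (false, false, true) s +
   x (false, false, false) * count_mem (false, false, false) s)%N.
Proof.
elim: s => [|[[[] []] []] s IH] /=; rewrite ?muln0 // IH /= !mulnDr; lia.
Qed.

(* a, b, c, v elements lie in the first, second, third set only, or in all
   three; p1, p2, p3 lie in exactly two sets.  The first set has the fewest
   private elements. *)
Definition balanced (q m o i k : nat) : Prop := exists a b c v p1 p2 p3 : nat,
  [/\ [/\ v + a + p1 + p2 = q, v + b + p1 + p3 = q & v + c + p2 + p3 = q],
      a <= b, a <= c & m < v + p1 + p2 + p3]%N /\
  [/\ o = v + odd a, i = p1 + b + a./2 & k = p3]%N.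

(** The two large groups collect points outside C and outside B. They have equal sizes, since
    [p1 + b = p2 + c] because B and C both have [q] points. A private point of A is seen by F in
    either group, so these points can be divided evenly. *)
Lemma layout_exists q m l (t : {ffun 'I_l -> typ}) :
  proper_types q m t ->
  (count_mem (true, false, false) (codom t) <= count_mem (false, true, false) (codom t))%N ->
  (count_mem (true, false, false) (codom t) <= count_mem (false, false, true) (codom t))%N ->
  exists TO T1 T2 T3 : seq typ,
    [/\ perm_eq (TO ++ T1 ++ T2 ++ T3) (codom t), size T2 = size T1,
        [/\ all (fun t => ~~ inC t) T1, all (fun t => ~~ inB t) T2 & all (fun t => ~~ inA t) T3]
      & balanced q m (size TO) (size T1) (size T3)].
Proof.
case/and5P=> /forallP ne /eqP qA /eqP qB /eqP qC em ab ac.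
rewrite card_count count_typ /= !mul1n !mul0n in qA.
rewrite card_count count_typ /= !mul1n !mul0n in qB.
rewrite card_count count_typ /= !mul1n !mul0n in qC.
rewrite card_count count_typ /= !mul1n !mul0n in em.
have n0 : count_mem (false, false, false) (codom t) = 0%N.
  apply/eqP; rewrite -leqn0 leqNgt -has_count has_pred1; apply/negP => /codomP[j tj].
  by have := ne j; rewrite -tj eqxx.
set v := count_mem (true, true, true) _ in qA qB qC em.
set p1 := count_mem (true, true, false) _ in qA qB em.
set p2 := count_mem (true, false, true) _ in qA qC em.
set p3 := count_mem (false, true, true) _ in qB qC em.
set a := count_mem (true, false, false) _ in qA ab ac.
set b := count_mem (false, true, false) _ in qB ab.
set c := count_mem (false, false, true) _ in qC ac.
exists (nseq v (true, true, true) ++ nseq (odd a) (true, false, false)).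
exists (nseq p1 (true, true, false) ++ nseq b (false, true, false) ++ nseq a./2 (true, false, false)).
exists (nseq p2 (true, false, true) ++ nseq c (false, false, true) ++ nseq a./2 (true, false, false)).
exists (nseq p3 (false, true, true)); split.
- have ah := odd_double_half a.
  apply/allP => x _ /=; apply/eqP; rewrite !count_cat !count_nseq.
  case: x => [[[] []] []] /=; rewrite ?n0 -?/v -?/p1 -?/p2 -?/p3 -?/a -?/b -?/c; lia.
- rewrite !size_cat !size_nseq; lia.
- by rewrite !all_cat !all_nseq /= !orbT.
- rewrite !size_cat !size_nseq; exists a, b, c, v, p1, p2, p3; split; split=> //; try split; lia.
Qed.

(** Comparing the first and third set, [p3 = p1 + a - c], which is at most [p1] since [a <= c]. *)
Lemma balanced_le q m o i k : balanced q m o i k -> (k <= i)%N.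
Proof. by case=> a [b [c [v [p1 [p2 [p3 [[[h1 h2 h3] ab ac _] [_ h5 h6]]]]]]]]; lia. Qed.

Lemma balanced_size q m o i k : balanced q m o i k -> (o <= q.+1 /\ i <= 2 * q)%N.
Proof.
case=> a [b [c [v [p1 [p2 [p3 [[[h1 h2 h3] ab ac _] [h4 h5 h6]]]]]]]].
by have := odd_double_half a; split; lia.
Qed.

Definition rot_ffun l (t : {ffun 'I_l -> typ}) : {ffun 'I_l -> typ} := [ffun j => rot_typ (t j)].

Lemma codom_rot l (t : {ffun 'I_l -> typ}) : codom (rot_ffun t) = map rot_typ (codom t).
Proof. by rewrite !codomE -map_comp; apply: eq_map => j /=; rewrite ffunE. Qed.

Lemma proper_rot q m l (t : {ffun 'I_l -> typ}) : proper_types q m t -> proper_types q m (rot_ffun t).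
Proof.
case/and5P=> /forallP ne qA qB qC em; apply/and5P; split.
- by apply/forallP => j; rewrite ffunE; have := ne j; case: (t j) => [[[] []] []].
- by move: qB; congr (_ == _); apply: eq_card => j; rewrite !inE ffunE.
- by move: qC; congr (_ == _); apply: eq_card => j; rewrite !inE ffunE.
- by move: qA; congr (_ == _); apply: eq_card => j; rewrite !inE ffunE.
- move: em; congr (_ < _)%N; apply: eq_card => j; rewrite !inE ffunE.
  by case: (t j) => [[[] []] []].
Qed.

Lemma placed_rot_ffun n' (F G H : {set 'I_n'.+1} -> int) l (t : {ffun 'I_l -> typ}) :
  placed F G H t = placed G H F (rot_ffun t).
Proof.
rewrite placed_rot; apply: eq_bigr => s _ /=.
have im (b : typ -> bool) : [set s j | j : 'I_l & b (rot_typ (t j))] =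
    [set s j | j : 'I_l & b (rot_ffun t j)].
  rewrite (_ : [set j | b (rot_typ (t j))] = [set j | b (rot_ffun t j)]) //.
  by apply/setP => j; rewrite !inE ffunE.
by rewrite -(im inA) -(im inB) -(im inC).
Qed.

Lemma count_mem_rot (s : seq typ) x : count_mem (rot_typ x) (map rot_typ s) = count_mem x s.
Proof.
rewrite count_map; apply: eq_count => y /=.
by case: x y => [[[] []] []] [[[] []] []].
Qed.

Definition computes q (cf : config) l (t : {ffun 'I_l -> typ}) :=
  forall n' inp (F G H : {set 'I_n'.+1} -> int),
    tab_for q (inp 0%N) F -> tab_for q (inp 1%N) G -> tab_for q (inp 2) H ->
    config_sum cf inp n'.+1 = placed F G H t.

(** Rotating the roles of the three sets brings one with the fewest private points to the front; the
    numbers of the input tables rotate along. *)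
Lemma config_exists q m coef l (t : {ffun 'I_l -> typ}) : proper_types q m t ->
  exists cf, [/\ cf_coef cf = coef,
    (cf_f cf < 3)%N && (cf_g cf < 3)%N && (cf_h cf < 3)%N,
    balanced q m (cf_o cf) (cf_i cf) (cf_k cf) & computes q cf t].
Proof.
move=> pt.
have key (u : {ffun 'I_l -> typ}) (x y z : nat) : proper_types q m u ->
   (count_mem (true, false, false) (codom u) <= count_mem (false, true, false) (codom u))%N ->
   (count_mem (true, false, false) (codom u) <= count_mem (false, false, true) (codom u))%N ->
   (x < 3)%N && (y < 3)%N && (z < 3)%N ->
   exists cf, [/\ cf_coef cf = coef,
    (cf_f cf < 3)%N && (cf_g cf < 3)%N && (cf_h cf < 3)%N,
    balanced q m (cf_o cf) (cf_i cf) (cf_k cf) &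
    forall n' inp (F G H : {set 'I_n'.+1} -> int),
      tab_for q (inp x) F -> tab_for q (inp y) G -> tab_for q (inp z) H ->
      config_sum cf inp n'.+1 = placed F G H u].
  move=> pu h1 h2 xyz; have [TO [T1 [T2 [T3 [pT s2 [a1 a2 a3] bal]]]]] := layout_exists pu h1 h2.
  exists (layout_config TO T1 T2 T3 coef x y z); split=> // n' inp F G H tF tG tH.
  have lE : (size TO + (size T1 + (size T1 + size T3)))%N = l.
    by have := perm_size pT; rewrite !size_cat s2 size_codom card_ord.
  case/and5P: pu => _ /eqP qA /eqP qB /eqP qC _.
  rewrite !card_count in qA qB qC.
  rewrite (config_sum_placed s2 a1 a2 a3 coef tF tG tH _ _ _); last first.
  - by rewrite (elimT seq.permP pT).
  - by rewrite (elimT seq.permP pT).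
  - by rewrite (elimT seq.permP pT).
  rewrite (placed_perm F G H (false, false, false) pT).
  by case: _ / lE.
have [|h] := boolP ((count_mem (true, false, false) (codom t) <= count_mem (false, true, false) (codom t)) &&
   (count_mem (true, false, false) (codom t) <= count_mem (false, false, true) (codom t)))%N.
  by case/andP=> g1 g2; have := key t 0%N 1%N 2 pt g1 g2 isT.
have cr x (u : {ffun 'I_l -> typ}) : count_mem (rot_typ x) (codom (rot_ffun u)) = count_mem x (codom u).
  by rewrite codom_rot count_mem_rot.
have pt1 := proper_rot pt; have pt2 := proper_rot pt1.
have [|h'] := boolP ((count_mem (false, true, false) (codom t) <= count_mem (true, false, false) (codom t)) &&
   (count_mem (false, true, false) (codom t) <= count_mem (false, false, true) (codom t)))%N.
  case/andP=> g1 g2.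
  have [||cf [c1 c2 c3 c4]] := key (rot_ffun t) 1%N 2 0%N pt1 _ _ isT.
  - by rewrite (cr (false, true, false)) (cr (false, false, true)).
  - by rewrite (cr (false, true, false)) (cr (true, false, false)).
  exists cf; split=> // n' inp F G H tF tG tH; rewrite (c4 _ _ _ _ _ tG tH tF).
  by rewrite [RHS]placed_rot_ffun.
(* Neither of the first two sets attains the minimum, so the third does, and two rotations bring it
   to the front. *)
have [||cf [c1 c2 c3 c4]] := key (rot_ffun (rot_ffun t)) 2 0%N 1%N pt2 _ _ isT.
- rewrite (cr (false, true, false)) (cr (false, false, true)).
  rewrite (cr (false, false, true)) (cr (true, false, false)); lia.
- rewrite (cr (false, true, false)) (cr (true, false, false)).
  rewrite (cr (false, false, true)) (cr (false, true, false)); lia.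
exists cf; split=> // n' inp F G H tF tG tH; rewrite (c4 _ _ _ _ _ tH tF tG).
by rewrite [RHS]placed_rot_ffun [RHS]placed_rot_ffun.
Qed.

(** * Positional codes of lists and sets *)

Definition lcode (n : nat) (l : seq nat) : nat := foldr (fun x acc => x + n * acc)%N 0%N l.

Lemma lcode_inj n l1 l2 : size l1 = size l2 -> all (fun x => x < n)%N l1 ->
  all (fun x => x < n)%N l2 -> lcode n l1 = lcode n l2 -> l1 = l2.
Proof.
elim: l1 l2 => [|x l1 IH] [|y l2] //= [sz] /andP[xn a1] /andP[yn a2] E.
have n0 : (0 < n)%N by apply: leq_ltn_trans xn.
have xy : x = y.
  by move/(congr1 (modn^~ n)): E; rewrite ![(n * _)%N]mulnC ![(_ + _ * n)%N]addnC !modnMDl !modn_small.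
congr (_ :: _) => //; apply: IH => //; apply/eqP.
by move/eqP: E; rewrite xy eqn_add2l eqn_pmul2l.
Qed.

Lemma rcode_perm n l1 l2 : perm_eq l1 l2 -> rcode n l1 = rcode n l2.
Proof.
move=> p; rewrite /rcode (perm_big _ p) /=; apply: eq_bigr => x _.
by rewrite (seq.permP p).
Qed.

(** In an increasing list, the number of elements below an entry is its index. *)
Lemma rcode_sorted n l : sorted ltn l -> rcode n l = lcode n l.
Proof.
elim: l => [|x l IH] /=; first by rewrite /rcode big_nil.
rewrite (path_sortedE ltn_trans) => /andP[xl sl]; rewrite -(IH sl) /rcode big_cons /=.
have -> : count (fun y => (y < x)%N) l = 0%N.
  by apply/eqP; rewrite -leqn0 leqNgt -has_count -all_predC; apply: sub_all xl => y /= h; rewrite -leqNgt ltnW.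
rewrite ltnn muln1 big_distrr /=; congr (_ + _)%N; rewrite !big_seq; apply: eq_bigr => y yl.
by rewrite (allP xl y yl) expnS mulnCA.
Qed.

(** * From tables to functions on q-subsets *)

Section Transfer.
Variables (U : finType) (q n' : nat).
Hypothesis Un : #|U| = n'.+1.
Let n := n'.+1.
Implicit Types (f : qset U q -> int) (A : qset U q).

Definition emb (x : U) : 'I_n := cast_ord Un (enum_rank x).
Definition unemb (i : 'I_n) : U := enum_val (cast_ord (esym Un) i).

Lemma embK : cancel emb unemb.
Proof. by move=> x; rewrite /emb /unemb cast_ordK enum_rankK. Qed.

Lemma unembK : cancel unemb emb.
Proof. by move=> i; rewrite /emb /unemb enum_valK cast_ordKV. Qed.

Definition setf f (S : {set 'I_n}) : int :=
  if insub (unemb @: S) : option (qset U q) is Some A then f A else 0.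

Lemma setf_emb f A : setf f (emb @: val A) = f A.
Proof.
by rewrite /setf -imset_comp (eq_imset _ embK) imset_id valK.
Qed.

Lemma setf0 f (S : {set 'I_n}) : #|S| != q -> setf f S = 0.
Proof.
move=> Sq; rewrite /setf insubN // card_imset //; exact: can_inj unembK.
Qed.

Lemma sum_setf f (K : {set 'I_n} -> int) :
  \sum_S setf f S * K S = \sum_A f A * K (emb @: val A).
Proof.
rewrite (partition_big (fun A : qset U q => emb @: val A) xpredT) //=.
apply: eq_bigr => S _.
rewrite (eq_bigr (fun A => f A * K S)); last by move=> A /eqP ->.
rewrite -mulr_suml; congr (_ * _).
have eqS (A : qset U q) : (emb @: val A == S) = (val A == unemb @: S).
  apply/eqP/eqP => [<-|->].
    by rewrite -imset_comp (eq_imset _ embK) imset_id.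
  by rewrite -imset_comp (eq_imset _ unembK) imset_id.
rewrite (eq_bigl _ _ eqS) /setf; case: insubP => [A _ vA|nA].
  by rewrite -vA (big_pred1 A).
by rewrite big_pred0 // => A; apply/negP => /eqP AS; case/negP: nA; rewrite -AS (valP A).
Qed.

(** The enumeration of a set is a subsequence of that of [U], so its ranks increase and [code] is a
    rank code in the sense of [rcode]. *)
Lemma sorted_rank (B : {set U}) : sorted ltn [seq val (enum_rank x) | x <- enum B].
Proof.
have -> : enum B = filter (mem B) (enum U) by rewrite enumT.
have sU : sorted ltn [seq val (enum_rank x) | x <- enum U].
  have -> : [seq val (enum_rank x) | x <- enum U] = iota 0 #|U|.
    rewrite -val_enum_ord (map_comp val enum_rank); congr map.
    apply: (@eq_from_nth _ (cast_ord (esym Un) ord0)); first by rewrite size_map -cardT size_enum_ord.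
    rewrite size_map -cardT => i iU; rewrite (nth_map (unemb ord0)) -?cardT //.
    rewrite -[i]/(nat_of_ord (Ordinal iU)) nth_ord_enum -enum_val_nth enum_valK //.
  exact: iota_ltn_sorted.
apply: (subseq_sorted ltn_trans _ sU); apply: map_subseq; exact: filter_subseq.
Qed.

Lemma codeE A : code A = lcode #|U| [seq val (enum_rank x) | x <- enum (val A)].
Proof. by rewrite /code /lcode foldr_map. Qed.

Lemma code_inj : injective (@code U q).
Proof.
move=> A B; rewrite !codeE => /lcode_inj E; apply: val_inj.
have {E} : [seq val (enum_rank x) | x <- enum (val A)] = [seq val (enum_rank x) | x <- enum (val B)].
  apply: E; rewrite ?size_map -?cardE ?(eqP (valP A)) ?(eqP (valP B)) // all_map; apply/allP => x _ /=; exact: ltn_ord.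
move/(inj_map (inj_comp val_inj enum_rank_inj)) => E.
by apply/setP => x; rewrite -mem_enum E mem_enum.
Qed.

Lemma table_code f A : table f (code A) = f A.
Proof.
rewrite /table; case: pickP => [B /eqP/code_inj -> //|/(_ A)].
by rewrite eqxx.
Qed.

Lemma tab_for_table f : tab_for q (table f) (setf f).
Proof.
move=> l ul szl.
have cq : #|unemb @: [set i in l]| == q.
  rewrite card_imset ?cardsE; last exact: can_inj unembK.
  by rewrite (card_uniqP ul) szl.
pose A : qset U q := exist (fun A : {set U} => is_true (#|A| == q)) _ cq.
have -> : [set i in l] = emb @: val A by rewrite /= -imset_comp (eq_imset _ unembK) imset_id.
rewrite setf_emb -table_code codeE -rcode_sorted; last exact: sorted_rank.
congr table; transitivity (rcode #|U| (map val l)); first by rewrite Un.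
apply: rcode_perm.
apply: uniq_perm.
- by rewrite map_inj_uniq //; exact: val_inj.
- by rewrite map_inj_uniq ?enum_uniq //; exact: inj_comp val_inj enum_rank_inj.
move=> k; apply/mapP/mapP => -[x xl ->].
  exists (unemb x); first by rewrite mem_enum imset_f // inE.
  by rewrite -[in LHS](unembK x).
rewrite mem_enum in xl; case/imsetP: xl => i; rewrite inE => il ->.
by exists i; rewrite // -[in RHS](unembK i).
Qed.

Lemma disjoint_emb (A B : {set U}) : [disjoint emb @: A & emb @: B] = [disjoint A & B].
Proof. by rewrite imset_disjoint //; exact: can_inj embK. Qed.

Lemma Delta_setf f g h : Delta f g h =
  \sum_(A : {set 'I_n}) \sum_(B : {set 'I_n})
    \sum_(C : {set 'I_n} | [&& [disjoint A & B], [disjoint A & C] & [disjoint B & C]])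
       setf f A * setf g B * setf h C.
Proof.
pose K3 (A B C : {set 'I_n}) : int :=
  Posz [&& [disjoint A & B], [disjoint A & C] & [disjoint B & C]].
transitivity (\sum_(A : {set 'I_n}) setf f A *
   (\sum_(B : {set 'I_n}) setf g B * (\sum_(C : {set 'I_n}) setf h C * K3 A B C))).
  rewrite sum_setf; apply: eq_bigr => A _; rewrite sum_setf mulr_sumr; apply: eq_bigr => B _.
  rewrite sum_setf !mulr_sumr big_mkcond; apply: eq_bigr => C _.
  rewrite /K3 !disjoint_emb; case: ifP => _; last by rewrite !mulr0.
  by rewrite mulr1 mulrA.
apply: eq_bigr => A _; rewrite mulr_sumr; apply: eq_bigr => B _.
rewrite !mulr_sumr [RHS]big_mkcond; apply: eq_bigr => C _.
by rewrite /K3; case: ifP => _; rewrite ?mulr0 // mulr1 mulrA.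
Qed.

End Transfer.

(** * Exponents *)

Section Exponents.
Variable R : realType.
Implicit Types (w al be : R).

Definition tau_of w al : R :=
  if al <= 1 / 2 then (3 - w) * (1 - al) / (36 - 6 * (1 + w) * (1 + al)) else 1 / 18.

(** For [al <= 1 / 2], clearing denominators turns the upper bound into
    [(2 - w) (1 - 2 al) <= 0]. *)
Lemma tau_bounds w al : 2 <= w -> w <= 12 / 5 -> 3 / 10 < al -> al <= 3 - w ->
  0 <= tau_of w al <= 1 / 18.
Proof.
move=> w2 w24 al0 al1; rewrite /tau_of; case: ifP => [al2|_]; last by lra.
have d0 : 0 < 36 - 6 * (1 + w) * (1 + al) by nra.
apply/andP; split; first by rewrite divr_ge0 ?(ltW d0) // mulr_ge0 //; lra.
by rewrite ler_pdivrMr //; nra.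
Qed.

(** The two conclusions treat the two terms of the cost bound for rectangular products. With
    [J = 6 ta q], the second one reduces to [q + s <= q + J <= 3q/2 - J/2], that is to [ta <= 1/18].
    The first one is linear in [v], [s], [a] and is checked at its extreme points. *)
Lemma exponent_real w al be (a b c v p1 p2 p3 q : R) :
  2 <= w -> w <= 12 / 5 -> 3 / 10 < al -> al <= 3 - w ->
  be * (1 - al) = w - 2 -> 0 <= be <= 1 ->
  0 <= a -> 0 <= b -> 0 <= c -> 0 <= v -> 0 <= p1 -> 0 <= p2 -> 0 <= p3 ->
  v + a + p1 + p2 = q -> v + b + p1 + p3 = q -> v + c + p2 + p3 = q ->
  a <= b -> a <= c -> 3 * q * (1 / 2 - tau_of w al) <= v + p1 + p2 + p3 ->
  v + (2 - al * be) * (p1 + b + a / 2) + be * p3 <= 3 * q * (1 / 2 - tau_of w al) /\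
  v + 2 * (p1 + b + a / 2) <= 3 * q * (1 / 2 - tau_of w al).
Proof.
move=> w2 w24 al0 al1 be_eq /andP[be0 be1] a0 b0 c0 v0 p10 p20 p30 e1 e2 e3 ab ac em.
have q0 : 0 <= q by lra.
have tb := tau_bounds w2 w24 al0 al1; move/andP: tb => [tau0 tau1].
set ta := tau_of w al in em tau0 tau1 *.
pose J := 6 * ta * q.
have Xe : 3 * q * (1 / 2 - ta) = 3 * q / 2 - J / 2 by rewrite /J; field.
(* Counting points with multiplicity, [3q = a + b + c + 2 (p1 + p2 + p3) + 3 v], while [em] bounds
   [v + p1 + p2 + p3] from below. *)
have j1 : a + (b + c) + v <= J by rewrite Xe in em; lra.
have Jq : J <= q / 3 by rewrite /J; nra.
have wbe : 2 - al * be = w - be by lra.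
pose s := b + c.
have i_eq : p1 + b + a / 2 = (q - v + s) / 2 by rewrite /s; lra.
have k_eq : p3 = (q - v - s + a) / 2 by rewrite /s; lra.
rewrite wbe i_eq k_eq Xe; split; last by rewrite /s; lra.
have s_le : s <= J - a - v by rewrite /s; lra.
have as2 : 2 * a <= s by rewrite /s; lra.
(* The coefficient of [v] is at most 0 since [w >= 2], and that of [s] is at least 0 since
   [be <= 1]; so the worst case is [v = 0], [s = J - a]. After this substitution the sign of
   [3 be - w] decides about [a]. *)
have -> : v + (w - be) * ((q - v + s) / 2) + be * ((q - v - s + a) / 2) =
  v * (1 - w / 2) + w * q / 2 + s * (w - 2 * be) / 2 + be * a / 2 by field.
have hv : v * (1 - w / 2) <= 0 by nra.
have hs : s * (w - 2 * be) / 2 <= (J - a) * (w - 2 * be) / 2 by nra.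
suff : w * q / 2 + J * (w - 2 * be) / 2 + a * (3 * be - w) / 2 <= 3 * q / 2 - J / 2 by lra.
have aJ : 3 * a <= J by lra.
case: (lerP al (1 / 2)) => al2.
  (* Here [be <= 2 (w - 2)], and [6 (w - 2) <= w] is [w <= 12 / 5]. *)
  have be2 : 3 * be <= w by nra.
  have ha : a * (3 * be - w) / 2 <= 0 by nra.
  (* The origin of [tau] for [al <= 1 / 2]: equality of exponents in the worst case [v = a = 0],
     [s = J]. *)
  suff : J * (w - 2 * be + 1) = (3 - w) * q by lra.
  have d0 : 36 - 6 * (1 + w) * (1 + al) != 0 by apply: lt0r_neq0; nra.
  have d1 : 1 - al != 0 by apply: lt0r_neq0; lra.
  have beE : be = (w - 2) / (1 - al) by rewrite -be_eq mulfK.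
  rewrite /J /ta /tau_of al2 beE; field.
  by rewrite d1 d0.
have taE : ta = 1 / 18 by rewrite /ta /tau_of leNgt al2.
have JE : J = q / 3 by rewrite /J taE; field.
(* From [1 - al <= 1 / 2]. If [3 be <= w], the worst case is [a = 0], and the claim becomes exactly
   this inequality. *)
have be2 : 2 * (w - 2) <= be by nra.
rewrite JE; rewrite JE in aJ; case: (lerP (3 * be) w) => be3.
  have ha : a * (3 * be - w) / 2 <= 0 by nra.
  nra.
(* Now the worst case is [a = J / 3 = q / 9], and the claim reads [11 w - 3 be <= 24]; by [be2] it
   follows from [5 w <= 12]. *)
have ha : a * (3 * be - w) <= (q / 9) * (3 * be - w) by nra.
nra.
Qed.

End Exponents.

(** The extra 1 in the exponent pays for the odd private point in the outer loop. As [e > m] means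
    [e >= m + 1], the hypothesis is on [m.+1]. *)
Lemma balanced_cost (R : realType) (w al be : R) (q m o i k n : nat) :
  2 <= w -> w <= 12 / 5 -> 3 / 10 < al -> al <= 3 - w ->
  be * (1 - al) = w - 2 -> 0 <= be <= 1 ->
  balanced q m o i k -> 3 * q%:R * (1 / 2 - tau_of w al) <= m.+1%:R -> (0 < n)%N ->
  (n ^ o)%:R * ((n ^ i)%:R `^ (2 - al * be) * (n ^ k)%:R `^ be + (n ^ i)%:R ^+ 2) <=
  2 * n%:R `^ (3 * q%:R * (1 / 2 - tau_of w al) + 1).
Proof.
move=> w2 w24 al0 al1 be_eq be01 bal hm n0; move/andP: (be01) => [be0 be1].
case: bal => a [b [c [v [p1 [p2 [p3 [[[h1 h2 h3] ab ac em] [h4 h5 h6]]]]]]]].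
have n1 : 1 <= n%:R :> R by rewrite ler1n.
have nn : n%:R != 0 :> R by rewrite pnatr_eq0 -lt0n.
have pX (j : nat) (x : R) : (n ^ j)%:R `^ x = n%:R `^ (j%:R * x).
  by rewrite natrX -powR_mulrn // -powRrM.
have nX (j : nat) : (n ^ j)%:R = n%:R `^ j%:R :> R by rewrite natrX powR_mulrn.
have pD (x y : R) : n%:R `^ x * n%:R `^ y = n%:R `^ (x + y) by rewrite powRD // nn implybT.
have [||||||e1 e2] := @exponent_real R w al be a%:R b%:R c%:R v%:R p1%:R p2%:R p3%:R q%:R
  w2 w24 al0 al1 be_eq be01 (ler0n _ _) (ler0n _ _) (ler0n _ _) (ler0n _ _) (ler0n _ _)
  (ler0n _ _) (ler0n _ _).
- by rewrite -!natrD h1.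
- by rewrite -!natrD h2.
- by rewrite -!natrD h3.
- by rewrite ler_nat.
- by rewrite ler_nat.
- by apply: le_trans hm _; rewrite -!natrD ler_nat.
set X := 3 * q%:R * _ in e1 e2 *.
have half : a./2%:R <= a%:R / 2 :> R.
  by rewrite ler_pdivlMr // -natrM ler_nat; have := odd_double_half a; lia.
have oR : o%:R <= v%:R + 1 :> R by rewrite h4 natrD lerD2l; case: (odd a).
have iR : i%:R <= p1%:R + b%:R + a%:R / 2 :> R by rewrite h5 !natrD lerD2l.
have wbe : 0 <= 2 - al * be by nra.
have b1 : n%:R `^ (o%:R + (i%:R * (2 - al * be) + k%:R * be)) <= n%:R `^ (X + 1).
  apply: ler_powR => //; rewrite h6.
  have : i%:R * (2 - al * be) <= (2 - al * be) * (p1%:R + b%:R + a%:R / 2).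
    by rewrite mulrC ler_wpM2l.
  lra.
have b2 : n%:R `^ (o%:R + 2 * i%:R) <= n%:R `^ (X + 1) by apply: ler_powR => //; lra.
rewrite mulrDr [2 * _]mulr_natl mulr2n; apply: lerD.
  by rewrite !pX nX !pD.
apply: le_trans b2; rewrite -natrX -expnM nX nX pD natrM.
by rewrite [2 * _]mulrC.
Qed.

(** The logarithm is bounded by a multiple of [n]: powers of [n] with exponent independent of [q]
    may be given away. *)
Lemma bits_dims (q i n M : nat) : (0 < n)%N -> (i <= 2 * q)%N -> (M <= n ^ i)%N ->
  (bits (n ^ i + M)%N <= (2 * q + 2) * n)%N.
Proof.
move=> n0 iq MN; rewrite bits_leP; last by rewrite muln_gt0 n0 andbT; lia.
have nn : (n < 2 ^ n)%N by apply: ltn_expl.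
rewrite absz_nat; apply: leq_ltn_trans (_ : n ^ i + n ^ i < _)%N; first by rewrite leq_add2l.
rewrite addnn -mul2n.
have h : (n ^ i <= 2 ^ (i * n))%N.
  case: (posnP i) => [->|i0]; first by rewrite mul0n !expn0.
  by rewrite mulnC expnM leq_exp2r // ltnW.
apply: leq_ltn_trans (_ : 2 ^ (i * n).+1 < _)%N; first by rewrite expnS leq_mul2l h.
by rewrite ltn_exp2l //; nia.
Qed.

(** The polylogarithmic factor costs [n ^ kk], where [kk] comes with [G] and is the same for all
    [q]. *)
Lemma mm_resources (R : realType) (w al be K : R) (kk : nat) (G : cmd) (q m : nat) :
  2 <= w -> w <= 12 / 5 -> 3 / 10 < al -> al <= 3 - w ->
  be * (1 - al) = w - 2 -> 0 <= be <= 1 ->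
  3 * q%:R * (1 / 2 - tau_of w al) <= m.+1%:R ->
  (forall N M : nat, (0 < N)%N -> (0 < M)%N -> (M <= N)%N ->
    let bd := N%:R `^ (2 - al * be) * M%:R `^ be + N%:R ^+ 2 in
    exists s t, [/\ exec G (mm_start N M) s t, mm_slp N M (slp_gates s) (slp_out s),
        (size (slp_gates s))%:R <= K * bd & t%:R <= K * bd * (bits (N + M)%N%:Z)%:R ^+ kk]) ->
  exists2 C : R, 0 <= C & exists C' : nat, forall n o i k : nat, (0 < n)%N -> balanced q m o i k ->
    exists s t, [/\ exec G (mm_start (n ^ i) (n ^ k)) s t,
      mm_slp (n ^ i) (n ^ k) (slp_gates s) (slp_out s),
      (size (slp_gates s) <= C' * n ^ (2 * q).+1)%N &
      (n ^ o * (size (slp_gates s) + t + n ^ i * n ^ i))%:R <=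
        C * n%:R `^ (3 * q%:R * (1 / 2 - tau_of w al) + (kk.+1)%:R)].
Proof.
move=> w2 w24 al0 al1 be_eq be01 hm hG.
set X := 3 * q%:R * _ in hm *.
have /andP[tau0 tau1] := tau_bounds w2 w24 al0 al1.
have X2q : X <= (2 * q)%:R.
  by rewrite /X natrM; have : 0 <= q%:R :> R by []; nra.
have K0 : 0 <= `|K| by [].
(* Size and time each take [|K|] times the bound and the [N * N] entries once; the 2 is that of
   [balanced_cost], and the power comes from [bits_dims]. *)
exists ((2 * `|K| + 1) * 2 * (2 * q + 2)%:R ^+ kk).
  by rewrite !mulr_ge0 ?exprn_ge0 // addr_ge0 // mulr_ge0.
(* A coarse polynomial bound on the number of gates, from [X <= 2 q]; it serves to choose the
   modulus. *)
exists (Num.truncn (`|K| * 2)).+1 => n o i k n0 bal.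
have kiq := balanced_le bal; have [_ iq] := balanced_size bal.
have kN : (n ^ k <= n ^ i)%N by rewrite leq_pexp2l.
have N0 j : (0 < n ^ j)%N by rewrite expn_gt0 n0.
have [s [t [ex mm hs ht]]] := hG (n ^ i)%N (n ^ k)%N (N0 _) (N0 _) kN.
have hbd := balanced_cost w2 w24 al0 al1 be_eq be01 bal hm n0.
set bd := _ + _ in hbd hs ht; rewrite -/X in hbd.
have n1 : 1 <= n%:R :> R by rewrite ler1n.
have bd0 : 0 <= bd by rewrite addr_ge0 // ?mulr_ge0 ?powR_ge0 // exprn_ge0.
have bdN : (n ^ i * n ^ i)%:R <= bd by rewrite /bd natrM -expr2 lerDr mulr_ge0 ?powR_ge0.
have o1 : 1 <= (n ^ o)%:R :> R by rewrite ler1n.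
have bd_le : bd <= 2 * n%:R `^ (X + 1).
  by apply: le_trans hbd; rewrite ler_peMl.
exists s, t; split=> //.
  rewrite -(ler_nat R); apply: (le_trans hs).
  apply: (@le_trans _ _ (`|K| * (2 * n%:R `^ (X + 1)))).
    apply: le_trans (ler_wpM2r bd0 (ler_norm K)) _; exact: ler_wpM2l.
  rewrite natrM mulrA; apply: ler_pM => //.
  - by rewrite mulr_ge0.
  - exact: powR_ge0.
  - by apply: ltW; exact: truncnS_gt.
  - by rewrite natrX -powR_mulrn //; apply: ler_powR => //; rewrite -natr1 lerD2r.
set bt := (bits _)%:R in ht.
have bt1 : 1 <= bt ^+ kk by rewrite exprn_ege1 // ler1n.
have btn : bt ^+ kk <= (2 * q + 2)%:R ^+ kk * n%:R ^+ kk.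
  rewrite -exprMn -natrM; apply: lerXn2r; rewrite ?nnegrE // ler_nat.
  exact: bits_dims.
have Kbd : K * bd <= `|K| * bd by rewrite ler_wpM2r ?ler_norm.
have Kbd0 : 0 <= `|K| * bd by rewrite mulr_ge0.
have -> : (n ^ o * (size (slp_gates s) + t + n ^ i * n ^ i))%:R =
  (n ^ o)%:R * ((size (slp_gates s))%:R + t%:R + (n ^ i * n ^ i)%:R) :> R by rewrite natrM !natrD.
have h1 : (size (slp_gates s))%:R + t%:R + (n ^ i * n ^ i)%:R <= (2 * `|K| + 1) * bd * bt ^+ kk.
  have hs' : (size (slp_gates s))%:R <= `|K| * bd * bt ^+ kk.
    by apply: (le_trans hs); apply: (le_trans Kbd); rewrite ler_peMr.
  have ht' : t%:R <= `|K| * bd * bt ^+ kk.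
    by apply: (le_trans ht); rewrite ler_wpM2r // (le_trans _ bt1).
  have hn' : (n ^ i * n ^ i)%:R <= bd * bt ^+ kk.
    by apply: (le_trans bdN); rewrite ler_peMr.
  have -> : (2 * `|K| + 1) * bd * bt ^+ kk =
    `|K| * bd * bt ^+ kk + `|K| * bd * bt ^+ kk + bd * bt ^+ kk by ring.
  by rewrite !lerD.
apply: le_trans (ler_wpM2l (ler0n _ _) h1) _.
have -> : (n ^ o)%:R * ((2 * `|K| + 1) * bd * bt ^+ kk) =
  (2 * `|K| + 1) * (((n ^ o)%:R * bd) * bt ^+ kk) by ring.
have -> : n%:R `^ (X + (kk.+1)%:R) = n%:R `^ (X + 1) * n%:R ^+ kk.
  rewrite -powR_mulrn // -powRD; last by rewrite pnatr_eq0 -lt0n n0 implybT.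
  by congr (_ `^ _); rewrite -natr1; ring.
have -> : (2 * `|K| + 1) * 2 * (2 * q + 2)%:R ^+ kk * (n%:R `^ (X + 1) * n%:R ^+ kk) =
  (2 * `|K| + 1) * ((2 * n%:R `^ (X + 1)) * ((2 * q + 2)%:R ^+ kk * n%:R ^+ kk)) by ring.
apply: ler_wpM2l; first by rewrite addr_ge0 // mulr_ge0.
apply: ler_pM => //.
- by rewrite mulr_ge0.
- by rewrite (le_trans _ bt1).
Qed.

(** * The main program *)

(* Each run of the matrix multiplication program has its own names, so that it
   starts from zeroed memory. *)
Definition slot (J j x : nat) : nat := (16 + (x * J + j))%N.

Lemma slot_inj J j : (j < J)%N -> injective (slot J j).
Proof.
move=> jJ x y /eqP; rewrite /slot eqn_add2l eqn_add2r eqn_pmul2r; last by apply: leq_ltn_trans jJ.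
by move/eqP.
Qed.

Lemma slot_neq J j j' x y : (j < J)%N -> (j' < J)%N -> j != j' -> slot J j x != slot J j' y.
Proof.
move=> jJ jJ'; apply: contra; rewrite /slot eqn_add2l => /eqP E.
by have := congr1 (modn^~ J) E; rewrite !modnMDl !modn_small // => ->.
Qed.

Lemma slot_ge J j x : (16 <= slot J j x)%N. Proof. exact: leq_addr. Qed.

Fixpoint configs_prog J j (G : cmd) (cfs : seq config) : cmd :=
  if cfs is cf :: cfs' then Seq (config_prog cf (slot J j) G) (configs_prog J j.+1 G cfs')
  else Skip.

Definition every (P : config -> Prop) (cfs : seq config) : Prop :=
  foldr (fun cf X => P cf /\ X) True cfs.

Lemma every_cat P s1 s2 : every P s1 -> every P s2 -> every P (s1 ++ s2).
Proof. by elim: s1 => //= cf s1 IH [h1 h2] h3; split=> //; exact: IH. Qed.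

Lemma every_impl (P P' : config -> Prop) s : (forall cf, P cf -> P' cf) -> every P s -> every P' s.
Proof. by move=> PP'; elim: s => //= cf s IH [/PP' h1 /IH h2]. Qed.

Definition inputs_only (cf : config) : Prop :=
  (cf_f cf < 3)%N && (cf_g cf < 3)%N && (cf_h cf < 3)%N.

(** The interface between the two halves of the argument: estimates of exponents establish it, and
    the program needs nothing else about the resources of [G]. *)
Definition config_ready (G : cmd) (n Q B : nat) (cf : config) : Prop :=
  let N := (n ^ cf_i cf)%N in let M := (n ^ cf_k cf)%N in
  exists sG tG, [/\ exec G (mm_start N M) sG tG, mm_slp N M (slp_gates sG) (slp_out sG),
    [/\ (M <= N)%N, (2 * (N * N) < Q)%N, (n ^ cf_o cf < Q)%N & (size (slp_gates sG) < Q)%N]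
    & (n ^ cf_o cf * (size (slp_gates sG) + tG + N * N) <= B)%N].

Definition unused J j s := forall j', (j <= j' < J)%N ->
  (forall x, var s (slot J j' x) = 0) /\ (forall a k, arr s (slot J j' a) k = 0).

Lemma config_prog_names cf r G y :
  (y \in wvars (config_prog cf r G)) || (y \in warrs (config_prog cf r G)) ->
  (y < 16)%N \/ exists x, y = r x.
Proof.
rewrite /= !inE !mem_cat wvars_rename warrs_rename !inE.
by do ?[case/orP]; try (by move/eqP ->; auto); try (by move/eqP ->; right; eexists);
  try (case/mapP => x _ ->; right; by exists x).
Qed.

Lemma runs_configs (G : cmd) (J : nat) (cfs : seq config) : every inputs_only cfs ->
  forall j, (j + size cfs <= J)%N -> exists W : nat, forall (n Q L B : nat) inp s,
  (0 < n)%N -> (0 < B)%N -> (0 < Q)%N -> base n Q L inp s -> unused J j s ->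
  every (config_ready G n Q B) cfs ->
  exists s', [/\ runs (configs_prog J j G cfs) s s' (W * (L ^ 2 * B)), base n Q L inp s' &
    eqm Q (var s' 2) (var s 2 + \sum_(cf <- cfs) cf_coef cf * config_sum cf inp n)].
Proof.
elim: cfs => [|cf cfs IH] /= hin j jJ.
  exists 1%N => n Q L B inp s n0 B0 Q0 bs un _; exists s; rewrite big_nil addr0; split=> //.
  have L0 : (0 < L)%N by apply: leq_trans (base_var bs (isT : (0 < 16)%N)).
  by exists 1%N; [exact: ExecSkip|rewrite mul1n muln_gt0 expn_gt0 L0].
have [cf3 hins] := hin; have jJ' : (j < J)%N by lia.
have [W1 run1] := runs_config_prog G cf3 (slot_ge J j) (slot_inj jJ').
have [|W2 run2] := IH hins j.+1; first by lia.
exists (W1 + W2)%N => n Q L B inp s n0 B0 Q0 bs un [[sG [tG [ex mm [MN N2 oQ sQ] cB]]] rd].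
have [|vr ar] := un j; first by rewrite leqnn.
have [s1 [r1 bs1 e1]] := run1 n Q L inp s sG tG n0 MN bs vr ar N2 oQ sQ ex mm.
have [fv fa] := runs_frame r1.
have un1 : unused J j.+1 s1.
  move=> j' /andP[jj' j'J]; have [|vr' ar'] := un j'; first by rewrite ltnW.
  have nin y x : y = slot J j' x -> ~~ ((y \in wvars (config_prog cf (slot J j) G)) ||
      (y \in warrs (config_prog cf (slot J j) G))).
    move=> yE; apply/negP => /config_prog_names[|[x' yE']].
      by rewrite yE ltnNge slot_ge.
    have := @slot_neq J j' j x x' j'J jJ'; rewrite -yE -yE' eqxx gtn_eqF // => /(_ isT).
    by [].
  split=> [x|a k].
    by rewrite fv ?vr' //; have := nin _ x erefl; rewrite negb_or => /andP[].
  by rewrite fa ?ar' //; have := nin _ a erefl; rewrite negb_or => /andP[].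
have [s2 [r2 bs2 e2]] := run2 n Q L B inp s1 n0 B0 Q0 bs1 un1 rd.
exists s2; split=> //.
  apply: leq_runs (runs_seq r1 r2) _; rewrite mulnDl leq_add2r.
  by rewrite leq_mul2l leq_mul2l cB !orbT.
rewrite big_cons /eqm e2 addrA -[RHS]modzDml -e1 modzDml //.
Qed.

Lemma configs_for (q m l : nat) (g : {ffun 'I_l -> typ} -> int) (ts : seq {ffun 'I_l -> typ}) :
  exists cfs : seq config,
    every (fun cf => inputs_only cf /\ balanced q m (cf_o cf) (cf_i cf) (cf_k cf)) cfs /\
    forall n' inp (F G H : {set 'I_n'.+1} -> int),
      tab_for q (inp 0%N) F -> tab_for q (inp 1%N) G -> tab_for q (inp 2) H ->
      \sum_(cf <- cfs) cf_coef cf * config_sum cf inp n'.+1 =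
      \sum_(t <- ts | proper_types q m t) g t * placed F G H t.
Proof.
elim: ts => [|t ts [cfs [ev IH]]].
  by exists [::]; split=> // n' inp F G H _ _ _; rewrite !big_nil.
case pt: (proper_types q m t); last first.
  by exists cfs; split=> // n' inp F G H tF tG tH; rewrite big_cons pt; exact: IH.
have [cf [cc cf3 bal comp]] := config_exists (g t) pt.
exists (cf :: cfs); split=> // n' inp F G H tF tG tH.
by rewrite !big_cons pt (IH _ _ _ _ _ tF tG tH) cc (comp _ _ _ _ _ tF tG tH).
Qed.

(** The list is obtained before [n] and the inputs are given, so it can be compiled into the
    program, and its length counts as a constant. *)
Lemma all_configs (q m N : nat) (g : forall l, {ffun 'I_l -> typ} -> int) :
  exists cfs : seq config,
    every (fun cf => inputs_only cf /\ balanced q m (cf_o cf) (cf_i cf) (cf_k cf)) cfs /\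
    forall n' inp (F G H : {set 'I_n'.+1} -> int),
      tab_for q (inp 0%N) F -> tab_for q (inp 1%N) G -> tab_for q (inp 2) H ->
      \sum_(cf <- cfs) cf_coef cf * config_sum cf inp n'.+1 =
      \sum_(l < N) \sum_(t : {ffun 'I_l -> typ} | proper_types q m t) g l t * placed F G H t.
Proof.
elim: N => [|N [cfs [ev IH]]].
  by exists [::]; split=> // n' inp F G H _ _ _; rewrite big_nil big_ord0.
have [cfs' [ev' IH']] := @configs_for q m N (g N) (index_enum {ffun 'I_N -> typ}).
exists (cfs ++ cfs'); split; first exact: every_cat.
move=> n' inp F G H tF tG tH; rewrite big_cat /= (IH _ _ _ _ _ tF tG tH).
by rewrite (IH' _ _ _ _ _ tF tG tH) big_ord_recr.
Qed.

(** The factors come from clearing the [l!] of the type sums, from the orderings of the three sets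
    in the weighted sum, and from the value of [fall] at disjoint triples. *)
Definition scale (q m : nat) : int := Posz ((3 * q)`!) * Posz (q`! ^ 3) * fall m 0.

Lemma scale_neq0 q m : scale q m != 0.
Proof.
rewrite /scale fall0 !mulf_neq0 ?expf_neq0 //; rewrite eqz_nat -lt0n ?expn_gt0 ?fact_gt0 //.
Qed.

(** Negative because these triples are removed again; the quotient of factorials replaces [1 / l!]
    after multiplication by [(3q)!]. *)
Definition type_coef (q m l : nat) (t : {ffun 'I_l -> typ}) : int :=
  - (Posz (q`! ^ 3) * (Posz ((3 * q)`! %/ l`!)%N * fall m #|[set j | multi (t j)]|)).

Lemma scaled_Delta (U : finType) (q m n' : nat) (f g h : qset U q -> int) (S : int) :
  #|U| = n'.+1 ->
  (forall (F G H : {set 'I_n'.+1} -> int), let inp := arr (Delta_start f g h) in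
     tab_for q (inp 0%N) F -> tab_for q (inp 1%N) G -> tab_for q (inp 2) H ->
     S = \sum_(l < (3 * q).+1) \sum_(t : {ffun 'I_l -> typ} | proper_types q m t)
       type_coef q m t * placed F G H t) ->
  Posz (3 * q)`! * (\sum_(u < n'.+2 ^ m) wterm q m (arr (Delta_start f g h)) n'.+1 (dig n'.+2 u)) + S
  = scale q m * Delta f g h.
Proof.
move=> Un hS.
pose F := setf Un f; pose G := setf Un g; pose H := setf Un h.
have tF : tab_for q (arr (Delta_start f g h) 0) F := tab_for_table Un f.
have tG : tab_for q (arr (Delta_start f g h) 1) G := tab_for_table Un g.
have tH : tab_for q (arr (Delta_start f g h) 2) H := tab_for_table Un h.
have zF (A : {set 'I_n'.+1}) : #|A| != q -> F A = 0 := @setf0 _ _ _ Un f A.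
have zG (A : {set 'I_n'.+1}) : #|A| != q -> G A = 0 := @setf0 _ _ _ Un g A.
have zH (A : {set 'I_n'.+1}) : #|A| != q -> H A = 0 := @setf0 _ _ _ Un h A.
rewrite (hS F G H tF tG tH) (sum_wterm m tF tG tH zF zG zH).
have -> : \sum_A \sum_B \sum_C F A * G B * H C *
    \prod_(i < m) (4 * (Posz (overlap A B C) - Posz i.+1)) =
  \sum_A \sum_B \sum_C F A * G B * H C * fall m (overlap A B C) by [].
rewrite sum_fall -Delta_setf.
have := @sum_overlap_by_types n' q m F G H zF zG zH.
set Y := \sum_A _ => hY.
have -> : \sum_(l < (3 * q).+1) \sum_(t : {ffun 'I_l -> typ} | proper_types q m t)
    type_coef q m t * placed F G H t = - (Posz (q`! ^ 3) * (Posz (3 * q)`! * Y)).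
  rewrite hY mulr_sumr -sumrN; apply: eq_bigr => l _.
  rewrite mulr_sumr mulr_sumr -sumrN; apply: eq_bigr => t _; rewrite /type_coef mulNr.
  by rewrite !mulrA.
rewrite /scale; move: (Posz (3 * q)`!) (Posz (q`! ^ 3)) (fall m 0) (Delta f g h) => a b c D.
ring.
Qed.

(** * Size of the result, its recovery, and the whole program *)

Lemma leq_abs_sum (I : finType) (P : pred I) (F : I -> int) (B : nat) :
  (forall i, `|F i| <= Posz B) -> `|\sum_(i | P i) F i| <= Posz (#|I| * B).
Proof.
move=> FB; apply: le_trans (ler_norm_sum _ _ _) _.
apply: (@le_trans _ _ (\sum_(i : I) Posz B)).
  by rewrite big_mkcond; apply: ler_sum => i _; case: ifP.
by rewrite sumr_const -mulr_natl natz PoszM.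
Qed.

(** Each of the three sums has at most [2 ^ n] terms; this coarse count still leaves polynomially
    many bits. *)
Lemma abs_Delta (U : finType) (q b : nat) (f g h : qset U q -> int) :
  (forall A, [/\ (bits (f A) <= b)%N, (bits (g A) <= b)%N & (bits (h A) <= b)%N]) ->
  `|Delta f g h| <= Posz (2 ^ (3 * #|U| + 3 * b)).
Proof.
move=> fb.
have qU : (#|{: qset U q}| <= 2 ^ #|U|)%N.
  have -> : (2 ^ #|U|)%N = #|{: {set U}}| by rewrite -cardsT -card_powerset powersetT cardsT.
  exact: (leq_card val val_inj).
have small z : (bits z <= b)%N -> `|z| <= Posz (2 ^ b).
  move=> zb; have := ltn_bits z; have : (2 ^ bits z <= 2 ^ b)%N by rewrite leq_exp2l.
  lia.
have t3 A B C : `|f A * g B * h C| <= Posz (2 ^ b * 2 ^ b * 2 ^ b).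
  have [fA _ _] := fb A; have [_ gB _] := fb B; have [_ _ hC] := fb C.
  rewrite !normrM !PoszM; apply: ler_pM => //; rewrite ?mulr_ge0 //; last exact: small.
  by apply: ler_pM => //; exact: small.
rewrite /Delta; apply: le_trans (leq_abs_sum _ (fun A => leq_abs_sum _ (fun B =>
  leq_abs_sum _ (fun C => t3 A B C)))) _.
rewrite lez_nat expnD !mulnA; set k := #|_|.
rewrite (mulnC 3%N) (mulnC 3%N b) !expnM; rewrite -/k in qU.
rewrite !expnS !expn0 !muln1 !mulnA !leq_mul //.
Qed.

(* Recovers the signed number z D, of absolute value below Q / 2, before dividing. *)
Definition finish (z : int) :=
  let t := modQ (Var 2) in
  Assign 0 (Op Div (Op Defs.Sub t (Op Mul (Var 1) (Elt (Var 1) (Op Mul (Const 2) t)))) (Const z)).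

Lemma eval_finish (Q : nat) (z D : int) s : var s 1 = Q -> eqm Q (var s 2) (z * D) ->
  z != 0 -> 2 * `|z * D| < Q ->
  exists2 s', exec (finish z) s s' (ecost s (if finish z is Assign _ e then e else Const 0)).+1 & var s' 0 = D.
Proof.
move=> v1 hQ z0 hb; rewrite /finish; eexists; first exact: ExecAssign.
rewrite set_varE eqxx.
rewrite -[LHS]/(((var s 2 %% var s 1)%Z - var s 1 * eval s (Elt (Var 1) (Op Mul (Const 2) (modQ (Var 2))))) %/ z)%Z.
rewrite eval_Elt [eval _ (Var 1)]/= -[eval s _]/(2 * (var s 2 %% var s 1)%Z) v1 hQ.
set y := z * D in hb *.
have -> : (y %% Q)%Z - Posz Q * Posz (Posz Q < 2 * (y %% Q)%Z)%R = y.
  have Q0 : Posz Q != 0 by lia.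
  case: (lerP 0 y) => y0.
    rewrite modz_small; last by lia.
    by rewrite ltNge (_ : 2 * y <= Q) /= ?mulr0 ?subr0 //; lia.
  have -> : (y %% Q)%Z = y + Q.
    by rewrite -[LHS](modzDr y Q) modz_small //; lia.
  by rewrite (_ : Posz Q < 2 * (y + Q)) /=; lia.
by rewrite /y mulKz.
Qed.

Section MainProgram.
Variables (q m : nat) (G : cmd) (c0 d0 c1 d1 : nat) (cfs : seq config).

(** The test sets [n = 0] apart, where positional notation in base [n] is meaningless; variable 0
    then already holds 0, the right answer when [q > 0]. *)
Definition main_prog :=
  If (Var 0)
    (Seq (prelude c0 d0 c1 d1)
    (Seq (hat_prog q 0) (Seq (hat_prog q 1) (Seq (hat_prog q 2)
    (Seq (wsum_prog q m (3 * q)`!)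
    (Seq (configs_prog (size cfs) 0 G cfs) (finish (scale q m))))))))
    Skip.

(** Records which cells are still zero: the wildcard tables, the accumulator in variable 2 and the
    names of the matrix multiplication copies all start from zero. *)
Definition untouched (V A : seq nat) s :=
  (forall x, (0 < x)%N -> x \notin V -> var s x = 0) /\
  (forall a, (2 < a)%N -> a \notin A -> forall k, arr s a k = 0).

Lemma untouched_frame V A V' A' s s' : frame V' A' s s' ->
  {subset V' <= V} -> {subset A' <= A} -> untouched V A s -> untouched V A s'.
Proof.
move=> [fv fa] sV sA [uv ua]; split=> [x x0 xV|a a2 aA k].
  by rewrite fv ?uv //; apply: contra xV; exact: sV.
by rewrite fa ?ua //; apply: contra aA; exact: sA.
Qed.

Lemma untouched_sub V A V' A' s : {subset V <= V'} -> {subset A <= A'} ->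
  untouched V A s -> untouched V' A' s.
Proof.
move=> sV sA [uv ua]; split=> [x x0 xV|a a2 aA k].
  by apply: uv => //; apply: contra xV; exact: sV.
by apply: ua => //; apply: contra aA; exact: sA.
Qed.

Hypothesis hin : every inputs_only cfs.

Lemma runs_main : exists W : nat, forall (U : finType) (f g h : qset U q -> int) (n' B : nat),
  let n := n'.+1 in let Q := modulus c0 d0 c1 d1 n in let L := bits Q in
  #|U| = n -> (0 < c0)%N -> (0 < d0)%N -> (0 < B)%N ->
  (forall A, [/\ (bits (f A) <= L)%N, (bits (g A) <= L)%N & (bits (h A) <= L)%N]) ->
  (n ^ q * 2 ^ q < Q)%N -> (n.+1 ^ m < Q)%N -> 2 * `|scale q m * Delta f g h| < Q ->
  every (config_ready G n Q B) cfs ->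
  Posz (3 * q)`! * (\sum_(u < n.+1 ^ m) wterm q m (arr (Delta_start f g h)) n (dig n.+1 u)) +
    \sum_(cf <- cfs) cf_coef cf * config_sum cf (arr (Delta_start f g h)) n
    = scale q m * Delta f g h ->
  exists2 s, runs main_prog (Delta_start f g h) s
     (W * (L ^ 2 * ((doublings c1 d1 n).+1 + n ^ q + n.+1 ^ m + B)))
   & var s 0 = Delta f g h.
Proof.
have [Wp runp] := runs_prelude c0 d0 c1 d1.
have [W0 runh0] := @runs_hat q 0 isT; have [W1 runh1] := @runs_hat q 1 isT.
have [W2 runh2] := @runs_hat q 2 isT.
have [Ww runw] := runs_wsum q m (3 * q)`!.
have [Wc runc] := runs_configs G hin (leqnn (0 + size cfs)).
pose ef := if finish (scale q m) is Assign _ e then e else Const 0.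
exists (Wp + W0 + W1 + W2 + Ww + Wc + (weight ef).+1 + 2)%N.
move=> U f g h n' B n Q L Un c00 d00 B0 fL hQ1 hQ2 hQ3 rd ident.
pose inp := arr (Delta_start f g h); pose s0 := Delta_start f g h.
have n0 : (0 < n)%N by [].
have L0 : (0 < L)%N by [].
have Q0 : (0 < Q)%N by apply: leq_ltn_trans hQ2.
have tabL (f' : qset U q -> int) k : (forall A, bits (f' A) <= L)%N -> (bits (table f' k) <= L)%N.
  by move=> fL'; rewrite /table; case: pickP.
have aL a k : (a < 8)%N -> (bits (arr s0 a k) <= L)%N.
  by case: a => [|[|[|a]]] _ //; apply: tabL => A; case: (fL A).
have un0 : untouched [::] [::] s0.
  by split=> [[|x] //|[|[|[|a]]]].
have [||s1 [r1 bs1 f1]] := runp n inp s0 n0 c00 d00 _ _ aL (fun _ _ _ => erefl).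
- by rewrite /= Un.
- by case.
have un1 : untouched [:: 1; 3] [::] s1.
  by apply: untouched_frame f1 _ _ (untouched_sub _ _ un0).
have hat_un a s s' T (V A : seq nat) : runs (hat_prog q a) s s' T -> 3 \in V -> 3 + a \in A ->
    untouched V A s -> untouched V A s'.
  move=> r V3 A3; apply: untouched_frame (runs_frame r) _ _ => x.
    by rewrite /= !inE orbb => /eqP ->.
  by rewrite /= !inE => /eqP ->.
have [|s2 [r2 bs2 h2]] := runh0 n Q L inp s1 n0 bs1 _ hQ1.
  by move=> k; case: un1 => _; apply.
have un2 : untouched [:: 1; 3] [:: 3] s2.
  by apply: hat_un r2 _ _ (untouched_sub _ _ un1).
have [|s3 [r3 bs3 h3]] := runh1 n Q L inp s2 n0 bs2 _ hQ1.
  by move=> k; case: un2 => _; apply.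
have un3 : untouched [:: 1; 3] [:: 3; 4] s3.
  apply: hat_un r3 _ _ (untouched_sub _ _ un2) => // x; rewrite !inE => ->; by [].
have [|s4 [r4 bs4 h4]] := runh2 n Q L inp s3 n0 bs3 _ hQ1.
  by move=> k; case: un3 => _; apply.
have un4 : untouched [:: 1; 3] [:: 3; 4; 5] s4.
  by apply: hat_un r4 _ _ (untouched_sub _ _ un3) => // x; rewrite !inE => /orP[] ->; rewrite ?orbT.
have hats a k : (a < 3)%N -> eqm Q (arr s4 (3 + a) k) (hatval q (inp a) n k).
  have [_ fa4] := runs_frame r4; have [_ fa3] := runs_frame r3.
  case: a => [|[|[|a]]] // _.
  - by rewrite fa4 // fa3 //; exact: h2.
  - by rewrite fa4 //; exact: h3.
have [s5 [r5 bs5 e5]] := runw n Q L inp s4 n0 bs4 hQ2 hats.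
have v42 : var s4 2 = 0 by case: un4 => -> //.
have un5 : untouched [:: 1; 3; 2] [:: 3; 4; 5] s5.
  apply: untouched_frame (runs_frame r5) _ _ (untouched_sub _ _ un4) => // x.
    by rewrite /= !inE => /or3P[] ->; rewrite ?orbT.
  by rewrite !inE => /orP[] ->; rewrite ?orbT.
have unu : unused (0 + size cfs) 0 s5.
  move=> j _; have nin x (V : seq nat) : all (fun y => (y < 16)%N) V -> slot (0 + size cfs) j x \notin V.
    by move/allP => V16; apply/negP => /V16; rewrite ltnNge slot_ge.
  case: un5 => uv ua; split=> [x|a k].
    by apply: uv; rewrite ?nin // (leq_trans _ (slot_ge _ _ _)).
  by apply: ua; rewrite ?nin // (leq_trans _ (slot_ge _ _ _)).
have [s6 [r6 bs6 e6]] := runc n Q L B inp s5 n0 B0 Q0 bs5 unu rd.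
have acc : eqm Q (var s6 2) (scale q m * Delta f g h).
  rewrite -ident /eqm e6 -modzDml e5 modzDml v42 add0r //.
have [s7 ex7 v7] := eval_finish (base1 bs6) acc (scale_neq0 q m) hQ3.
exists s7 => //.
have r7 : runs (finish (scale q m)) s6 s7 ((weight ef).+1 * L ^ 2).
  exists (ecost s6 ef).+1 => //.
  have [_] := small_cost Q0 bs6 (isT : small ef).
  by move=> ?; rewrite mulSn -add1n leq_add // expn_gt0 L0.
have [t ex tT] := runs_seq r1 (runs_seq r2 (runs_seq r3 (runs_seq r4 (runs_seq r5 (runs_seq r6 r7))))).
exists (ecost s0 (Var 0) + t).+1.
  by apply: ExecIfTrue ex; rewrite /= Un.
have bn : (ecost s0 (Var 0) <= L)%N.
  have := base_var bs1 (isT : (0 < 16)%N); rewrite (base0 bs1) /= Un //.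
move: tT bn; set E := (doublings c1 d1 n).+1.
have LL : (L <= L ^ 2)%N by rewrite expnS expn1 leq_pmulr.
move: (ecost _ _) LL => ec LL tT bn.
set S := (E + n ^ q + n.+1 ^ m + B)%N.
have hS w y : (y <= S)%N -> (w * (L ^ 2 * y) <= w * (L ^ 2 * S))%N.
  by move=> yS; rewrite !leq_mul.
have b1 := hS Wp E; have b2 := hS W0 (n ^ q)%N; have b3 := hS W1 (n ^ q)%N; have b4 := hS W2 (n ^ q)%N.
have b5 := hS Ww (n.+1 ^ m)%N; have b6 := hS Wc B; have b7 := hS (weight ef).+1 1%N.
have b8 := hS 2 1%N.
have S1 : (1 <= S)%N by rewrite /S; lia.
have {}b1 := b1 ltac:(rewrite /S; lia); have {}b2 := b2 ltac:(rewrite /S; lia).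
have {}b3 := b3 ltac:(rewrite /S; lia); have {}b4 := b4 ltac:(rewrite /S; lia).
have {}b5 := b5 ltac:(rewrite /S; lia); have {}b6 := b6 ltac:(rewrite /S; lia).
have {}b7 := b7 S1; have {}b8 := b8 S1.
rewrite !mulnDl; move: tT b1 b2 b3 b4 b5 b6 b7 b8; rewrite !muln1 /= -/E.
move: (Wp * (L ^ 2 * E))%N (W0 * (L ^ 2 * n ^ q))%N (W1 * (L ^ 2 * n ^ q))%N (W2 * (L ^ 2 * n ^ q))%N.
move: (Ww * _)%N (Wc * (L ^ 2 * B))%N ((weight ef).+1 * L ^ 2)%N (L ^ 2 * S)%N => *.

lia.
Qed.

End MainProgram.

(** * Choice of the constants and the final estimate *)

Lemma horner_nat_le (p : {poly nat}) n : (0 < n)%N ->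
  (p.[n] <= (\sum_(i < size p) nth 0 p i) * n ^ size p)%N.
Proof.
move=> n0; rewrite horner_coef big_distrl; apply: leq_sum => i _.
rewrite [X in (X <= _)%N]/(nth 0 p i * (n ^+ i)%R)%N leq_mul2l; apply/orP; right.
by rewrite natrXE leq_pexp2l // ltnW.
Qed.

(** Makes [L] at least the length of the input values, as [base] requires. *)
Lemma doublings_le c0 d0 c1 d1 n : (0 < c0)%N -> (doublings c1 d1 n <= bits (modulus c0 d0 c1 d1 n))%N.
Proof.
move=> c00; apply: ltnW; rewrite ltnNge; apply/negP => h.
have : (modulus c0 d0 c1 d1 n < 2 ^ doublings c1 d1 n)%N.
  by apply: leq_trans (ltn_bits (modulus c0 d0 c1 d1 n)) _; rewrite leq_exp2l.
by rewrite /modulus ltnNge leq_pmull // muln_gt0 c00 expn_gt0.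
Qed.

Lemma bits_modulus_le c0 d0 c1 d1 n : (0 < n)%N -> (0 < c0)%N ->
  (bits (modulus c0 d0 c1 d1 n) <= (c0 + d0 + c1) * n ^ d1.+1)%N.
Proof.
move=> n0 c00; have nd : (n <= n ^ d1.+1)%N by rewrite -{1}[n]expn1 leq_pexp2l.
have nd1 : (n ^ d1 <= n ^ d1.+1)%N by rewrite leq_pexp2l.
have h1 : (c0 + d0 * n + c1 * n ^ d1 <= (c0 + d0 + c1) * n ^ d1.+1)%N.
  rewrite !mulnDl !leq_add ?leq_mul2l ?nd ?nd1 ?orbT //.
  by rewrite leq_pmulr // expn_gt0 n0.
apply: leq_trans h1; rewrite bits_leP; last by rewrite !addn_gt0 c00.
rewrite absz_nat /modulus !expnD ltn_pmul2r ?expn_gt0 //.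
have h2 : (n.+1 ^ d0 <= 2 ^ (d0 * n))%N.
  case: (posnP d0) => [->|d00]; first by rewrite mul0n !expn0.
  by rewrite mulnC expnM leq_exp2r // ltn_expl.
apply: leq_ltn_trans (leq_mul (leqnn _) h2) _.
by rewrite ltn_pmul2r ?expn_gt0 // ltn_expl.
Qed.

Lemma lt_modulus c0 d0 c1 d1 n c e x : (0 < n)%N -> (0 < c0)%N -> (c <= c0)%N -> (e < d0)%N ->
  (x <= c * n.+1 ^ e)%N -> (x < modulus c0 d0 c1 d1 n)%N.
Proof.
move=> n0 c00 cc ed xc; apply: leq_ltn_trans xc _.
apply: leq_ltn_trans (_ : _ <= c0 * n.+1 ^ e)%N _; first by rewrite leq_mul2r cc orbT.
apply: leq_trans (_ : c0 * n.+1 ^ d0 <= _)%N; first by rewrite ltn_pmul2l // ltn_exp2l.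
by rewrite /modulus leq_pmulr // expn_gt0.
Qed.

(** The modulus has to exceed [2 ^ q n ^ q] table steps, [(n + 1) ^ m] words, [2 n ^ (4q)] matrix
    positions, [n ^ (q + 1)] outer choices and [C' n ^ (2q + 1)] gates, and to leave room for twice
    the scaled result. *)
Lemma ex_constants a b c q m : exists c0 d0 : nat,
  [/\ 0 < c0, a <= c0, 2 <= c0, b <= c0 & c <= c0]%N /\
  [/\ q < d0, m < d0, 4 * q < d0, q.+1 < d0 & (2 * q).+1 < d0]%N.
Proof. by exists (a + b + c + 2)%N, (4 * q + m + 2)%N; split; split; lia. Qed.

Lemma doublings_ge p1 b n s : (0 < n)%N -> (b <= p1 * n ^ s)%N ->
  (3 * n + 3 * b <= doublings (3 * p1 + 3) s.+1 n)%N.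
Proof.
move=> n0 hb.
have h1 : (p1 * n ^ s <= p1 * n ^ s.+1)%N by rewrite leq_mul2l leq_pexp2l ?orbT.
have h2 : (n <= n ^ s.+1)%N by rewrite -{1}[n]expn1 leq_pexp2l.
by rewrite /doublings mulnDl -mulnA; lia.
Qed.

Theorem theorem1 (R : realType)
  (omega_ge2 : 2 <= omega R)
  (omega_lt : omega R < 2 + 3728 / 10 ^+ 4 + 639 / 10 ^+ 7)
  (alpha_gt : 3 / 10 < alpha R)
  (alpha_le : alpha R <= 3 - omega R)
  (alpha_eq1 : alpha R = 1 <-> omega R = 2)
  (M1 : mm_computable (fun N M => (M <= N)%N)
          (fun N M => N%:R `^ (2 - alpha R * beta R) * M%:R `^ beta R
                      + N%:R ^+ 2))
  (M2 : mm_computable (fun N M => (N <= M)%N)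
          (fun N M => N%:R `^ (omega R - 1) * M%:R))
  (p : {poly nat}) :
  exists2 c : R, 0 <= c &
  forall q : nat, (0 < q)%N ->
  exists (P : cmd) (K : R),
  forall (U : finType) (f g h : qset U q -> int),
    (forall A : qset U q,
       [/\ (bits (f A) <= p.[#|U|])%N, (bits (g A) <= p.[#|U|])%N
         & (bits (h A) <= p.[#|U|])%N]) ->
    exists (s : state) (t : nat),
      [/\ exec P (Delta_start f g h) s t,
          var s 0 = Delta f g h
        & (0 < #|U|)%N ->
          t%:R <= K * #|U|%:R `^ (3 * q%:R * (1 / 2 - tau R) + c)].
Proof.
have w24 : omega R <= 12 / 5 by lra.
clear omega_lt M2.
have be_eq : beta R * (1 - alpha R) = omega R - 2.
  rewrite /beta; case: eqP => [al1|al1]; first by rewrite al1 (alpha_eq1.1 al1); ring.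
  by rewrite divfK // subr_eq0 eq_sym; apply/eqP.
have be01 : 0 <= beta R <= 1.
  rewrite /beta; case: eqP => [al1|/eqP al1]; first by rewrite lexx ler01.
  have al_lt : 0 < 1 - alpha R by rewrite subr_gt0 lt_neqAle al1; lra.
  by rewrite divr_ge0 ?ler_pdivrMr //; lra.
have [tau0 tau1] := andP (tau_bounds omega_ge2 w24 alpha_gt alpha_le).
have tauE : tau R = tau_of (omega R) (alpha R) by [].
rewrite -tauE in tau0 tau1.
have [G [K [kk hG]]] := M1.
pose d1 := (size p).+1; pose p1 := (\sum_(i < size p) nth 0 p i)%N.
(* [L] is [O(n ^ (d1 + 1))] and enters squared; [d1] pays for the doublings, [kk] for the
   polylogarithmic factor, and 1 for the odd private point. *)
pose c := (2 * d1.+1 + (d1 + kk.+1))%N.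
exists c%:R => // q q0.
set X := 3 * q%:R * (1 / 2 - tau R).
have q1 : 1 <= q%:R :> R by rewrite ler1n.
(* As [tau <= 1/18], [X] is at least [4q/3], so building the tables in [n ^ q] steps fits the
   budget. *)
have X0 : q%:R <= X by rewrite /X; nra.
pose m := Num.truncn X.
have mX : m%:R <= X by rewrite truncn_le (le_trans _ X0).
have Xm : X <= m.+1%:R by apply: ltW; exact: truncnS_gt.
have [C C0 [C' res]] := mm_resources omega_ge2 w24 alpha_gt alpha_le be_eq be01 Xm hG.
rewrite -tauE -/X in res.
have [cfs [ev cfsE]] := all_configs q m (3 * q).+1 (@type_coef q m).
have hin : every inputs_only cfs by apply: every_impl ev => cf [].
have [Z ZE] : exists Z : nat, `|scale q m|%N = Z by eexists.
pose c1 := (3 * p1 + 3)%N.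
have [c0 [d0 [[c00 qc c2 Cc Zc] [qd md q4d q1d q2d]]]] := ex_constants (2 ^ q) C' (2 * Z) q m.
have [W runM] := @runs_main q m G c0 d0 c1 d1 cfs hin.
pose CL := (c0 + d0 + c1)%N.
exists (main_prog q m G c0 d0 c1 d1 cfs).
(* One summand for each of the doublings, the tables, the words, where [n + 1 <= 2 n] gives [2 ^ m],
   and the configurations. *)
exists (W%:R * (CL%:R ^+ 2 * ((c1 + 1)%:R + 1 + 2 ^+ m + (C + 1)))).
move=> U f g h fb; case En: #|U| => [|n'].
  exists (Delta_start f g h), (ecost (Delta_start f g h) (Var 0) + 1).+1; split=> //.
    by apply: ExecIfFalse; [rewrite /= En|exact: ExecSkip].
  rewrite /= En /Delta big1 // => A _; exfalso.
  by have := max_card (mem (val A)); rewrite En (eqP (valP A)) leqNgt q0.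
set n := n'.+1 in En *.
have n0 : (0 < n)%N by [].
pose Q := modulus c0 d0 c1 d1 n.
pose x : R := n%:R; have x1 : 1 <= x by rewrite ler1n.
have pb : (p.[n] <= p1 * n ^ size p)%N by exact: horner_nat_le.
have pd : (3 * n + 3 * p.[n] <= doublings c1 d1 n)%N by exact: doublings_ge.
pose B := (Num.truncn (C * x `^ (X + kk.+1%:R))).+1.
have fL A : [/\ (bits (f A) <= bits Q)%N, (bits (g A) <= bits Q)%N & (bits (h A) <= bits Q)%N].
  have pQ : (p.[n] <= bits Q)%N.
    apply: leq_trans (doublings_le _ _ _ _ c00); apply: leq_trans pd.
    by apply: leq_trans (leq_addl _ _); rewrite leq_pmull.
  by case: (fb A); rewrite En => h1 h2 h3; split; exact: leq_trans pQ.
have hQ1 : (n ^ q * 2 ^ q < Q)%N.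
  apply: (@lt_modulus _ _ _ _ _ (2 ^ q) q) => //.
  by rewrite mulnC leq_mul2l leq_exp2r // leqnSn orbT.
have hQ2 : (n.+1 ^ m < Q)%N.
  by apply: (@lt_modulus _ _ _ _ _ 1 m) => //; rewrite mul1n.
have hQ3 : 2 * `|scale q m * Delta f g h| < Q.
  have hD := abs_Delta fb; rewrite En in hD.
  have e1 : 2 * `|scale q m * Delta f g h| <= Posz (2 * Z * 2 ^ (3 * n + 3 * p.[n])).
    by rewrite normrM !PoszM -mulrA ler_wpM2l // -(abszE (scale q m)) ZE; apply: ler_pM.
  apply: le_lt_trans e1 _; rewrite ltz_nat.
  apply: leq_ltn_trans (_ : 2 * Z * 2 ^ doublings c1 d1 n < _)%N.
    by rewrite leq_mul2l leq_exp2l // pd orbT.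
  rewrite /Q /modulus ltn_pmul2r ?expn_gt0 //.
  rewrite -[X in (X < _)%N]muln1; apply: leq_ltn_trans (leq_mul Zc (leqnn 1)) _.
  by rewrite ltn_pmul2l // -[X in (X < _)%N](expn0 n.+1) ltn_exp2l // (leq_ltn_trans _ qd).
have rd : every (config_ready G n Q B) cfs.
  apply: every_impl ev => cf [_ bal].
  have [s [t [ex mm sC tC]]] := res n _ _ _ n0 bal.
  have [oq iq] := balanced_size bal.
  exists s, t; split=> //.
    split; first by rewrite leq_pexp2l // (balanced_le bal).
    - apply: (@lt_modulus _ _ _ _ _ 2 (4 * q)) => //.
      rewrite leq_mul2l /= -expnD; apply: leq_trans (_ : n ^ (4 * q) <= _)%N.
        rewrite leq_pexp2l //; apply: leq_trans (leq_add iq iq) _.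
        by rewrite -mulnDl.
      by rewrite leq_exp2r ?leqnSn // muln_gt0.
    - apply: (@lt_modulus _ _ _ _ _ 1 q.+1) => //; rewrite mul1n.
      apply: leq_trans (_ : n ^ q.+1 <= _)%N; first by rewrite leq_pexp2l.
      by rewrite leq_exp2r.
    - apply: (@lt_modulus _ _ _ _ _ C' (2 * q).+1) => //.
      by apply: leq_trans sC _; rewrite leq_mul2l leq_exp2r // leqnSn orbT.
  apply: leqW; rewrite truncn_ge_nat; first exact: tC.
  by rewrite mulr_ge0 ?powR_ge0.
have ident := @scaled_Delta U q m n' f g h _ En (fun F0 G0 H0 tF tG tH => cfsE n' _ F0 G0 H0 tF tG tH).
have d00 : (0 < d0)%N by apply: leq_ltn_trans qd.
have [s [t ex tT] v0] := runM U f g h n' B En c00 d00 isT fL hQ1 hQ2 hQ3 rd ident.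
exists s, t; split=> // _.
rewrite -/x; apply: le_trans (_ : (W * (bits Q ^ 2 * ((doublings c1 d1 n).+1 + n ^ q + n.+1 ^ m + B)))%N%:R <= _).
  by rewrite ler_nat.
rewrite natrM -[W%:R * _ * _]mulrA; apply: ler_wpM2l => //; rewrite natrM.
have xn0 : x != 0 by rewrite pnatr_eq0.
have x0 : 0 <= x by rewrite ler0n.
have xX (j : nat) : x ^+ j = x `^ j%:R by rewrite powR_mulrn.
have xD (a b : R) : x `^ a * x `^ b = x `^ (a + b) by rewrite powRD // xn0 implybT.
pose P0 := x `^ (X + (d1 + kk.+1)%:R).
have -> : x `^ (X + c%:R) = x ^+ (2 * d1.+1) * P0.
  by rewrite xX xD /c natrD; congr (_ `^ _); ring.
have P1 : 1 <= P0.
  rewrite -(powRr0 x); apply: ler_powR => //; apply: addr_ge0 => //.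
  exact: le_trans X0.
rewrite mulrACA.
apply: ler_pM => //.
  rewrite mulnC exprM -exprMn natrX lerXn2r ?nnegrE //.
    by rewrite mulr_ge0 // exprn_ge0.
  by rewrite -natrX -natrM ler_nat; exact: bits_modulus_le.
have X_ge0 : 0 <= X by apply: le_trans X0.
have hP (e : R) : e <= X + (d1 + kk.+1)%:R -> x `^ e <= P0 by exact: ler_powR.
have hPX (e : R) : e <= X -> x `^ e <= P0.
  by move=> eX; apply: hP; apply: le_trans eX _; rewrite lerDl.
have -> : ((doublings c1 d1 n).+1 + n ^ q + n.+1 ^ m + B)%:R =
    (doublings c1 d1 n).+1%:R + (n ^ q)%:R + (n.+1 ^ m)%:R + B%:R :> R by rewrite !natrD.
rewrite !(mulrDl _ _ P0) mul1r; apply: lerD; [apply: lerD; [apply: lerD|]|].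
- apply: (@le_trans _ _ ((c1 + 1)%:R * x ^+ d1)).
    by rewrite -natrX -natrM ler_nat mulnDl mul1n -addn1 leq_add // expn_gt0.
  apply: ler_wpM2l => //; rewrite xX; apply: hP.
  by rewrite natrD addrCA lerDl addr_ge0.
- by rewrite natrX xX; apply: hPX.
- apply: (@le_trans _ _ ((2 * n) ^ m)%:R).
    rewrite ler_nat; case: (posnP m) => [->|m0]; first by rewrite !expn0.
    by rewrite leq_exp2r // mul2n -addnn -addn1 leq_add2l.
  rewrite expnMn natrM !natrX; apply: ler_wpM2l; first exact: exprn_ge0.
  by rewrite xX; apply: hPX.
- rewrite /B -natr1; apply: lerD => //.
  apply: (@le_trans _ _ (C * x `^ (X + kk.+1%:R))).
    by rewrite truncn_le mulr_ge0 ?powR_ge0.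
  apply: ler_wpM2l => //; apply: hP.
  by rewrite lerD2l ler_nat leq_addl.
Qed.
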